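(* For each integer $n\ge 2$, there exists a unique irreducible polynomial $\alpha'_n$ with integer coefficients in $n+1$ variables, monic in its first variable, and homogeneous when the first variable is given degree $2$ and each of the remaining $n$ variables is given degree $1$, such that $\alpha'_n(16K^2, a_1^2,\ldots,a_n^2)=0$ whenever $a_1,\ldots,a_n$ are the lengths of the sides of a semicyclic $(n+1)$-gon excluding a diameter, and $K$ is its area. The total degree of $\alpha'_n$ (with respect to this grading) is $2\Delta'_n$, where $$\Delta'_n=\frac n2\binom{n-1}{\lfloor (n-1)/2\rfloor}.$$
   Context: Polygons are oriented closed polygons that may be non-convex and self-intersecting. The area $K$ of an oriented polygon is the signed area $\oint_C x\,dy$, where $C$ is its boundary curve. An $(n+1)$-gon is semicyclic if it is inscribed in a circle and one of its sides is a diameter of that circle; $a_1,\dots,a_n$ denote the lengths of its other $n$ sides. Equivalently, if the circle has radius $r$ and center $0$ in $\mathbb{C}$, the vertices are $v_1,\dots,v_n$ and $v_{n+1}=-v_1$ with $|v_i|=r$, and $a_i=|v_{i+1}-v_i|$ for $1\le i\le n$. *)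

(* Defs.v *)
(* MathComp / MathComp-Analysis with multinomials and real-closed.  The analysis
   files are imported one by one: importing the whole of all_analysis clashes
   with the notations of mpoly. *)
From mathcomp Require Import all_boot all_order all_algebra.
From mathcomp Require Import mpoly complex.
From mathcomp Require Import classical_sets reals measure normedtype derive.
From mathcomp Require Import lebesgue_measure lebesgue_integral.
From HB Require Import structures.

Set Implicit Arguments.
Unset Strict Implicit.
Unset Printing Implicit Defensive.

Import Order.TTheory GRing.Theory Num.Theory numFieldNormedType.Exports.

Local Open Scope ring_scope.
Local Open Scope complex_scope.

Section Polygons.
Variable R : realType.

(* \int_gamma x dy for a plane curve gamma : [0, 1] -> C, z = x + i y *)
Definition line_integral_xdy (gamma : R -> R[i]) : R :=
  (\int[lebesgue_measure]_(t in [set` `[0, 1]%R])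
     (complex.Re (gamma t) * derive1 (fun s => complex.Im (gamma s)) t))%R.

Definition segment (p q : R[i]) : R -> R[i] :=
  fun t => (1 - t)%:C * p + t%:C * q.

(* A closed polygon with m vertices is its cyclic sequence of vertices v;
   side i goes from v i to v (ordS i), ordS being the successor modulo m. *)
Definition side_length m (v : 'I_m -> R[i]) (i : 'I_m) : R :=
  Normc.normc (v (ordS i) - v i).

Definition signed_area m (v : 'I_m -> R[i]) : R :=
  \sum_(i < m) line_integral_xdy (segment (v i) (v (ordS i))).

(* An (n+1)-gon is labelled so that its diametral side is the closing one, from
   the last vertex to the first. *)
Definition semicyclic n (v : 'I_n.+1 -> R[i]) : Prop :=
  exists (c : R[i]) (r : R),
    [/\ 0 < r,
        forall i, Normc.normc (v i - c) = r
      & v ord_max - c = - (v ord0 - c)].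

End Polygons.

Definition irreducible_elt (A : idomainType) (p : A) : Prop :=
  [/\ p != 0, p \isn't a GRing.unit
    & forall q r : A, p = q * r -> q \is a GRing.unit \/ r \is a GRing.unit].

Section WeightedPolynomials.
Variable n : nat.

(* p as a univariate polynomial in its first variable 'X_0, with 'X_(j+1)
   becoming the j-th variable of the coefficients *)
Definition poly_in_first (p : {mpoly int[n.+1]}) : {poly {mpoly int[n]}} :=
  mmap (fun c : int => (c%:MP_[n])%:P)
       (fun i : 'I_n.+1 =>
          if unlift ord0 i is Some j then ('X_j : {mpoly int[n]})%:P else 'X) p.

Definition monic_in_first (p : {mpoly int[n.+1]}) : Prop :=
  poly_in_first p \is monic.

Definition wdeg (m : 'X_{1..n.+1}) : nat :=
  (\sum_(i < n.+1) m i * (if i == ord0 then 2 else 1))%N.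

Lemma wdeg0 : wdeg 0%MM = 0%N.
Proof. by rewrite /wdeg big1 // => i _; rewrite mnm0E. Qed.

Lemma wdegD : {morph wdeg : m1 m2 / (m1 + m2)%MM >-> (m1 + m2)%N}.
Proof.
move=> m1 m2; rewrite /wdeg -big_split /=; apply: eq_bigr => i _.
by rewrite mnmDE mulnDl.
Qed.

HB.instance Definition _ := mpoly.isMeasure.Build n.+1 wdeg wdeg0 wdegD.

(* mmeasure is one more than the degree, and 0 for the zero polynomial *)
Definition total_wdegree (p : {mpoly int[n.+1]}) : nat := (mmeasure wdeg p).-1.

Definition area_args (R : realType) (K : R) (a : 'I_n -> R) : 'I_n.+1 -> R :=
  fun i => if unlift ord0 i is Some j then a j ^+ 2 else 16 * K ^+ 2.

(* The sides other than the diameter are those indexed by lift ord_max j,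
   which has the same value as j : 'I_n. *)
Definition vanishes_on_semicyclic (R : realType) (p : {mpoly int[n.+1]}) : Prop :=
  forall v : 'I_n.+1 -> R[i], semicyclic v ->
    (map_mpoly (intr : int -> R) p).@[area_args (signed_area v)
        (fun j : 'I_n => side_length v (lift ord_max j))] = 0.

Definition semicyclic_area_poly (R : realType) (p : {mpoly int[n.+1]}) : Prop :=
  [/\ irreducible_elt p, monic_in_first p, p \is ishomog wdeg
    & vanishes_on_semicyclic R p].

End WeightedPolynomials.

Definition Delta' (n : nat) : rat := n%:R / 2 * 'C(n.-1, n.-1./2)%:R.

(* Main.v *)
(* Write the sides of a semicyclic polygon of diameter D as a_j = D sin t_j, where
   the t_j add up to pi/2. With q_j = exp(i t_j) the semicyclic polygons become the
   real points of an affine variety with coordinate ring T, in which they are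
   Zariski dense. A polynomial vanishes on all of them iff it lies in the kernel
   of Z[a_1^2, ..., a_n^2][u] -> T, u |-> 16 K^2 = (sum_j a_j b_j)^2, where
   b_j = D cos t_j. Since 16 K^2 is integral over the factorial ring Z[a_j^2], the
   kernel is generated by a monic polynomial alpha, by Gauss's lemma.

   Lower bound for the degree: varying the angles shows that D^2 is a rational
   function of 16 K^2 and the a_j^2, so that deg alpha is at least the degree d of
   the minimal polynomial S of D^2. On the curve of polygons with q_j^2 proportional
   to kap_j L or its inverse, S becomes a polynomial in L of degree at most 2 d which
   vanishes when L^(2|E|-n) = - prod_(j notin E) kap_j / prod_(j in E) kap_j for a
   set E of more than n/2 indices. For generic kap this gives
   sum_E (2|E| - n) = 2 Delta'_n distinct roots.

   Upper bound: with z_j = q_j^2, monomials in 4K and the a_j^2 are combinations of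
   D^(2w) times Laurent monomials in the z_j, and prod_j z_j = -1 allows one to
   normalize the median exponent to 0. Counting the normal forms gives a polynomial
   relation for 4K over Z[a_j^2] of degree at most 2 Delta'_n; complex conjugation
   makes it even in K. *)

Require Import Defs.
From mathcomp Require Import all_boot all_order all_algebra.
From mathcomp Require Import mpoly complex.
From mathcomp Require Import reals boolp generic_quotient separable.
From mathcomp Require Import ring zify lra.
Set Implicit Arguments.
Unset Strict Implicit.
Unset Printing Implicit Defensive.

(** * Binomial sums and medians *)

(** Why D^2 carries the lower bound: D^2 and the a_j^2 do not change when some z_j = q_j^2 is
    replaced by its inverse, while the area does. So a single curve of squared sides serves all sets
    E at once, and no branch of the area has to be followed along it.

    The number 2 Delta'_n = n C(n-1, floor((n-1)/2)) arises in two ways. Above, it counts the shapes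
    of normal forms: n places for the zero exponent, times the choices of floor((n-1)/2) nonpositive
    exponents among the others. Below, it is the sum of 2|E| - n over the large sets E, which
    telescopes. The bounds meet since the relation for 4K, being even, has degree at most Delta'_n
    in u, while S has degree at least Delta'_n and deg S <= deg alpha.

    The count above is asymptotic: at a high degree there are N = 2 Delta'_n times a binomial
    coefficient normal forms, against N + 1 times a slightly smaller one of candidate products. The
    ratio of the two binomials tends to 1, which forces a linear relation.

    T is a polynomial ring in the q_k and D / prod_k q_k, so varying the angles is purely algebraic:
    the vector fields are combinations of partial derivatives. *)

Lemma base_expansion_inj B n (g h : 'I_n -> nat) :
  (forall j, g j < B) -> (forall j, h j < B) ->
  \sum_j g j * B ^ j = \sum_j h j * B ^ j -> g =1 h.
Proof.
elim: n g h => [|n IH] g h gB hB; first by move=> _ [].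
rewrite !big_ord_recl expn0 !muln1.
have E f : \sum_(i < n) f (lift ord0 i) * B ^ (bump 0 i) =
    (\sum_(i < n) f (lift ord0 i) * B ^ i) * B.
  by rewrite big_distrl; apply: eq_bigr => i _; rewrite /bump expnSr mulnA.
rewrite !E => Egh; have g0 : g ord0 = h ord0.
  have := congr1 (modn^~ B) Egh.
  by rewrite [g _ + _]addnC [h _ + _]addnC /= !modnMDl !modn_small.
have B0 : 0 < B by apply: leq_trans (gB ord0).
move: Egh; rewrite g0 => /addnI /eqP; rewrite eqn_pmul2r // => /eqP Egh.
move=> j; have [k|] := unliftP ord0 j => -> //.
by apply: (IH (fun i => g (lift ord0 i)) (fun i => h (lift ord0 i))).
Qed.

(** The sum telescopes: with M = m + 1, absorption gives i C(M, i) = M C(M-1, i-1) and (M - i) C(M,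
    i) = M C(M-1, i). *)
Lemma sum_excess_bin m k : k <= m.+1 -> m.+1 <= 2 * k ->
  \sum_(k <= i < m.+2) 'C(m.+1, i) * (2 * i - m.+1) = m.+1 * 'C(m, k.-1).
Proof.
move=> km; have [j] := ubnP (m.+1 - k); elim: j k km => // j IH k km jk mk.
rewrite big_ltn //; have [k1|] := ltnP k m.+1; last first.
  move=> mk'; have -> : k = m.+1 by apply/eqP; rewrite eqn_leq km.
  by rewrite big_geq // addn0 !binn mul1n muln1 mul2n -addnn addnK.
rewrite IH //; [|lia|lia]; case: k km jk mk k1 => [|k] //= km jk mk k1.
have e1 : k.+1 * 'C(m.+1, k.+1) = m.+1 * 'C(m, k) by rewrite -mul_bin_diag.
have e2 : (m.+1 - k.+1) * 'C(m.+1, k.+1) = m.+1 * 'C(m, k.+1).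
  by rewrite -mul_bin_down mulnC.
rewrite -e1 -e2 mulnC -mulnDl; congr (_ * _); lia.
Qed.

(** Truncated subtraction keeps only the sets of more than half the indices, so this is the number
    of roots produced in the lower bound. *)
Lemma sum_excess_sets m :
  \sum_(A : {set 'I_m.+1}) (2 * #|A| - m.+1) = m.+1 * 'C(m, m./2).
Proof.
rewrite (partition_big (fun A : {set 'I_m.+1} => inord #|A| : 'I_m.+2) predT) //=.
have cA (A : {set 'I_m.+1}) : #|A| < m.+2 by rewrite ltnS -[X in _ <= X]card_ord max_card.
transitivity (\sum_(i < m.+2) 'C(m.+1, i) * (2 * i - m.+1)).
  apply: eq_bigr => i _; rewrite (eq_bigl (fun A : {set 'I_m.+1} => #|A| == i)); last first.
    by move=> A; rewrite -val_eqE /= inordK.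
  rewrite (eq_bigr (fun=> 2 * i - m.+1)) => [|A /eqP -> //].
  by rewrite sum_nat_const -cardsE card_draws card_ord.
rewrite -(big_mkord xpredT (fun i => 'C(m.+1, i) * (2 * i - m.+1))).
have h2 := odd_double_half m; rewrite -addnn in h2.
rewrite (@big_cat_nat _ _ _ (m.+1)./2.+1) /=; [|by []|by rewrite /=; lia].
rewrite big_nat_cond big1 ?add0n => [|i]; last first.
  rewrite andbT => /andP[_ iM]; apply/eqP; rewrite muln_eq0; apply/orP; right.
  have h3 := odd_double_half m.+1; rewrite -addnn in h3; lia.
rewrite sum_excess_bin; [|lia|lia]; congr (_ * _) => /=.
rewrite -bin_sub; last lia.
by congr 'C(_, _); lia.
Qed.

(** A Bernoulli inequality: the quotient of the two binomials is the product over 1 <= i <= m of 1 -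
    N / (w + N + i), hence at least 1 - m N / (w + N). *)
Lemma bin_shift_ge m w N :
  'C(m + w + N, m) * (w + N - m * N) <= 'C(m + w, m) * (w + N).
Proof.
elim: m => [|m IH]; first by rewrite !bin0 !mul1n mul0n subn0.
have [h|h] := leqP (w + N) (m.+1 * N).
  by move: h; rewrite -subn_eq0 => /eqP ->; rewrite muln0.
have hY : ((m + w).+1 + N) * (w + N - m.+1 * N) <= (m + w).+1 * (w + N - m * N).
  have -> : w + N - m * N = (w + N - m.+1 * N) + N by rewrite mulSn in h *; lia.
  have : w + N - m.+1 * N <= w by rewrite mulSn; lia.
  move: (w + N - _) => Y Yw; rewrite mulnDl mulnDr leq_add2l mulnC leq_mul2r.
  by rewrite (leq_trans Yw) ?orbT // ltnW // ltnS leq_addl.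
rewrite -(leq_pmul2l (ltn0Sn m)) !mulnA !addSn -!mul_bin_diag /=.
rewrite -mulnA mulnCA -[X in _ <= X]mulnA.
apply: leq_trans (_ : 'C(m + w + N, m) * ((m + w).+1 * (w + N - m * N)) <= _).
  by rewrite leq_mul2l -addSn hY orbT.
by rewrite mulnCA leq_mul2l IH orbT.
Qed.

Lemma bin_growth m N : exists w, N * 'C(m + (w + N), m) < N.+1 * 'C(m + w, m).
Proof.
(* The inequality N (w + N) < (N + 1) (w + N - m N) needed below amounts to w + N > (N + 1) m N. *)
pose w := (N.+1 * (m * N)).+1; exists w; rewrite addnA.
have := bin_shift_ge m w N.
have : 0 < 'C(m + w + N, m) by rewrite bin_gt0 -addnA leq_addr.
move: 'C(_, _) 'C(_, _) => a b a0 h.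
rewrite -(ltn_pmul2r (_ : 0 < w + N)) //.
have h2 : N * (w + N) < N.+1 * (w + N - m * N).
  by rewrite /w; move: (m * N) => M; nia.
apply: leq_trans (_ : N.+1 * (b * (w + N - m * N)) <= _).
  by rewrite mulnAC [N.+1 * _]mulnCA [_ * b]mulnC ltn_pmul2l.
by rewrite -mulnA leq_pmul2l.
Qed.

Lemma subset_between (I : finType) (A B : {set I}) k :
  A \subset B -> #|A| <= k <= #|B| ->
  exists2 S : {set I}, A \subset S /\ S \subset B & #|S| = k.
Proof.
move=> AB /andP[Ak kB]; elim: k Ak kB => [|k IH] Ak kB.
  by exists A => //; apply/eqP; rewrite eqn_leq Ak.
have [Ak'|Ak'] := eqVneq #|A| k.+1; first by exists A.
have [|S [AS SB] Sk] := IH _ (ltnW kB); first by rewrite -ltnS ltn_neqAle Ak'.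
have [x xB xS] : exists2 x, x \in B & x \notin S.
  apply/subsetPn; apply: contraTN kB => /subset_leq_card; rewrite Sk.
  by rewrite -ltnNge ltnS.
exists (x |: S); last by rewrite cardsU1 xS Sk.
by rewrite subUset sub1set xB SB (subset_trans AS) ?subsetUr.
Qed.

(** [i] minimizes [h] among the indices with more than m/2 values at or below theirs. Because of
    ties, [S] is interpolated between the indices strictly below [h i] and those at most [h i]. *)
Lemma median m (h : 'I_m.+1 -> int) : exists i : 'I_m.+1, exists2 S : {set 'I_m},
  #|S| = m./2 & forall k, if k \in S then (h (lift i k) <= h i)%R
                          else (h i <= h (lift i k))%R.
Proof.
pose cnt i := #|[set j | (h j <= h i)%R]|.
have [i0 i0P] : exists i0, m./2 < cnt i0.
  have [i0 _ i0max] := @Order.TotalTheory.arg_maxP _ _ 'I_m.+1 ord0 xpredT h isT.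
  exists i0; rewrite /cnt (_ : [set j | _] = setT); last by apply/setP => j; rewrite !inE; apply: i0max.
  by rewrite cardsT card_ord ltnS leq_half_double; lia.
have [i iP imin] := @Order.TotalTheory.arg_minP _ _ 'I_m.+1 i0 (fun i => m./2 < cnt i) h i0P.
have lt_cnt : #|[set j | (h j < h i)%R]| <= m./2.
  rewrite leqNgt; apply/negP => gt.
  have [j0 j0P] : exists j0, j0 \in [set j | (h j < h i)%R].
    by apply/set0Pn; rewrite -card_gt0 (leq_trans _ gt).
  rewrite inE in j0P.
  have [j ji jmax] := @Order.TotalTheory.arg_maxP _ _ 'I_m.+1 j0 (fun j => (h j < h i)%R) h j0P.
  suff : (h i <= h j)%R by rewrite Order.TotalTheory.leNgt ji.
  apply: imin; apply: leq_trans gt _; apply: subset_leq_card; apply/subsetP => l lP.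
  by move: lP; rewrite !inE; apply: jmax.
pose lo := [set k | (h (lift i k) < h i)%R]; pose hi := [set k | (h (lift i k) <= h i)%R].
have c_lo : #|lo| <= m./2.
  apply: leq_trans lt_cnt; rewrite -(card_imset _ (@lift_inj _ i)); apply: subset_leq_card.
  by apply/subsetP => _ /imsetP[k kP ->]; move: kP; rewrite !inE.
have c_hi : m./2 <= #|hi|.
  rewrite -ltnS; apply: leq_trans iP _; rewrite -(card_imset _ (@lift_inj _ i)).
  rewrite -add1n -[1%N](cards1 i); apply: leq_trans (leq_card_setU _ _).
  apply: subset_leq_card; apply/subsetP => j; rewrite !inE.
  case: (unliftP i j) => [k ->|->] jP; last by rewrite eqxx.
  by apply/orP; right; apply/imsetP; exists k; rewrite ?inE.
have lohi : lo \subset hi by apply/subsetP => k; rewrite !inE; apply: Order.POrderTheory.ltW.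
have [|S [loS Shi] cS] := subset_between lohi (k := m./2); first by rewrite c_lo.
exists i, S => // k; case: ifP => kS.
  by have := subsetP Shi _ kS; rewrite inE.
rewrite Order.TotalTheory.leNgt; apply/negP => kl; case/negP: (negbT kS).
by apply: (subsetP loS); rewrite inE.
Qed.

Import Order.TTheory GRing.Theory Num.Theory.
Local Open Scope ring_scope.

(** * Factorial domains and Gauss's lemma *)

Section Divisibility.
Variable A : idomainType.
Implicit Types a b c p : A.

Definition rdvd a b := exists c, b = a * c.

Definition prime_elt p :=
  [/\ p != 0, p \isn't a GRing.unit
    & forall a b, rdvd p (a * b) -> rdvd p a \/ rdvd p b].

Definition factored a :=
  exists u (s : seq A), [/\ u \is a GRing.unit,
    {in s, forall p, prime_elt p} & a = u * \prod_(p <- s) p].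

Lemma rdvd0 a : rdvd a 0. Proof. by exists 0; rewrite mulr0. Qed.

Lemma rdvd_mull a b c : rdvd a b -> rdvd a (b * c).
Proof. by case=> d ->; exists (d * c); rewrite mulrA. Qed.

Lemma rdvd_mulr a b c : rdvd a b -> rdvd a (c * b).
Proof. by rewrite mulrC; apply: rdvd_mull. Qed.

Lemma rdvdD a b c : rdvd a b -> rdvd a c -> rdvd a (b + c).
Proof. by case=> x -> [y ->]; exists (x + y); rewrite mulrDr. Qed.

Lemma rdvdB a b c : rdvd a b -> rdvd a c -> rdvd a (b - c).
Proof. by case=> x -> [y ->]; exists (x - y); rewrite mulrBr. Qed.

Lemma rdvd_trans a b c : rdvd a b -> rdvd b c -> rdvd a c.
Proof. by case=> x -> [y ->]; exists (x * y); rewrite mulrA. Qed.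

Lemma rdvd_sum (I : Type) (r : seq I) (P : pred I) (F : I -> A) a :
  (forall i, P i -> rdvd a (F i)) -> rdvd a (\sum_(i <- r | P i) F i).
Proof.
move=> dF; elim/big_rec: _ => [|i x Pi]; first exact: rdvd0.
by apply: rdvdD; apply: dF.
Qed.

Lemma prime_rdvd_factored p u (s : seq A) :
  prime_elt p -> u \is a GRing.unit -> rdvd p (u * \prod_(q <- s) q) ->
  exists2 q, q \in s & rdvd p q.
Proof.
case=> p0 pU pP uU.
have pNu x : x \is a GRing.unit -> ~ rdvd p x.
  move=> xU [c xE]; move: xU; rewrite xE unitrM => /andP[pU' _].
  by rewrite pU' in pU.
case/pP => [/(pNu _ uU)//|].
elim: s => [|q s IH]; first by rewrite big_nil => /(pNu _ (unitr1 _)).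
rewrite big_cons => /pP[dq|/IH[r rs dr]]; first by exists q; rewrite ?mem_head.
by exists r; rewrite // inE rs orbT.
Qed.

Lemma prime_rdvd_prime p q :
  prime_elt p -> prime_elt q -> rdvd p q -> rdvd q p.
Proof.
move=> [p0 pU pP] [q0 qU qP] [c qE].
have [[d pE]|[d cE]] := qP p c (ex_intro _ 1 (etrans (esym qE) (esym (mulr1 q)))).
  by exists d.
case/negP: pU; apply/unitrP; exists d.
have: q * (p * d) = q * 1 by rewrite mulrCA -cE -qE mulr1.
by move/(mulfI q0) => pd1; rewrite mulrC pd1.
Qed.

Lemma factoredM a b : factored a -> factored b -> factored (a * b).
Proof.
move=> [u [s [uU sP ->]]] [v [t [vU tP ->]]].
exists (u * v), (s ++ t); split; first by rewrite unitrM uU.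
  by move=> p; rewrite mem_cat => /orP[/sP|/tP].
by rewrite big_cat /= mulrACA.
Qed.

Lemma factored_unit u : u \is a GRing.unit -> factored u.
Proof. by move=> uU; exists u, [::]; split=> //; rewrite big_nil mulr1. Qed.

Lemma factored_prime p : prime_elt p -> factored p.
Proof.
move=> pP; exists 1, [:: p]; split; rewrite ?unitr1 ?big_seq1 ?mul1r //.
by move=> q; rewrite inE => /eqP ->.
Qed.

End Divisibility.

(** Factors are prime rather than irreducible: uniqueness is then automatic, and existence is the
    whole content. *)
Definition factorial_domain (A : idomainType) :=
  forall a : A, a != 0 -> factored a.

Lemma factorial_int : factorial_domain int.
Proof.
have prime_int (p : nat) : prime p -> prime_elt (p%:Z).
  move=> pp; split.
  - by rewrite eqz_nat -lt0n prime_gt0.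
  - rewrite unfold_in /=; apply/negP => /orP[/eqP [E]|/eqP//].
    by rewrite E in pp.
  have dE x : rdvd p%:Z x <-> (p %| `|x|)%N.
    split=> [[c ->]|]; first by rewrite abszM dvdn_mulr.
    by move=> dx; have /dvdzP[q ->] : (p %| x)%Z by []; exists q; rewrite mulrC.
  by move=> a b; rewrite !dE abszM Euclid_dvdM // => /orP.
have nat_fact n : (0 < n)%N -> factored n%:Z.
  elim/ltn_ind: n => n IH n0; have [n1|n1] := leqP n 1.
    by apply: factored_unit; rewrite (_ : n = 1%N) //; apply/eqP; rewrite eqn_leq n1.
  have pp := pdiv_prime n1; have dn := pdiv_dvd n.
  rewrite -(divnK dn) PoszM; apply: factoredM; last exact/factored_prime/prime_int.
  by apply: IH; rewrite ?ltn_Pdiv ?prime_gt1 // divn_gt0 ?prime_gt0 // dvdn_leq.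
move=> a a0; rewrite -[a]mulz_sign_abs; apply: factoredM.
  by apply: factored_unit; case: (a < 0).
by apply: nat_fact; rewrite absz_gt0.
Qed.

Section PolyFactorial.
Variable A : idomainType.
Implicit Types (a c p : A) (f g h : {poly A}).

Lemma rdvd_polyC p f : rdvd p%:P f <-> forall i, rdvd p f`_i.
Proof.
split=> [[g ->] i|df]; first by exists g`_i; rewrite coefCM.
have [F FE] := choice df; exists (\poly_(i < size f) F i).
apply/polyP => i; rewrite coefCM coef_poly; case: ltnP => [_|fi] //.
by rewrite mulr0 nth_default.
Qed.

Lemma prime_polyC p : prime_elt p -> prime_elt p%:P.
Proof.
case=> p0 pU pP; split; first by rewrite polyC_eq0.
  by rewrite poly_unitE coefC negb_and pU orbT.
have first_coef f : ~ rdvd p%:P f ->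
    exists i, ~ rdvd p f`_i /\ forall j, (j < i)%N -> rdvd p f`_j.
  move=> nf; have ex : exists i, `[< ~ rdvd p f`_i >].
    apply: contrapT => nex; apply: nf; apply/rdvd_polyC => i.
    by apply: contrapT => ni; apply: nex; exists i; apply/asboolP.
  case: (ex_minnP ex) => i /asboolP ni imin; exists i; split=> // j ji.
  by apply: contrapT => /asboolP /imin; rewrite leqNgt ji.
move=> f g dfg; apply: contrapT => /not_orP[/first_coef[i [ni fi]] /first_coef[j [nj gj]]].
have /rdvd_polyC /(_ (i + j)%N) := dfg; rewrite coefM.
have ij : (i < (i + j).+1)%N by rewrite ltnS leq_addr.
(* In degree i + j, with i and j the lowest degrees of coefficients not divisible by p, every
   product but f_i g_j is divisible by p. *)
rewrite (bigD1 (Ordinal ij)) //= => dsum.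
have : rdvd p (f`_i * g`_(i + j - i)).
  rewrite -[X in rdvd _ X](addrK (\sum_(k < (i + j).+1 | k != Ordinal ij)
    f`_k * g`_(i + j - k))); apply: rdvdB => //.
  apply: rdvd_sum => k kNi; have [ki|ik|ki] := ltngtP k i.
  - exact/rdvd_mull/fi.
  - by apply/rdvd_mulr/gj; rewrite ltn_subLR ?ltn_add2r // -ltnS.
  - by move: kNi; rewrite -val_eqE /= ki eqxx.
by rewrite addKn => /pP[].
Qed.

Lemma scale_polyI a : a != 0 -> injective (fun f => a *: f).
Proof. by move=> a0 f g; rewrite -!mul_polyC => /mulfI; apply; rewrite polyC_eq0. Qed.

Hypothesis factA : factorial_domain A.

(** Each prime factor of [c] divides [f] or [g] by [prime_polyC], so the primes are cancelled one at
    a time. *)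
Lemma strip_content c f g h : c != 0 -> c *: h = f * g ->
  exists c1 c2 f' g', [/\ c1 != 0, c2 != 0, f = c1 *: f', g = c2 *: g'
    & h = f' * g'].
Proof.
move=> /factA[u [s [uU sP ->]]].
elim: s f g sP => [|p s IH] f g sP.
  rewrite big_nil mulr1 => hE; have u0 : u != 0 by apply: contraTneq uU => ->; rewrite unitr0.
  exists u, 1, (u^-1 *: f), g; rewrite oner_eq0 u0 !scalerA divrr // !scale1r.
  split=> //; apply: (scale_polyI u0); rewrite hE -scalerAl scalerA divrr ?scale1r //.
rewrite big_cons mulrCA -scalerA => hE.
have pP : prime_elt p by apply: sP; rewrite mem_head.
have sP' : {in s, forall q, prime_elt q} by move=> q qs; apply: sP; rewrite inE qs orbT.
have p0 : p != 0 by case: pP.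
have dfg : rdvd p%:P (f * g) by rewrite -hE -mul_polyC; exists (u * \prod_(j <- s) j *: h).
have [_ _ /(_ f g dfg)] := prime_polyC pP.
case=> [] [k kE]; rewrite mul_polyC in kE.
  have [|c1 [c2 [f' [g' [c10 c20 kE' gE hE']]]]] := IH k g sP'.
    by apply: (scale_polyI p0); rewrite hE kE scalerAl.
  exists (p * c1), c2, f', g'; rewrite mulf_neq0 //; split=> //.
  by rewrite kE kE' scalerA.
have [|c1 [c2 [f' [g' [c10 c20 fE kE' hE']]]]] := IH f k sP'.
  by apply: (scale_polyI p0); rewrite hE kE scalerAr.
exists c1, (p * c2), f', g'; rewrite mulf_neq0 //; split=> //.
by rewrite kE kE' scalerA.
Qed.

(* [f] divides [h] over the fraction field, with denominators cleared by [c]. *)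
Lemma gauss_monic c (f g h : {poly A}) : h \is monic -> c != 0 ->
  c *: h = f * g -> exists2 f', f' \is monic & f = lead_coef f *: f'.
Proof.
move=> /monicP hm c0 /(strip_content c0)[c1 [c2 [f' [g' [c10 c20 fE gE hE]]]]].
have lfg : lead_coef f' * lead_coef g' = 1 by rewrite -lead_coefM -hE.
exists (lead_coef g' *: f'); first by rewrite monicE lead_coefZ mulrC lfg.
by rewrite fE lead_coefZ scalerA -mulrA lfg mulr1.
Qed.

Definition primitive f := forall p, prime_elt p -> ~ rdvd p%:P f.

Lemma primitive_rdvd f c g h :
  primitive f -> c != 0 -> c *: h = f * g -> rdvd f h.
Proof.
move=> pf c0 /(strip_content c0)[c1 [c2 [f' [g' [c10 c20 fE _ ->]]]]].
have [u [[|p s] [uU sP c1E]]] := factA c10.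
  rewrite big_nil mulr1 in c1E; exists (c1^-1 *: g').
  by rewrite fE -scalerAl -scalerAr scalerA c1E divrr // scale1r.
case: (pf p); first by apply: sP; rewrite mem_head.
rewrite fE c1E big_cons mulrCA -scalerA -mul_polyC.
by exists (u * \prod_(j <- s) j *: f').
Qed.

(** Let f divide g h. If f and g are coprime over the fraction field, Bezout makes f divide a
    constant multiple of h, and primitivity removes the constant. Otherwise their gcd is f up to
    constants, as f has no proper factor of positive degree. *)
Lemma prime_primitive f : primitive f -> (1 < size f)%N ->
  (forall g h, f = g * h -> (size g <= 1)%N \/ (size h <= 1)%N) ->
  prime_elt f.
Proof.
move=> pf f1 irr; have f0 : f != 0 by rewrite -size_poly_gt0 ltnW.
split=> // [|g h [k ghE]]; first by rewrite poly_unitE; case: eqP f1 => // ->.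
have [cop|ncop] := boolP (coprimep f g).
  have /Pdiv.Idomain.Bezout_coprimepP[[u v] /= /Pdiv.Idomain.eqpP[[c1 c2] /= /andP[c10 c20] E]] := cop.
  right; apply: (primitive_rdvd (c := c2) (g := c1 *: (u * h + v * k))) => //.
  rewrite -[h]mul1r scalerAl -E -!scalerAl -scalerAr; congr (_ *: _).
  by rewrite mulrDl -(mulrA v) ghE; ring.
left; have := Pdiv.Idomain.dvdp_gcdl f g; set d := gcdp f g => df.
have d1 : (1 < size d)%N.
  rewrite ltn_neqAle size_poly_gt0 gcdp_eq0 negb_and f0 andbT eq_sym.
  by rewrite -Pdiv.Idomain.coprimep_def.
have /Pdiv.Idomain.dvdpP[[c q] /= c0 fE] := df.
have [c1 [c2 [q' [d' [c10 c20 qE dE fE']]]]] := strip_content c0 fE.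
have sd' : size d' = size d by rewrite dE size_scale.
have q1 : size q' = 1%N.
  case: (irr _ _ fE') => [q1|]; last by rewrite sd' leqNgt d1.
  apply/eqP; rewrite eqn_leq q1 size_poly_gt0; apply: contraNneq f0 => q0.
  by rewrite fE' q0 mul0r.
have /size_poly1P[e e0 q'E] : size q' == 1%N by rewrite q1.
have /Pdiv.Idomain.dvdpP[[b r] /= b0 gE] := Pdiv.Idomain.dvdp_gcdr f g.
apply: (primitive_rdvd (c := e * b) (g := c2 *: r)); rewrite ?mulf_neq0 //.
rewrite -scalerA gE -/d dE fE' q'E -!scalerAr scalerA mul_polyC -scalerAl scalerA.
by rewrite mulrC [d' * r]mulrC.
Qed.

(** Induction on the size, then on the number of prime factors of the leading coefficient. A
    constant prime dividing f divides that coefficient, so either one of these primes can be split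
    off or f is primitive. *)
Lemma factorial_poly : factorial_domain {poly A}.
Proof.
move=> f; have [n] := ubnP (size f); elim: n f => // n IH f fn f0.
have prim g : g != 0 -> (size g <= n)%N -> primitive g -> factored g.
  move=> g0 gn pg; have [g1|g1] := leqP (size g) 1.
    have [c gE] : exists c, g = c%:P by exists g`_0; apply: size1_polyC.
    have [u [[|p s] [uU sP cE]]] : factored c by apply: factA; rewrite gE polyC_eq0 in g0.
      by apply: factored_unit; rewrite gE cE big_nil mulr1 poly_unitE size_polyC coefC
        (contraTneq _ uU) // => ->; rewrite unitr0.
    case: (pg p); first by apply: sP; rewrite mem_head.
    by rewrite gE cE big_cons mulrCA polyCM; exists (u * \prod_(j <- s) j)%:P.
  have [[a [b [gE [a1 b1]]]]|nab] :=
      pselect (exists a b : {poly A}, g = a * b /\ (1 < size a)%N /\ (1 < size b)%N).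
    have a0 : a != 0 by rewrite -size_poly_gt0 ltnW.
    have b0 : b != 0 by rewrite -size_poly_gt0 ltnW.
    have sg : size g = (size a + size b).-1 by rewrite gE size_mul.
    rewrite gE; apply: factoredM; apply: IH => //; apply: leq_trans gn; rewrite sg.
      by move: b1; case: (size b) => [|[|m]] // _; rewrite !addnS ltnS leq_addr.
    by move: a1; case: (size a) => [|[|m]] // _; rewrite !addSn ltnS leq_addl.
  apply/factored_prime/prime_primitive => // a b gE; apply: contrapT.
  move=> /not_orP[/negP a1 /negP b1]; apply: nab; exists a, b.
  by rewrite !ltnNge.
have: lead_coef f != 0 by rewrite lead_coef_eq0.
move=> /factA[u [s [uU]]].
elim: {s}(size s) {-2}s (erefl (size s)) f f0 fn => [|k IHk] s sk f f0 fn sP lfE.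
  apply: prim => // p pP /rdvd_polyC /(_ (size f).-1).
  rewrite -lead_coefE lfE => /(prime_rdvd_factored pP uU)[q].
  by case: s sk {sP lfE}.
have [[p [ps [g fE]]]|nps] := pselect (exists p, p \in s /\ rdvd p%:P f).
  have pP := sP _ ps; have p0 : p != 0 by case: pP.
  have g0 : g != 0 by apply: contraNneq f0 => g0; rewrite fE g0 mulr0.
  rewrite fE; apply: factoredM; first exact/factored_prime/prime_polyC.
  apply: (IHk (rem p s)) => //.
  - by rewrite size_rem // sk.
  - by move: fn; rewrite fE mul_polyC size_scale.
  - by move=> q /mem_rem; apply: sP.
  apply: (mulfI p0); have := lfE; rewrite fE mul_polyC lead_coefZ => ->.
  by rewrite (perm_big _ (perm_to_rem ps)) big_cons mulrCA.
apply: prim => // p pP dpf; have /rdvd_polyC /(_ (size f).-1) := dpf.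
rewrite -lead_coefE lfE => /(prime_rdvd_factored pP uU)[q qs pq].
apply: nps; exists q; split=> //; apply: rdvd_trans dpf.
by have [c ->] := prime_rdvd_prime pP (sP _ qs) pq; exists c%:P; rewrite polyCM.
Qed.
End PolyFactorial.

(** * Multivariate polynomials as polynomials in their first variable *)

Lemma mpoly_ext n (K : comNzRingType) (S : nzRingType)
    (f g : {rmorphism {mpoly K[n]} -> S}) :
  (forall c, f c%:MP = g c%:MP) -> (forall i, f 'X_i = g 'X_i) -> f =1 g.
Proof.
move=> fgC fg p; rewrite [p]mpolyE !rmorph_sum; apply: eq_bigr => m _.
rewrite -mul_mpolyC !rmorphM fgC; congr (_ * _).
by rewrite mpolyXE_id !rmorph_prod; apply: eq_bigr => i _; rewrite !rmorphXn /= fg.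
Qed.

Lemma mpoly_int_ext n (S : nzRingType) (f g : {rmorphism {mpoly int[n]} -> S}) :
  (forall i, f 'X_i = g 'X_i) -> f =1 g.
Proof. by apply: mpoly_ext => c; rewrite -[c]intz !rmorph_int. Qed.

Section FirstVariable.
Variables (K : comNzRingType) (n : nat).

Definition first_var (i : 'I_n.+1) : {poly {mpoly K[n]}} :=
  if unlift ord0 i is Some j then ('X_j)%:P else 'X.

Definition to_poly : {rmorphism {mpoly K[n.+1]} -> {poly {mpoly K[n]}}} :=
  mmap (polyC \o @mpolyC n K) first_var.

Definition shift_var : {rmorphism {mpoly K[n]} -> {mpoly K[n.+1]}} :=
  mmap (@mpolyC n.+1 K) (fun j => 'X_(lift ord0 j)).

Definition of_poly : {rmorphism {poly {mpoly K[n]}} -> {mpoly K[n.+1]}} :=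
  horner_eval ('X_ord0) \o map_poly shift_var.

Lemma to_polyX0 : to_poly 'X_ord0 = 'X.
Proof. by rewrite /= mmapX mmap1U /first_var unlift_none. Qed.

Lemma to_polyXS j : to_poly 'X_(lift ord0 j) = ('X_j)%:P.
Proof. by rewrite /= mmapX mmap1U /first_var liftK. Qed.

Lemma to_polyC c : to_poly c%:MP = c%:MP%:P.
Proof. by rewrite /= mmapC. Qed.

Lemma shift_varC c : shift_var c%:MP = c%:MP.
Proof. by rewrite /= mmapC. Qed.

Lemma shift_varX j : shift_var 'X_j = 'X_(lift ord0 j).
Proof. by rewrite /= mmapX mmap1U. Qed.

Lemma of_polyX : of_poly 'X = 'X_ord0.
Proof. by rewrite /= map_polyX /horner_eval hornerX. Qed.

Lemma of_polyC c : of_poly c%:P = shift_var c.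
Proof. by rewrite /= map_polyC /horner_eval hornerC. Qed.

Lemma to_polyK : cancel to_poly of_poly.
Proof.
move=> p; apply: (mpoly_ext (f := of_poly \o to_poly) (g := idfun)) => [c|i].
  by rewrite [LHS](congr1 of_poly (to_polyC c)) of_polyC shift_varC.
have [j|] := unliftP ord0 i => ->.
  by rewrite [LHS](congr1 of_poly (to_polyXS j)) of_polyC shift_varX.
by rewrite [LHS](congr1 of_poly to_polyX0) of_polyX.
Qed.

Lemma of_polyK : cancel of_poly to_poly.
Proof.
have toS q : to_poly (shift_var q) = q%:P.
  apply: (mpoly_ext (f := to_poly \o shift_var) (g := polyC)) => [c|i].
    by rewrite [LHS](congr1 to_poly (shift_varC c)) to_polyC.
  by rewrite [LHS](congr1 to_poly (shift_varX i)) to_polyXS.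
elim/poly_ind=> [|p c IH]; first by rewrite !rmorph0.
by rewrite rmorphD rmorphM of_polyX of_polyC rmorphD rmorphM IH to_polyX0 toS.
Qed.

Lemma to_poly_eval (v : 'I_n.+1 -> K) p :
  (map_poly (meval (fun j => v (lift ord0 j))) (to_poly p)).[v ord0] = p.@[v].
Proof.
pose w j := v (lift ord0 j).
apply: (mpoly_ext (f := horner_eval (v ord0) \o (map_poly (meval w) \o to_poly))
  (g := meval v)) => [c|i] /=.
  by rewrite mmapC /= map_polyC /horner_eval hornerC /= !mevalC.
rewrite mmapX mmap1U mevalXU /first_var; have [j ->|->] := unliftP ord0 i.
  by rewrite map_polyC /horner_eval hornerC /= mevalXU.
by rewrite map_polyX /horner_eval hornerX.
Qed.

End FirstVariable.
Arguments to_poly {K n}.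
Arguments of_poly {K n}.
Arguments shift_var {K n}.

Lemma poly_in_firstE n (p : {mpoly int[n.+1]}) : poly_in_first p = to_poly p.
Proof. by []. Qed.

(** * Vanishing on infinite grids, and factoriality of integral polynomial rings *)

Definition infinitely_many (K : Type) (S : K -> Prop) :=
  exists2 f : nat -> K, injective f & forall k, S (f k).

Lemma poly_zero_on (K : idomainType) (S : K -> Prop) (p : {poly K}) :
  infinitely_many S -> (forall x, S x -> p.[x] = 0) -> p = 0.
Proof.
move=> [f finj fS] p0; apply: (@roots_geq_poly_eq0 _ p (map f (iota 0 (size p)))).
- by apply/allP => x /mapP[k _ ->]; apply/rootP/p0.
- by rewrite map_inj_uniq ?iota_uniq.
- by rewrite size_map size_iota.
Qed.

Lemma mpoly_zero_on (K : idomainType) n (S : 'I_n -> K -> Prop) (p : {mpoly K[n]}) :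
  (forall i, infinitely_many (S i)) ->
  (forall v, (forall i, S i (v i)) -> p.@[v] = 0) -> p = 0.
Proof.
elim: n S p => [|n IH] S p Sinf p0.
  by have := p0 (fun=> 0) (fun i => match notF (ltn_ord i) with end);
    rewrite [p]nvar0_mpolyC mevalC => ->.
apply: (can_inj (@to_polyK K n)); rewrite rmorph0; apply/polyP => k; rewrite coef0.
apply: (IH (fun i => S (lift ord0 i))) => // v Sv.
have: map_poly (meval v) (to_poly p) = 0.
  apply: (poly_zero_on (Sinf ord0)) => x Sx.
  pose w i := if unlift ord0 i is Some j then v j else x.
  have wS j : w (lift ord0 j) = v j by rewrite /w liftK.
  have w0 : w ord0 = x by rewrite /w unlift_none.
  rewrite -(p0 w) => [|i]; last by case: (unliftP ord0 i) => [j|] ->; rewrite ?wS ?w0.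
  rewrite -to_poly_eval w0; congr (_.[_]); apply: eq_map_poly => q.
  by apply: meval_eq => j; rewrite wS.
by move/(congr1 (fun q : {poly K} => q`_k)); rewrite coef_map coef0.
Qed.

Lemma factorial_iso (A B : idomainType) (f : {rmorphism A -> B})
    (g : {rmorphism B -> A}) :
  cancel f g -> cancel g f -> factorial_domain A -> factorial_domain B.
Proof.
move=> fK gK factA b b0.
have fU a : a \is a GRing.unit -> f a \is a GRing.unit by apply: rmorph_unit.
have fP p : prime_elt p -> prime_elt (f p).
  case=> p0 pU pP; split.
  - by apply: contraNneq p0 => fp0; rewrite -[p]fK fp0 rmorph0.
  - by apply: contra pU => /(rmorph_unit g); rewrite fK.
  - have dE a : rdvd (f p) a -> rdvd p (g a).
      by case=> c ->; exists (g c); rewrite rmorphM fK.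
    have dE' a : rdvd p (g a) -> rdvd (f p) a.
      by case=> c E; exists (f c); rewrite -rmorphM -E gK.
    by move=> a c /dE; rewrite rmorphM => /pP[/dE'|/dE']; [left|right].
have [|u [s [uU sP gE]]] := factA (g b).
  by apply: contraNneq b0 => gb0; rewrite -[b]gK gb0 rmorph0.
exists (f u), (map f s); split; first exact: fU.
  by move=> q /mapP[p ps ->]; apply/fP/sP.
by rewrite big_map -rmorph_prod -rmorphM -gE gK.
Qed.

Lemma factorial_mpoly n : factorial_domain {mpoly int[n]}.
Proof.
elim: n => [|n IH].
  apply: (@factorial_iso _ _ (@mpolyC 0 int) (@mcoeff 0 int 0%MM)) factorial_int.
    exact: mpolyCK.
  by move=> p; rewrite [RHS]nvar0_mpolyC.
apply: (@factorial_iso {poly {mpoly int[n]}} {mpoly int[n.+1]} of_poly to_poly).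
- exact: of_polyK.
- exact: to_polyK.
- exact: factorial_poly.
Qed.

(** * Minimal polynomials of integral elements *)

Local Open Scope quotient_scope.

Lemma common_denominator (A : idomainType) (I : finType) (w : I -> {fraction A}) :
  exists d : A, exists v : I -> A, d != 0 /\ forall i, tofrac d * w i = tofrac (v i).
Proof.
have den (x : {fraction A}) : exists d a : A, d != 0 /\ tofrac d * x = tofrac a.
  elim/quotW: x => x; exists \d_x, \n_x; split; first exact: denom_ratioP.
  rewrite /GRing.mul /= !piE; apply/eqmodP; rewrite /= FracField.equivfE.
  by rewrite /FracField.mulf !numden_Ratio ?(oner_eq0, mulf_neq0, denom_ratioP) //
    !mulr1 mul1r mulrC.
have /choice[d dP] : forall i, exists d : A, exists a, d != 0 /\ tofrac d * w i = tofrac a.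
  by move=> i; apply: den.
have [a aP] := choice dP.
exists (\prod_i d i), (fun i => (\prod_(j | j != i) d j) * a i); split.
  by apply/prodf_neq0 => i _; case: (aP i).
move=> i; have [_ E] := aP i.
by rewrite (bigD1 i) //= [d i * _]mulrC !tofracM -mulrA E.
Qed.

Local Close Scope quotient_scope.

(** A kernel vector over the fraction field, with its denominators cleared. *)
Lemma lin_dep (A : idomainType) (I J : finType) (M : I -> J -> A) :
  (#|J| < #|I|)%N ->
  exists v : I -> A, (exists i, v i != 0) /\ forall j, \sum_i v i * M i j = 0.
Proof.
move=> JI; pose N := \matrix_(i < #|I|, j < #|J|) tofrac (M (enum_val i) (enum_val j)).
have : kermx N != 0.
  rewrite -mxrank_eq0 mxrank_ker subn_eq0 -ltnNge.
  exact: leq_ltn_trans (rank_leq_col _) JI.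
case/rowV0Pn=> w /sub_kermxP wN w0.
have [d [v [d0 vE]]] := common_denominator (fun i : I => w 0 (enum_rank i)).
exists v; split.
  have [i wi] : exists i, w 0 i != 0.
    apply: contrapT => nw; case/negP: w0; apply/eqP/rowP => i; rewrite mxE.
    by apply: contrapT => /eqP wi; apply: nw; exists i.
  exists (enum_val i); rewrite -tofrac_eq0 -vE enum_valK mulf_neq0 //.
  by rewrite tofrac_eq0.
move=> j; apply/eqP; rewrite -tofrac_eq0 raddf_sum /=; apply/eqP.
have := congr1 (fun z : 'rV__ => tofrac d * z 0 (enum_rank j)) wN.
rewrite !mxE mulr0 mulr_sumr => E; rewrite -[RHS]E.
rewrite [RHS](reindex enum_rank) /=; last by apply: onW_bij; apply: enum_rank_bij.
by apply: eq_bigr => i _; rewrite tofracM -vE mxE !enum_rankK mulrA.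
Qed.

Section Evaluation.
Variables (A T : comNzRingType) (psi : {rmorphism A -> T}).

Definition ev (w : T) : {rmorphism {poly A} -> T} := horner_eval w \o map_poly psi.

Lemma evX w : ev w 'X = w.
Proof. by rewrite /= map_polyX /horner_eval hornerX. Qed.

Lemma evC w a : ev w a%:P = psi a.
Proof. by rewrite /= map_polyC /horner_eval hornerC. Qed.

Lemma evZ w a p : ev w (a *: p) = psi a * ev w p.
Proof. by rewrite -mul_polyC rmorphM evC. Qed.

Lemma evE w (p : {poly A}) : ev w p = \sum_(i < size p) psi p`_i * w ^+ i.
Proof.
rewrite -[p in LHS]coefK poly_def rmorph_sum; apply: eq_bigr => i _.
by rewrite evZ rmorphXn evX.
Qed.

End Evaluation.

Section MinimalPolynomial.
Variables (A T : idomainType) (psi : {rmorphism A -> T}).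
Hypothesis factA : factorial_domain A.
Hypothesis psi_inj : forall a, psi a = 0 -> a = 0.

(** Let mu have least size among the nonzero polynomials killing w. Pseudo-division of the integral
    equation by mu leaves remainder 0, so mu divides a monic polynomial over the fraction field, and
    Gauss's lemma makes it a constant multiple of a monic one, by which Euclidean division is
    possible. *)
Lemma minpoly_exists w : integralOver psi w ->
  exists alpha : {poly A}, [/\ alpha \is monic, ev psi w alpha = 0
    & forall p, ev psi w p = 0 -> exists q, p = q * alpha].
Proof.
case=> M Mmon /rootP MK.
have evM : ev psi w M = 0 by [].
have ex : exists n, `[< exists2 p : {poly A}, p != 0 /\ ev psi w p = 0 & size p = n >].
  by exists (size M); apply/asboolP; exists M; rewrite ?monic_neq0.
case: (ex_minnP ex) => n /asboolP[mu [mu0 evmu] mun] minn.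
have small (r : {poly A}) : ev psi w r = 0 -> (size r < n)%N -> r = 0.
  move=> evr; apply: contraPeq => r0; apply/negP; rewrite -leqNgt.
  by apply: minn; apply/asboolP; exists r.
have lmu0 : lead_coef mu != 0 by rewrite lead_coef_eq0.
have [alpha amon muE] : exists2 f, f \is monic & mu = lead_coef mu *: f.
  apply: (@gauss_monic _ factA (lead_coef mu ^+ scalp M mu) mu (M %/ mu)%R M) => //.
    by rewrite expf_neq0.
  rewrite [LHS](Pdiv.Idomain.divp_eq M mu) mulrC (small (M %% mu)) ?addr0 //.
    have := congr1 (ev psi w) (Pdiv.Idomain.divp_eq M mu).
    by rewrite evZ rmorphD rmorphM evM evmu !mulr0 add0r => <-.
  by rewrite -mun Pdiv.Idomain.ltn_modp.
have eva : ev psi w alpha = 0.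
  apply/eqP; move/eqP: evmu; rewrite muE evZ mulf_eq0 => /orP[/eqP/psi_inj/eqP|//].
  by rewrite (negPf lmu0).
have sa : size alpha = n by rewrite -mun muE size_scale.
exists alpha; split=> // p evp; exists (Pdiv.Ring.rdivp p alpha).
rewrite {1}(Pdiv.RingMonic.rdivp_eq amon p) (small (Pdiv.Ring.rmodp p alpha)) ?addr0 //.
  have := congr1 (ev psi w) (Pdiv.RingMonic.rdivp_eq amon p).
  by rewrite rmorphD rmorphM evp eva mulr0 add0r.
by rewrite -sa Pdiv.Ring.ltn_rmodpN0 // monic_neq0.
Qed.

Lemma size_kernel (alpha p : {poly A}) : p != 0 -> (exists q, p = q * alpha) ->
  (size alpha <= size p)%N.
Proof.
move=> p0 [q pE]; have q0 : q != 0 by apply: contraNneq p0 => q0; rewrite pE q0 mul0r.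
have a0 : alpha != 0 by apply: contraNneq p0 => a0; rewrite pE a0 mulr0.
by rewrite pE size_mul // -(prednK (_ : 0 < size q)%N) ?size_poly_gt0 // addSn leq_addl.
Qed.

(* With denominators cleared, the powers s^k for k <= deg alpha are deg alpha + 1
   vectors in the A-span of the w^l for l < deg alpha. *)
Lemma size_rational w s (alpha g h : {poly A}) :
  alpha \is monic -> ev psi w alpha = 0 -> ev psi w g != 0 -> s * ev psi w g = ev psi w h ->
  exists2 S : {poly A}, S != 0 & ev psi s S = 0 /\ (size S <= size alpha)%N.
Proof.
move=> amon eva g0 sgE; set d := (size alpha).-1.
have sa : size alpha = d.+1 by rewrite prednK // size_poly_gt0 monic_neq0.
pose r (k : 'I_d.+1) := Pdiv.Ring.rmodp (h ^+ k * g ^+ (d - k)) alpha.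
have rE k : ev psi w (r k) = s ^+ k * ev psi w g ^+ d.
  have := congr1 (ev psi w) (Pdiv.RingMonic.rdivp_eq amon (h ^+ k * g ^+ (d - k))).
  rewrite rmorphD !rmorphM !rmorphXn eva mulr0 add0r => <-.
  rewrite -sgE exprMn -mulrA -exprD subnKC // -ltnS ltn_ord //.
have [|v [[i vi] vE]] := @lin_dep A 'I_d.+1 'I_d (fun k l => (r k)`_l).
  by rewrite !card_ord.
exists (\poly_(k < d.+1) v (inord k)).
  apply: contraNneq vi => /(congr1 (fun p : {poly A} => p`_i)).
  by rewrite coef_poly ltn_ord inord_val coef0 => ->.
split; last by rewrite sa size_poly.
apply: (mulIf (expf_neq0 d g0)); rewrite mul0r poly_def rmorph_sum mulr_suml.
have vr : \sum_k v k *: r k = 0.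
  apply/polyP => l; rewrite coef_sum coef0; have [ld|dl] := ltnP l d.
    by rewrite -[RHS](vE (Ordinal ld)); apply: eq_bigr => k _; rewrite coefZ.
  rewrite big1 // => k _; rewrite coefZ nth_default ?mulr0 // (leq_trans _ dl) //.
  by rewrite -ltnS -sa Pdiv.Ring.ltn_rmodpN0 // monic_neq0.
have := congr1 (ev psi w) vr; rewrite rmorph_sum rmorph0 => E; rewrite -[RHS]E; apply: eq_bigr => k _.
by rewrite !evZ rmorphXn evX rE inord_val mulrA.
Qed.

End MinimalPolynomial.

(** * The squared diameter as a rational function of the area *)

Lemma mpoly_int_ind n (P : {mpoly int[n]} -> Prop) :
  (forall c, P c%:MP) -> (forall i, P 'X_i) ->
  (forall p q, P p -> P q -> P (p + q)) ->
  (forall p q, P p -> P q -> P (p * q)) -> forall p, P p.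
Proof.
move=> PC PX PD PM p; rewrite [p]mpolyE; elim: (msupp p) => [|m s IH].
  by rewrite big_nil -mpolyC0.
rewrite big_cons; apply: (PD) => //; rewrite -mul_mpolyC; apply: (PM) => //.
have P1 : P 1 by rewrite -mpolyC1.
rewrite mpolyXE_id; apply: (big_ind P P1 PM) => i _.
elim: (m i) => [|k IHk]; first by rewrite expr0.
by rewrite exprS; apply: PM.
Qed.

Lemma map_poly_MXaddC (A : comNzRingType) (f : A -> A) :
  f 0 = 0 -> {morph f : x y / x + y} -> forall (p : {poly A}) c,
  map_poly f (p * 'X + c%:P) = map_poly f p * 'X + (f c)%:P.
Proof.
move=> f0 fD p c; apply/polyP => i.
rewrite coef_map_id0 // !coefD !coefMX !coefC fD.
by case: i => [|i] /=; rewrite ?coef_map_id0 ?f0.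
Qed.

Section Derivations.
Variable T : comNzRingType.

Definition derivation (d : T -> T) :=
  (forall x y, d (x + y) = d x + d y) /\
  (forall x y, d (x * y) = d x * y + x * d y).

Variables (d : T -> T) (dd : derivation d).

Lemma der_add x y : d (x + y) = d x + d y. Proof. by case: dd. Qed.
Lemma der_mul x y : d (x * y) = d x * y + x * d y. Proof. by case: dd. Qed.

Lemma der0 : d 0 = 0.
Proof. by apply: (addrI (d 0)); rewrite -der_add !addr0. Qed.

Lemma der1 : d 1 = 0.
Proof.
by apply: (addrI (d 1)); rewrite -{1}[d 1]mul1r -{2}[d 1]mulr1 addrC -der_mul mulr1 addr0.
Qed.

Lemma der_opp x : d (- x) = - d x.
Proof. by apply: (addrI (d x)); rewrite -der_add !subrr der0. Qed.

Lemma der_sum (I : Type) (r : seq I) (P : pred I) (F : I -> T) :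
  d (\sum_(i <- r | P i) F i) = \sum_(i <- r | P i) d (F i).
Proof. exact: (big_morph d der_add der0). Qed.

Lemma der_int (z : int) : d z%:~R = 0.
Proof.
have dn (n : nat) : d n%:R = 0.
  by elim: n => [|n IH]; rewrite ?der0 // -natr1 der_add IH der1 addr0.
by case: z => n; rewrite ?NegzE ?mulrNz -?pmulrn ?der_opp dn ?oppr0.
Qed.

Variables (n : nat) (psi : {rmorphism {mpoly int[n]} -> T}).

Lemma der_mpoly a : d (psi a) = \sum_j psi (mderiv j a) * d (psi 'X_j).
Proof.
move: a; apply: mpoly_int_ind => [c|i|p q IHp IHq|p q IHp IHq].
- rewrite -[c]intz !rmorph_int der_int big1 // => j _.
  by rewrite -(rmorph_int (@mpolyC n int)) mderivC rmorph0 mul0r.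
- rewrite (bigD1 i) //= big1 => [|j ji]; rewrite mderivX mnm1E.
    have -> : (U_(i) - U_(i) = 0 :> 'X_{1..n})%MM.
      by apply/mnmP => k; rewrite mnmBE subnn mnm0E.
    by rewrite eqxx scale1r mpolyX0 rmorph1 mul1r addr0.
  by rewrite eq_sym (negPf ji) scale0r rmorph0 mul0r.
- rewrite rmorphD der_add IHp IHq -big_split /=; apply: eq_bigr => j _.
  by rewrite mderivD rmorphD mulrDl.
rewrite rmorphM der_mul IHp IHq mulr_suml mulr_sumr -big_split /=.
apply: eq_bigr => j _; rewrite mderivM rmorphD !rmorphM mulrDl mulrAC.
by rewrite mulrA.
Qed.

Definition dcoef (j : 'I_n) (p : {poly {mpoly int[n]}}) := map_poly (mderiv j) p.

Lemma der_ev w (p : {poly {mpoly int[n]}}) :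
  d (ev psi w p) = ev psi w p^`() * d w + \sum_j ev psi w (dcoef j p) * d (psi 'X_j).
Proof.
elim/poly_ind: p => [|p c IH].
  rewrite deriv0 !rmorph0 der0 mul0r add0r big1 // => j _.
  by rewrite /dcoef map_poly0 rmorph0 mul0r.
have dE j : dcoef j (p * 'X + c%:P) = dcoef j p * 'X + (mderiv j c)%:P.
  by apply: (@map_poly_MXaddC {mpoly int[n]}) => [|x y]; rewrite (mderiv0, mderivD).
rewrite derivD derivC addr0 derivM derivX mulr1 !rmorphD !rmorphM !evX evC.
rewrite der_add der_mul IH der_mpoly.
rewrite [X in _ = _ + X](eq_bigr (fun j => ev psi w (dcoef j p) * d (psi 'X_j) * w
    + psi (mderiv j c) * d (psi 'X_j))); last first.
  by move=> j _; rewrite dE rmorphD rmorphM evX evC mulrDl mulrAC.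
by rewrite big_split /= -mulr_suml; ring.
Qed.

End Derivations.

(* a_j and b_j are the sine and cosine sides D sin t_j and D cos t_j, [dl k] is the
   derivation increasing the angle t_k at the expense of the last one (so that the
   sum of the angles is kept), [eu] is the Euler field of dilations. *)
Section Variation.
Variables (m : nat) (T : idomainType) (im D : T) (a b : 'I_m.+1 -> T).
Variable psi : {rmorphism {mpoly int[m.+1]} -> T}.
Hypotheses (imE : im * im = -1) (char0 : forall z : int, z%:~R = 0 :> T -> z = 0).
Hypothesis circ : forall j, a j ^+ 2 + b j ^+ 2 = D ^+ 2.
Hypothesis psiX : forall j, psi 'X_j = a j ^+ 2.

Definition sg (k : 'I_m) (j : 'I_m.+1) : T :=
  (j == lift ord_max k)%:R - (j == ord_max)%:R.

Variables (dl : 'I_m -> T -> T) (eu : T -> T).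
Hypotheses (dlD : forall k, derivation (dl k)) (euD : derivation eu).
Hypothesis dla : forall k j, dl k (a j) = - (sg k j * im * b j).
Hypothesis dlb : forall k j, dl k (b j) = sg k j * im * a j.
Hypotheses (eua : forall j, eu (a j) = a j) (eub : forall j, eu (b j) = b j).
Hypothesis tan_sum : \sum_j a j * \prod_(k | k != j) b k != 0.

Let C := \sum_j a j * b j.
Let u := C ^+ 2.

Let two_neq0 : 2 != 0 :> T.
Proof. by apply/eqP => /(char0 (z := 2)). Qed.

Let im_neq0 : im != 0.
Proof. by apply/eqP => i0; move/eqP: imE; rewrite i0 mul0r eq_sym oppr_eq0 oner_eq0. Qed.

Lemma sum_sg k (F : 'I_m.+1 -> T) :
  \sum_j sg k j * F j = F (lift ord_max k) - F ord_max.
Proof.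
rewrite (bigD1 ord_max) //= (bigD1 (lift ord_max k)) /=; last by rewrite eq_sym neq_lift.
rewrite big1 => [|j /andP[/negPf j1 /negPf j2]].
  have h := negPf (neq_lift ord_max k).
  by rewrite /sg !eqxx h [lift _ _ == _]eq_sym h /= mulr1n mulr0n; ring.
by rewrite /sg j1 j2 /= mulr0n; ring.
Qed.

(* Differentiating p(u, a_j^2) = 0 along the [dl k] shows that
   F_j a_j b_j + 2 g C b_j^2 does not depend on j, where F_j and g are the partial
   derivatives; the Euler field shows that the common value is 0. *)
Lemma area_variation (p : {poly {mpoly int[m.+1]}}) : ev psi u p = 0 ->
  forall j, a j * b j * ev psi u (dcoef j p) = - (2 * ev psi u p^`() * C * b j ^+ 2).
Proof.
move=> pu0; set g := ev psi u p^`(); pose F j := ev psi u (dcoef j p).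
have [dadd dmul] : (forall k x y, dl k (x + y) = dl k x + dl k y) /\
    (forall k x y, dl k (x * y) = dl k x * y + x * dl k y).
  by split=> k; case: (dlD k).
have dx k j : dl k (psi 'X_j) = - (2 * im * (sg k j * (a j * b j))).
  by rewrite psiX expr2 dmul dla; ring.
have dC k : dl k C = 2 * im * (a (lift ord_max k) ^+ 2 - a ord_max ^+ 2).
  rewrite (der_sum (dlD k)).
  rewrite (eq_bigr (fun j => sg k j * (im * (2 * a j ^+ 2 - D ^+ 2)))).
    by rewrite sum_sg; ring.
  by move=> j _; rewrite dmul dla dlb -(circ j); ring.
have du k : dl k u = 2 * C * dl k C by rewrite /u expr2 dmul; ring.
have R k : 2 * g * C * (a (lift ord_max k) ^+ 2 - a ord_max ^+ 2) =
    F (lift ord_max k) * (a (lift ord_max k) * b (lift ord_max k))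
    - F ord_max * (a ord_max * b ord_max).
  have := der_ev (dlD k) psi u p; rewrite pu0 (der0 (dlD k)) du dC -/g.
  rewrite (eq_bigr (fun j => sg k j * (- 2 * im * (F j * (a j * b j))))); last first.
    by move=> j _; rewrite dx -/(F j); ring.
  rewrite sum_sg => E; apply: (mulfI (mulf_neq0 two_neq0 im_neq0)).
  by apply/eqP; rewrite -subr_eq0 [X in _ == X]E; apply/eqP; ring.
have Eu : \sum_j F j * a j ^+ 2 = - (2 * g * u).
  have := der_ev euD psi u p; rewrite pu0 (der0 euD) -/g.
  have -> : eu u = 4 * u.
    rewrite /u expr2 (der_mul euD) (der_sum euD).
    rewrite (eq_bigr (fun j => 2 * (a j * b j))) -?mulr_sumr -/C; first by ring.
    by move=> j _; rewrite (der_mul euD) eua eub; ring.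
  rewrite (eq_bigr (fun j => 2 * (F j * a j ^+ 2))) -?mulr_sumr; last first.
    by move=> j _; rewrite psiX expr2 (der_mul euD) eua -/(F j); ring.
  move=> E; apply: (mulfI two_neq0).
  by apply/eqP; rewrite -subr_eq0 [X in _ == X]E; apply/eqP; ring.
pose L := F ord_max * (a ord_max * b ord_max) + 2 * g * C * b ord_max ^+ 2.
have RL j : F j * (a j * b j) + 2 * g * C * b j ^+ 2 = L.
  have [k ->|->//] := unliftP ord_max j.
  have h i : b i ^+ 2 = D ^+ 2 - a i ^+ 2 by rewrite -(circ i); ring.
  rewrite /L !h -[F (lift _ _) * _](subrK (F ord_max * (a ord_max * b ord_max))) -R.
  by ring.
(* With a_j = D sin t_j and b_j = D cos t_j, L tan t_j = F_j a_j^2 + 2 g C a_j b_j, and the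
   right-hand sides add up to 0 by the Euler relation [Eu]. The hypothesis [tan_sum] is sum_j tan
   t_j <> 0 with the cosines cleared. *)
have L0 : L = 0.
  apply/eqP; have := tan_sum; apply: contraNT => L0; apply/eqP.
  apply: (mulfI L0); rewrite mulr0 mulr_sumr.
  transitivity (\sum_j (\prod_k b k) * (F j * a j ^+ 2 + 2 * g * C * (a j * b j))).
    apply: eq_bigr => j _; rewrite -(RL j) (bigD1 j (P := predT)) //=; ring.
  by rewrite -mulr_sumr big_split /= -mulr_sumr Eu -/C /u; ring.
move=> j; have := RL j; rewrite L0 -/(F j) => E.
by apply/eqP; rewrite -subr_eq0 -E; apply/eqP; ring.
Qed.

Hypotheses (a_neq0 : forall j, a j != 0) (b_neq0 : forall j, b j != 0).

(** Algebraic independence of the a_j^2. For c constant in u, [area_variation] reads a_j b_j psi(d_j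
    c) = 0, so the partial derivatives of c lie in the kernel too and vanish by induction on the
    degree; a constant in the kernel is 0 by [char0]. *)
Lemma psi_inj c : psi c = 0 -> c = 0.
Proof.
have [N] := ubnP (msize c); elim: N c => // N IH c cN c0.
have [//|c1] := eqVneq c 0.
have dc0 j : mderiv j c = 0.
  apply: (IH).
    rewrite ltnS in cN; apply: leq_trans cN.
    rewrite (mpolySpred _ c1) msizeE ltnS.
    apply/bigmax_leqP_seq => k; rewrite mcoeff_msupp mcoeff_mderiv => ck _.
    have : (k + U_(j))%MM \in msupp c.
      by rewrite mcoeff_msupp; apply: contraNneq ck => ->; rewrite mul0rn.
    by move/msize_mdeg_lt; rewrite mdegD mdeg1 addn1 (mpolySpred _ c1).
  have := @area_variation c%:P; rewrite evC => /(_ c0 j).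
  have -> : dcoef j c%:P = (mderiv j c)%:P by exact: map_polyC.
  rewrite evC derivC rmorph0 !(mulr0, mul0r) oppr0.
  by move/eqP; rewrite !mulf_eq0 (negPf (a_neq0 j)) (negPf (b_neq0 j)) /= => /eqP.
have cC : c = (c@_0)%:MP.
  apply/mpolyP => k; rewrite mcoeffC; have [->|k0] := eqVneq k 0%MM; first by rewrite mulr1.
  rewrite mulr0; have [j kj] : exists j, k j != 0%N.
    apply: contrapT => nk; case/eqP: k0; apply/mnmP => j; rewrite mnm0E.
    by apply: contrapT => /eqP kj; apply: nk; exists j.
  have := congr1 (mcoeff (k - U_(j))%MM) (dc0 j); rewrite mcoeff_mderiv mcoeff0 submK.
    by move/eqP; rewrite -mulr_natr mulf_eq0 pnatr_eq0 orbF => /eqP.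
  by apply/mnm_lepP => l; rewrite mnm1E; case: eqP => // <-; rewrite lt0n.
move: c0; rewrite cC -[c@_0]intz !rmorph_int => /char0 ->.
by rewrite mulr0z.
Qed.

(* The square of [area_variation], with b_j^2 = D^2 - a_j^2. *)
Lemma diam_rational j (p : {poly {mpoly int[m.+1]}}) : ev psi u p = 0 ->
  D ^+ 2 * ev psi u (4 *: ('X * p^`() ^+ 2)) =
  ev psi u ('X_j *: (dcoef j p) ^+ 2 + (4 * 'X_j) *: ('X * p^`() ^+ 2)).
Proof.
move=> pu0; have E := area_variation pu0 j.
have {}E : a j * ev psi u (dcoef j p) = - (2 * ev psi u p^`() * C * b j).
  by apply: (mulIf (b_neq0 j)); rewrite mulrAC E; ring.
rewrite rmorphD !evZ !rmorphM evX psiX rmorph_nat -(circ j).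
transitivity (4 * u * ev psi u p^`() ^+ 2 * b j ^+ 2
  + 4 * a j ^+ 2 * (u * ev psi u p^`() ^+ 2)); first by ring.
congr (_ + _); transitivity ((a j * ev psi u (dcoef j p)) ^+ 2); last by ring.
by rewrite E /u; ring.
Qed.

End Variation.

(** * The generic semicyclic polygon *)

(* The generic semicyclic polygon of diameter D, with sides D sin t_j where the t_j
   add up to pi/2. Its coordinate ring is generated by q_k = exp(i t_k), k < m, and
   D / prod_k q_k; this [scale] is a variable rather than D itself to make the
   conjugate chords D exp(-i t_j) polynomials. *)
Section GenericPolygon.
Variables (C : numClosedFieldType) (m : nat).
Notation T := {mpoly C[m.+1]}.

Definition half_arc (k : 'I_m) : T := 'X_(lift ord_max k).
Definition scale : T := 'X_ord_max.
Definition arc_prod : T := \prod_k half_arc k.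
Definition diam : T := scale * arc_prod.
Definition imT : T := ('i)%:MP.

(** This is D q_j, and [cchord j] is D / q_j. As the t_j add up to pi/2, the last q_j is i / prod_k
    q_k. *)
Definition chord (j : 'I_m.+1) : T :=
  if unlift ord_max j is Some k then diam * half_arc k else imT * scale.
Definition cchord (j : 'I_m.+1) : T :=
  if unlift ord_max j is Some k then scale * \prod_(l | l != k) half_arc l
  else - (imT * scale * arc_prod ^+ 2).
Definition sine (j : 'I_m.+1) : T :=
  - (imT * (2^-1)%:MP * (chord j - cchord j)).
Definition cosine (j : 'I_m.+1) : T := (2^-1)%:MP * (chord j + cchord j).

Lemma imT2 : imT * imT = -1.
Proof. by rewrite /imT -mpolyCM -expr2 sqrCi mpolyCN mpolyC1. Qed.

Lemma halfT : (2^-1)%:MP + (2^-1)%:MP = 1 :> T.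
Proof. by rewrite -mpolyCD -[X in X%:MP]mulr2n -[2^-1 *+ 2]mulr_natr mulVf ?pnatr_eq0 // mpolyC1. Qed.

Lemma chordM j : chord j * cchord j = diam ^+ 2.
Proof.
rewrite /chord /cchord; case: unliftP => [k _|_].
  rewrite /diam [arc_prod](bigD1 k) //=; ring.
by rewrite /diam; transitivity (- (imT * imT) * scale ^+ 2 * arc_prod ^+ 2);
  [ring | rewrite imT2; ring].
Qed.

Lemma cosD j : cosine j + imT * sine j = chord j.
Proof.
rewrite /cosine /sine; set h := mpolyC _ _.
transitivity (h * (chord j + cchord j) - (imT * imT) * h * (chord j - cchord j)); first by ring.
rewrite imT2; transitivity ((h + h) * chord j); first by ring.
by rewrite /h halfT mul1r.
Qed.

Lemma cosB j : cosine j - imT * sine j = cchord j.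
Proof.
rewrite /cosine /sine; set h := mpolyC _ _.
transitivity (h * (chord j + cchord j) + (imT * imT) * h * (chord j - cchord j)); first by ring.
rewrite imT2; transitivity ((h + h) * cchord j); first by ring.
by rewrite /h halfT mul1r.
Qed.

Lemma sine_cosine j : sine j ^+ 2 + cosine j ^+ 2 = diam ^+ 2.
Proof.
rewrite -(chordM j) -cosD -cosB.
transitivity (- (imT * imT) * sine j ^+ 2 + cosine j ^+ 2); last by ring.
by rewrite imT2; ring.
Qed.

Lemma chord_lift k : chord (lift ord_max k) = diam * half_arc k.
Proof. by rewrite /chord liftK. Qed.

Lemma chord_max : chord ord_max = imT * scale.
Proof. by rewrite /chord unlift_none. Qed.

Lemma cchord_lift k :
  cchord (lift ord_max k) = scale * \prod_(l | l != k) half_arc l.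
Proof. by rewrite /cchord liftK. Qed.

Lemma cchord_max : cchord ord_max = - (imT * scale * arc_prod ^+ 2).
Proof. by rewrite /cchord unlift_none. Qed.

Lemma prod_chord : \prod_j chord j = imT * diam ^+ m.+1.
Proof.
rewrite (bigD1_ord ord_max) //= chord_max.
under eq_bigr => k _ do rewrite chord_lift.
rewrite big_split /= prodr_const card_ord -/arc_prod exprS /diam; ring.
Qed.

Lemma half_arc_neq0 k : half_arc k != 0.
Proof. by rewrite -msize_poly_eq0 msizeX. Qed.

Lemma scale_neq0 : scale != 0.
Proof. by rewrite -msize_poly_eq0 msizeX. Qed.

Lemma imT_neq0 : imT != 0.
Proof. by rewrite mpolyC_eq0 neq0Ci. Qed.

Lemma diam_neq0 : diam != 0.
Proof.
rewrite mulf_neq0 ?scale_neq0 //.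
by apply/prodf_neq0 => k _; apply: half_arc_neq0.
Qed.

Lemma chord_neq0 j : chord j != 0.
Proof.
have [k ->|->] := unliftP ord_max j.
  by rewrite chord_lift mulf_neq0 ?half_arc_neq0 ?diam_neq0.
by rewrite chord_max mulf_neq0 ?imT_neq0 ?scale_neq0.
Qed.

Lemma prod_cchord : \prod_j cchord j = - (imT * diam ^+ m.+1).
Proof.
have D0 : imT * diam ^+ m.+1 != 0.
  by rewrite mulf_neq0 ?imT_neq0 // expf_neq0 // diam_neq0.
apply: (mulfI D0); rewrite -{1}prod_chord -big_split /=.
under eq_bigr => j _ do rewrite chordM.
rewrite prodr_const card_ord.
transitivity (- (imT * imT) * (diam ^+ m.+1) ^+ 2); last by ring.
by rewrite imT2 opprK mul1r -!exprM mulnC.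
Qed.

(** The operator q_k d/dq_k is -i d/dt_k, which explains the factors [im] in the action on sines and
    cosines; the second term keeps [diam] fixed. *)
Definition rotate (k : 'I_m) (p : T) : T :=
  half_arc k * mderiv (lift ord_max k) p - scale * mderiv ord_max p.
Definition dilate (p : T) : T := scale * mderiv ord_max p.

Lemma rotate_der k : derivation (rotate k).
Proof. by split=> x y; rewrite /rotate ?mderivD ?mderivM; ring. Qed.

Lemma dilate_der : derivation dilate.
Proof. by split=> x y; rewrite /dilate ?mderivD ?mderivM; ring. Qed.

Lemma mderivXU (i j : 'I_m.+1) : mderiv i ('X_j : T) = (i == j)%:R.
Proof.
rewrite mderivX mnm1E eq_sym; case: eqP => [->|_]; last by rewrite scale0r.
have -> : (U_(j) - U_(j) = 0 :> 'X_{1..m.+1})%MM.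
  by apply/mnmP => k; rewrite mnmBE subnn mnm0E.
by rewrite scale1r mpolyX0.
Qed.

Local Notation sg := (@sg m T).

Lemma rotateX k j : rotate k 'X_j = sg k j * 'X_j.
Proof.
rewrite /rotate /sg !mderivXU eq_sym [ord_max == j]eq_sym /half_arc /scale.
by case: eqP => [->|_]; case: eqP => [->|_]; rewrite /= ?mulr1n ?mulr0n; ring.
Qed.

Lemma rotateC k c : rotate k c%:MP = 0.
Proof. by rewrite /rotate !mderivC; ring. Qed.

Lemma der_prod0 (d : T -> T) (I : finType) (P : pred I) (F : I -> T) :
  derivation d -> (forall i, P i -> d (F i) = 0) -> d (\prod_(i | P i) F i) = 0.
Proof.
move=> dd dF; apply: (big_ind (fun p => d p = 0)) => //; first exact: der1.
by move=> x y dx dy; rewrite (der_mul dd) dx dy mul0r mulr0 addr0.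
Qed.

Lemma sg_max k : sg k ord_max = -1.
Proof. by rewrite /sg eqxx (negPf (neq_lift _ _)) /= mulr0n mulr1n sub0r. Qed.

Lemma sg_lift k l : sg k (lift ord_max l) = (l == k)%:R.
Proof.
by rewrite /sg (inj_eq (@lift_inj _ _)) [lift _ _ == ord_max]eq_sym (negPf (neq_lift _ _)) subr0.
Qed.

Lemma rotate_scale k : rotate k scale = - scale.
Proof. by rewrite rotateX sg_max mulN1r. Qed.

Lemma rotate_arc k l : rotate k (half_arc l) = sg k (lift ord_max l) * half_arc l.
Proof. exact: rotateX. Qed.

Lemma rotate_prod k : rotate k (\prod_(l | l != k) half_arc l) = 0.
Proof.
apply: der_prod0 (rotate_der k) _ => l lk.
by rewrite rotateX sg_lift (negPf lk) mul0r.
Qed.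

Lemma rotate_diam k : rotate k diam = 0.
Proof.
rewrite /diam /arc_prod (bigD1 k) //= !(der_mul (rotate_der k)) rotate_prod.
by rewrite rotate_scale rotate_arc sg_lift eqxx mulr1n mul1r mulr0 addr0 mulNr addNr.
Qed.

Lemma rotate_chord k j : rotate k (chord j) = sg k j * chord j.
Proof.
have [l ->|->] := unliftP ord_max j.
  by rewrite chord_lift (der_mul (rotate_der k)) rotate_diam rotate_arc; ring.
by rewrite chord_max (der_mul (rotate_der k)) rotateC rotate_scale sg_max; ring.
Qed.

Lemma rotate_cchord k j : rotate k (cchord j) = - (sg k j * cchord j).
Proof.
apply: (mulfI (chord_neq0 j)); have := congr1 (rotate k) (chordM j).
rewrite expr2 (der_mul (rotate_der k) (chord j)) (der_mul (rotate_der k) diam).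
rewrite rotate_diam rotate_chord => E.
rewrite mulrN mulrCA mulrA; apply/eqP; rewrite -addr_eq0 addrC; apply/eqP.
by rewrite E; ring.
Qed.

Lemma rotate_sine k j : rotate k (sine j) = - (sg k j * imT * cosine j).
Proof.
have dd := rotate_der k.
rewrite (der_opp dd) !(der_mul dd) !rotateC (der_add dd) (der_opp dd).
by rewrite rotate_chord rotate_cchord /cosine; ring.
Qed.

Lemma rotate_cosine k j : rotate k (cosine j) = sg k j * imT * sine j.
Proof.
have dd := rotate_der k.
rewrite (der_mul dd) rotateC (der_add dd) rotate_chord rotate_cchord /sine.
set h := mpolyC _ _.
transitivity (- (imT * imT) * (sg k j * (h * (chord j - cchord j)))); last by ring.
by rewrite imT2; ring.
Qed.

Lemma dilateC c : dilate c%:MP = 0.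
Proof. by rewrite /dilate mderivC mulr0. Qed.

Lemma dilate_scale : dilate scale = scale.
Proof. by rewrite /dilate mderivXU eqxx mulr1. Qed.

Lemma dilate_arc k : dilate (half_arc k) = 0.
Proof. by rewrite /dilate mderivXU (negPf (neq_lift _ _)) mulr0. Qed.

Lemma dilate_prod (P : pred 'I_m) : dilate (\prod_(l | P l) half_arc l) = 0.
Proof. by apply: der_prod0 dilate_der _ => l _; apply: dilate_arc. Qed.

Lemma dilate_chord j : dilate (chord j) = chord j.
Proof.
have dd := dilate_der; have [l ->|->] := unliftP ord_max j.
  by rewrite chord_lift /diam !(der_mul dd) dilate_prod dilate_arc dilate_scale; ring.
by rewrite chord_max (der_mul dd) dilateC dilate_scale; ring.
Qed.

Lemma dilate_cchord j : dilate (cchord j) = cchord j.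
Proof.
have dd := dilate_der; have [l ->|->] := unliftP ord_max j.
  by rewrite cchord_lift (der_mul dd) dilate_prod dilate_scale; ring.
by rewrite cchord_max expr2 (der_opp dd) !(der_mul dd) dilate_prod dilateC dilate_scale; ring.
Qed.

Lemma dilate_sine j : dilate (sine j) = sine j.
Proof.
have dd := dilate_der.
rewrite (der_opp dd) !(der_mul dd) !dilateC (der_add dd) (der_opp dd).
by rewrite dilate_chord dilate_cchord /sine; ring.
Qed.

Lemma dilate_cosine j : dilate (cosine j) = cosine j.
Proof.
have dd := dilate_der.
rewrite (der_mul dd) !dilateC (der_add dd).
by rewrite dilate_chord dilate_cchord /cosine; ring.
Qed.

End GenericPolygon.

Section Specialization.
Variables (C : numClosedFieldType) (m : nat).
Notation T := {mpoly C[m.+1]}.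
Notation chord := (chord C (m := m)).
Notation cchord := (cchord C (m := m)).
Notation sine := (sine C (m := m)).
Notation cosine := (cosine C (m := m)).

Definition polygon_point (d : C) (q : 'I_m.+1 -> C) (j : 'I_m.+1) : C :=
  if unlift ord_max j is Some k then q j else d / \prod_k q (lift ord_max k).

Section Point.
Variables (d : C) (q : 'I_m.+1 -> C).
Hypotheses (q0 : forall j, q j != 0) (qprod : \prod_j q j = 'i).

Let Q := \prod_(k < m) q (lift ord_max k).

Let Q0 : Q != 0. Proof. by apply/prodf_neq0. Qed.

Lemma q_max : q ord_max = 'i / Q.
Proof. by rewrite -qprod (bigD1_ord ord_max) //= mulfK. Qed.

Lemma eval_arc k : (half_arc C k).@[polygon_point d q] = q (lift ord_max k).
Proof. by rewrite mevalXU /polygon_point liftK. Qed.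

Lemma eval_prod (P : pred 'I_m) :
  (\prod_(k | P k) half_arc C k).@[polygon_point d q] = \prod_(k | P k) q (lift ord_max k).
Proof. by rewrite rmorph_prod; apply: eq_bigr => k _; exact: eval_arc. Qed.

Lemma eval_scale : (scale C m).@[polygon_point d q] = d / Q.
Proof. by rewrite mevalXU /polygon_point unlift_none. Qed.

Lemma eval_diam : (diam C m).@[polygon_point d q] = d.
Proof. by rewrite mevalM eval_scale eval_prod divfK. Qed.

Lemma eval_chord j : (chord j).@[polygon_point d q] = d * q j.
Proof.
have [k ->|->] := unliftP ord_max j.
  by rewrite chord_lift mevalM eval_diam eval_arc.
by rewrite chord_max mevalM mevalC eval_scale q_max mulrCA mulrA.
Qed.

Lemma eval_cchord j : (cchord j).@[polygon_point d q] = d / q j.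
Proof.
have [k ->|->] := unliftP ord_max j.
  rewrite cchord_lift mevalM eval_prod eval_scale /Q (bigD1 k) //=.
  have P0 : \prod_(l < m | l != k) q (lift ord_max l) != 0 by apply/prodf_neq0.
  by field; rewrite P0 q0.
rewrite cchord_max mevalN !mevalM mevalC eval_scale eval_prod q_max.
rewrite invfM invrK -/Q invCi.
by field.
Qed.

Lemma eval_sine j : (sine j).@[polygon_point d q] = - ('i / 2 * d * (q j - (q j)^-1)).
Proof.
rewrite /sine mevalN !mevalM mevalB !mevalC eval_chord eval_cchord.
by field.
Qed.

Lemma eval_cosine j : (cosine j).@[polygon_point d q] = d / 2 * (q j + (q j)^-1).
Proof. by rewrite /cosine mevalM mevalD mevalC eval_chord eval_cchord; ring. Qed.

Lemma eval_sine2 j : (sine j ^+ 2).@[polygon_point d q] =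
  d ^+ 2 * (2 - q j ^+ 2 - (q j ^+ 2)^-1) / 4.
Proof.
rewrite expr2 mevalM eval_sine; have := sqrCi C; have := q0 j.
set i := 'i; move=> qj i2.
transitivity (i ^+ 2 / 4 * d ^+ 2 * (q j - (q j)^-1) ^+ 2); first by field.
by rewrite i2; field.
Qed.

Lemma eval_sine_cosine j : (sine j * cosine j).@[polygon_point d q] =
  - ('i * d ^+ 2 * (q j ^+ 2 - (q j ^+ 2)^-1) / 4).
Proof. by rewrite mevalM eval_sine eval_cosine; field. Qed.

End Point.

(** Test points, not necessarily on the unit circle, for showing that elements of T are nonzero. At
    (1, 1) only the last sine survives in the tangent sum; at (2, 2) every q_j^2 differs from 1 and
    -1; at (2, 1) only two terms of the area survive. *)
Definition unit_pt (x y : C) (j : 'I_m.+1) : C :=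
  if unlift ord_max j is Some k then (if k == 0%N :> nat then x else y)
  else 'i / (if m is 0 then 1 else x * y ^+ m.-1).

Lemma unit_pt_neq0 x y : x != 0 -> y != 0 -> forall j, unit_pt x y j != 0.
Proof.
move=> x0 y0 j; rewrite /unit_pt; case: unliftP => [k _|_]; first by case: ifP.
rewrite mulf_neq0 ?neq0Ci // invr_neq0 //; case: (m); rewrite ?oner_eq0 // => l.
by rewrite mulf_neq0 // expf_neq0.
Qed.

Lemma unit_pt_prod x y : x != 0 -> y != 0 -> \prod_j unit_pt x y j = 'i.
Proof.
move=> x0 y0; rewrite (bigD1_ord ord_max) //= {1}/unit_pt unlift_none.
under eq_bigr => k _ do rewrite /unit_pt liftK.
case: (m) => [|l]; first by rewrite big_ord0; field.
rewrite big_ord_recl /= prodr_const card_ord divfK // mulf_neq0 // expf_neq0 //.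
Qed.

Hypothesis m_gt0 : (0 < m)%N.

Let pt x y := polygon_point 1 (unit_pt x y).

Lemma eval_neq0 v (p : T) : p.@[v] != 0 -> p != 0.
Proof. by apply: contraNneq => ->; rewrite meval0. Qed.

Lemma tan_sum_neq0 :
  \sum_j sine j * \prod_(k | k != j) cosine k != 0.
Proof.
have h0 : 1 != 0 :> C by exact: oner_neq0.
have Q0 := unit_pt_neq0 h0 h0; have Q1 := unit_pt_prod h0 h0.
apply: (@eval_neq0 (pt 1 1)); rewrite rmorph_sum (bigD1 ord_max) //=.
have qmax : unit_pt 1 1 ord_max = 'i by rewrite q_max // big1 ?divr1 // => k _; rewrite /unit_pt liftK if_same.
have qlift k : unit_pt 1 1 (lift ord_max k) = 1 by rewrite /unit_pt liftK if_same.
rewrite [X in _ + X]big1 ?addr0 => [|j].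
  rewrite mevalM eval_sine // rmorph_prod qmax invCi /= big1 ?mulr1 => [|j].
    have -> : - ('i / 2 * ('i - - 'i)) = - 'i ^+ 2 :> C by field.
    by rewrite sqrCi opprK oner_neq0.
  by case: (unliftP ord_max j) => [k ->|->]; rewrite ?eqxx // => _; rewrite eval_cosine // qlift; field.
case: (unliftP ord_max j) => [k ->|->]; rewrite ?eqxx // => _.
by rewrite mevalM eval_sine // qlift invr1 subrr mulr0 oppr0 mul0r.
Qed.

Lemma pt21_lift x y k : unit_pt x y (lift ord_max k) = if k == 0%N :> nat then x else y.
Proof. by rewrite /unit_pt liftK. Qed.

Lemma unit_pt_max x y :
  unit_pt x y ord_max = 'i / (x * y ^+ m.-1).
Proof. by rewrite /unit_pt unlift_none; case: (m) m_gt0. Qed.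

Lemma unit_pt2_sqr j : exists k, (unit_pt 2 2 j ^+ 2 = 4) \/
  (unit_pt 2 2 j ^+ 2 = - (4 ^+ k.+1)^-1).
Proof.
case: (unliftP ord_max j) => [k ->|->].
  by exists 0%N; left; rewrite pt21_lift if_same; ring.
exists m.-1; right; rewrite unit_pt_max -exprS expr_div_n sqrCi -exprM mulnC exprM.
by rewrite mulN1r (_ : 2 ^+ 2 = 4) //; ring.
Qed.

Lemma unit_pt2_neq j : unit_pt 2 2 j ^+ 2 != 1 /\ unit_pt 2 2 j ^+ 2 != -1.
Proof.
have [k [->|->]] := unit_pt2_sqr j.
  by split; [rewrite (eqr_nat C 4 1) | rewrite -addr_eq0 -(natrD C 4 1) pnatr_eq0].
have p4 : 1 < 4 ^+ k.+1 :> C by rewrite exprn_egt1 // ltr1n.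
have p0 : 0 < 4 ^+ k.+1 :> C by apply: lt_trans p4.
split; last by rewrite eqr_opp invr_eq1 gt_eqF.
by rewrite lt_eqF // (lt_trans _ (@ltr01 C)) // oppr_lt0 invr_gt0.
Qed.

Lemma sine_neq0 j : sine j != 0.
Proof.
have h0 : 2 != 0 :> C by rewrite pnatr_eq0.
have Q0 := unit_pt_neq0 h0 h0; have Q1 := unit_pt_prod h0 h0.
apply: (@eval_neq0 (pt 2 2)); rewrite eval_sine // oppr_eq0 !mulf_neq0 ?neq0Ci ?invr_neq0 ?oner_neq0 //.
have [+ _] := unit_pt2_neq j; apply: contraNneq => /(congr1 (fun z => z * unit_pt 2 2 j)).
by rewrite mul0r mulrBl mulVf // -expr2 => /eqP; rewrite subr_eq0.
Qed.

Lemma cosine_neq0 j : cosine j != 0.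
Proof.
have h0 : 2 != 0 :> C by rewrite pnatr_eq0.
have Q0 := unit_pt_neq0 h0 h0; have Q1 := unit_pt_prod h0 h0.
apply: (@eval_neq0 (pt 2 2)); rewrite eval_cosine // !mulf_neq0 ?invr_neq0 ?oner_neq0 //.
have [_ +] := unit_pt2_neq j; apply: contraNneq => /(congr1 (fun z => z * unit_pt 2 2 j)).
by rewrite mul0r mulrDl mulVf // -expr2 => /eqP; rewrite addr_eq0.
Qed.

Lemma area_neq0 : \sum_j sine j * cosine j != 0.
Proof.
have h0 : 1 != 0 :> C by exact: oner_neq0.
have h2 : 2 != 0 :> C by rewrite pnatr_eq0.
have Q0 := unit_pt_neq0 h2 h0; have Q1 := unit_pt_prod h2 h0.
apply: (@eval_neq0 (pt 2 1)); rewrite rmorph_sum (bigD1 ord_max) //=.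
rewrite (bigD1 (lift ord_max (Ordinal m_gt0))) /=; last by rewrite eq_sym neq_lift.
rewrite !eval_sine_cosine // unit_pt_max pt21_lift /= big1 => [|j].
  rewrite (expr1n _ m.-1) (mulr1 2) expr_div_n sqrCi addr0.
  have -> : - ('i * 1 ^+ 2 * (-1 / 2 ^+ 2 - (-1 / 2 ^+ 2)^-1) / 4) +
    - ('i * 1 ^+ 2 * (2 ^+ 2 - (2 ^+ 2)^-1) / 4) = - ('i * (15 / 8)) :> C by field.
  by rewrite oppr_eq0 !mulf_neq0 ?neq0Ci ?invr_neq0 ?pnatr_eq0.
case: (unliftP ord_max j) => [k ->|->]; rewrite ?eqxx // (inj_eq (@lift_inj _ _)).
rewrite -(inj_eq val_inj k) /= => /andP[_ /negPf k0].
by rewrite eval_sine_cosine // pt21_lift k0; field.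
Qed.

End Specialization.

(** * Integrality of the squared diameter *)

Lemma integral_sqr (R K : comNzRingType) (f : {rmorphism R -> K}) z :
  integralOver f (z ^+ 2) -> integralOver f z.
Proof.
move=> zint; apply: (@integral_root_monic _ _ _ _ ('X^2 - (z ^+ 2)%:P)).
- by rewrite monicXnsubC.
- by rewrite rootE !hornerE subrr.
- apply/integral_poly => i; rewrite coefB coefXn coefC; apply: integral_sub.
    exact: integral_nat.
  by case: ifP => _ //; apply: integral0.
Qed.

(** Multiplying a monic relation of degree d for s over A[1/s] by a high power s^K clears the
    negative powers and leaves s^(d+K) as the only term of top degree. *)
Lemma integral_inv_adjoin (A : comNzRingType) (L : fieldType)
    (phi : {rmorphism A -> L}) (s : L) :
  s != 0 -> integralOver (ev phi s^-1) s -> integralOver phi s.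
Proof.
move=> s0 [M /monicP Mmon /rootP Ms]; set d := (size M).-1.
have sM : size M = d.+1.
  rewrite prednK // size_poly_gt0; apply/eqP => M0.
  by move/eqP: Mmon; rewrite M0 lead_coef0 eq_sym oner_eq0.
have Md : M`_d = 1 by rewrite -Mmon.
pose K := (\max_(i < d) size (M`_i)%R)%N.
pose N := \sum_(i < d) \sum_(j < size M`_i) M`_i`_j *: ('X^(i + (K - j)) : {poly A}).
have jK (i : 'I_d) (j : 'I_(size M`_i)) : (j <= K)%N.
  by apply: leq_trans (ltnW (ltn_ord j)) (leq_bigmax i).
have sN : (size N < (size ('X^(d + K) : {poly A})))%N.
  rewrite size_polyXn ltnS (leq_trans (size_sum _ _ _)) //; apply/bigmax_leqP => i _.
  rewrite (leq_trans (size_sum _ _ _)) //; apply/bigmax_leqP => j _.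
  rewrite (leq_trans (size_scale_leq _ _)) // size_polyXn -addSn.
  by rewrite leq_add ?leq_subr // ltn_ord.
exists ('X^(d + K) + N); first by rewrite monicE lead_coefDl // lead_coefXn.
apply/rootP; rewrite -[LHS]/(ev phi s ('X^(d + K) + N)) rmorphD rmorphXn evX.
have -> : ev phi s N = s ^+ K * \sum_(i < d) ev phi s^-1 M`_i * s ^+ i.
  rewrite rmorph_sum mulr_sumr; apply: eq_bigr => i _.
  rewrite rmorph_sum evE mulr_suml mulr_sumr; apply: eq_bigr => j _.
  rewrite evZ rmorphXn evX exprD exprB ?jK // ?unitfE // exprVn; ring.
rewrite exprD [s ^+ d * _]mulrC -mulrDr; apply/eqP; rewrite mulf_eq0; apply/orP; right.
have := Ms; rewrite -[X in X = 0]/(ev (ev phi s^-1) s M) evE sM big_ord_recr /= Md.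
by rewrite -[X in _ + X * _]/(ev phi s^-1 1) rmorph1 mul1r addrC => ->.
Qed.

Section Circumdiameter.
Variables (A : comNzRingType) (L : fieldType) (phi : {rmorphism A -> L}).
Variables (I : finType) (x : I -> A) (a b : I -> L) (im D : L).
Hypotheses (imE : im * im = -1) (two_neq0 : 2 != 0 :> L) (D0 : D != 0).
Hypothesis phix : forall j, phi (x j) = a j ^+ 2.
Hypothesis circ : forall j, a j ^+ 2 + b j ^+ 2 = D ^+ 2.
Hypothesis prod_p : \prod_j (b j + im * a j) = im * D ^+ #|I|.
Hypothesis prod_m : \prod_j (b j - im * a j) = - (im * D ^+ #|I|).

Let w := (D ^+ 2)^-1.
Let O v := integralOver (ev phi w) v.
Let wO v := O (v * D ^+ 2).
Let al j := a j / D.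
Let be j := b j / D.

Let O_w : O w. Proof. by rewrite -(evX phi w); apply: integral_id. Qed.
Let O_phi c : O (phi c). Proof. by rewrite -(evC phi w); apply: integral_id. Qed.
Let O_a j : O (a j). Proof. by apply: integral_sqr; rewrite -phix; apply: O_phi. Qed.

Let al2 j : al j ^+ 2 = a j ^+ 2 * w. Proof. by rewrite /al /w; field. Qed.
Let be2 j : be j ^+ 2 = 1 - a j ^+ 2 * w.
Proof.
have -> : be j ^+ 2 = b j ^+ 2 * w by rewrite /be /w; field.
have -> : b j ^+ 2 = D ^+ 2 - a j ^+ 2 by rewrite -(circ j); ring.
by rewrite /w; field.
Qed.

Let O_al j : O (al j).
Proof.
apply: integral_sqr; rewrite al2 -phix.
by apply: integral_mul; [apply: O_phi | apply: O_w].
Qed.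
Let O_be j : O (be j).
Proof.
apply: integral_sqr; rewrite be2 -phix; apply: integral_sub; first exact: integral1.
by apply: integral_mul; [apply: O_phi | apply: O_w].
Qed.

Let wO_add v1 v2 : wO v1 -> wO v2 -> wO (v1 + v2).
Proof. by move=> h1 h2; rewrite /wO mulrDl; apply: integral_add. Qed.
Let wO_sub v1 v2 : wO v1 -> wO v2 -> wO (v1 - v2).
Proof. by move=> h1 h2; rewrite /wO mulrBl; apply: integral_sub. Qed.
Let wO_mul v1 v2 : O v1 -> wO v2 -> wO (v1 * v2).
Proof. by move=> h1 h2; rewrite /wO -mulrA; apply: integral_mul. Qed.

Let wO_al i j : wO (al i * al j).
Proof.
have -> : al i * al j = (a i * a j) * w by rewrite /al /w; field.
by rewrite /wO -mulrA mulVf ?expf_neq0 // mulr1; apply: integral_mul; apply: O_a.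
Qed.

Let partial_prod (s : seq I) : exists p r,
  [/\ \prod_(j <- s) (be j + im * al j) = p + im * r,
      \prod_(j <- s) (be j - im * al j) = p - im * r,
      O p /\ O r, wO (p - \prod_(j <- s) be j) & forall j, wO (r * al j)].
Proof.
elim: s => [|i s [p [r [E1 E2 [Op Or] wp wr]]]].
  exists 1, 0; rewrite !big_nil mulr0 addr0 subr0 subrr; split=> //.
  - by split; [apply: integral1 | apply: integral0].
  - by rewrite /wO mul0r; apply: integral0.
  - by move=> j; rewrite /wO !mul0r; apply: integral0.
exists (p * be i - r * al i), (p * al i + r * be i); rewrite !big_cons E1 E2; split.
- transitivity (be i * p + (im * im) * (al i * r) + im * (al i * p + be i * r)); first by ring.
  by rewrite imE; ring.
- transitivity (be i * p + (im * im) * (al i * r) - im * (al i * p + be i * r)); first by ring.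
  by rewrite imE; ring.
- by split; [apply: integral_sub | apply: integral_add]; apply: integral_mul;
    first [exact: Op | exact: Or | exact: O_al | exact: O_be].
- have -> : p * be i - r * al i - be i * \prod_(j <- s) be j =
    be i * (p - \prod_(j <- s) be j) - r * al i by ring.
  by apply: wO_sub; [apply: wO_mul; [exact: O_be|] | exact: wr].
- move=> j; have -> : (p * al i + r * be i) * al j = p * (al i * al j) + be i * (r * al j) by ring.
  by apply: wO_add; apply: wO_mul; [exact: Op|exact: wO_al|exact: O_be|exact: wr].
Qed.

Let prod_be2 (s : seq I) : wO (\prod_(j <- s) be j ^+ 2 - 1).
Proof.
elim: s => [|i s IH]; first by rewrite big_nil subrr /wO mul0r; apply: integral0.
rewrite big_cons; set P := \prod_(_ <- _) _ in IH *.
have -> : be i ^+ 2 * P - 1 = be i ^+ 2 * (P - 1) - al i * al i.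
  by rewrite be2 -expr2 al2; ring.
apply: wO_sub; last exact: wO_al.
by apply: wO_mul => //; rewrite expr2; apply: integral_mul; exact: O_be.
Qed.

(* Let O be the integral closure of A[w], w = 1/D^2. With al_j = a_j/D and
   be_j = b_j/D, the relation Re prod (be_j + i al_j) = 0 reads prod be_j = 0
   modulo w O, while be_j^2 = 1 modulo w O; so 1 is in w O, that is, D^2 is in O. *)
Lemma integral_diam2 : integralOver phi (D ^+ 2).
Proof.
have D20 : D ^+ 2 != 0 by rewrite expf_neq0.
apply: integral_inv_adjoin => //; rewrite -/w -[D ^+ 2]mul1r.
have [p [r [E1 E2 [Op _] wp _]]] := partial_prod (index_enum I).
have eE : \prod_j (be j + im * al j) = im.
  transitivity (\prod_j ((b j + im * a j) * D^-1)).
    by apply: eq_bigr => j _; rewrite /be /al; ring.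
  by rewrite big_split prodr_const /= prod_p exprVn mulfK // expf_neq0.
have eE' : \prod_j (be j - im * al j) = - im.
  transitivity (\prod_j ((b j - im * a j) * D^-1)).
    by apply: eq_bigr => j _; rewrite /be /al; ring.
  by rewrite big_split prodr_const /= prod_m exprVn mulNr mulfK // expf_neq0.
have p0 : p = 0.
  apply: (mulfI two_neq0); rewrite mulr0.
  transitivity ((p + im * r) + (p - im * r)); first by ring.
  by rewrite -E1 -E2 eE eE' subrr.
have O_prod : O (\prod_j be j).
  apply: (big_ind O) => [||j _]; [exact: integral1 | exact: integral_mul | exact: O_be].
have wB : wO (\prod_j be j ^+ 2).
  have -> : \prod_j be j ^+ 2 = - \prod_j be j * (p - \prod_j be j).
    by rewrite p0 sub0r mulrNN -expr2 prodrXl.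
  by apply: wO_mul => //; apply: integral_opp.
rewrite -[1](subKr (\prod_j be j ^+ 2)); by apply: wO_sub; [exact: wB | exact: prod_be2].
Qed.

End Circumdiameter.

Lemma integral_tofrac (A : comNzRingType) (T : idomainType)
    (psi : {rmorphism A -> T}) (z : T) :
  integralOver (@tofrac T \o psi) (tofrac z) -> integralOver psi z.
Proof.
case=> p pmon pz; exists p => //; move: pz.
by rewrite map_poly_comp !rootE horner_map tofrac_eq0.
Qed.

(** * Minimal polynomials of the area and of the squared diameter *)

Section MinimalPolynomials.
Variables (C : numClosedFieldType) (m : nat).
Hypothesis m_gt0 : (0 < m)%N.
Notation T := {mpoly C[m.+1]}.
Notation A := {mpoly int[m.+1]}.

Definition psi : {rmorphism A -> T} := mmap intr (fun j => sine C j ^+ 2).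
(** This is 4K: the triangle spanned by the centre and side j has area (D/2)^2 sin(2 t_j) / 2 = a_j
    b_j / 4. *)
Definition darea : T := \sum_j sine C j * cosine C j.
Definition area2 : T := darea ^+ 2.
Definition diam2 : T := diam C m ^+ 2.

Lemma psiX j : psi 'X_j = sine C j ^+ 2.
Proof. by rewrite /= mmapX mmap1U. Qed.

Lemma char0T (z : int) : z%:~R = 0 :> T -> z = 0.
Proof.
rewrite -(rmorph_int (@mpolyC m.+1 C)) => /eqP; rewrite mpolyC_eq0 intr_eq0.
by move/eqP.
Qed.

Lemma integral_diam2T : integralOver psi diam2.
Proof.
apply: integral_tofrac; rewrite rmorphXn.
apply: (@integral_diam2 _ _ (@tofrac T \o psi) 'I_m.+1 (fun j => 'X_j)
  (fun j => tofrac (sine C j)) (fun j => tofrac (cosine C j)) (tofrac (imT C m))).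
- by rewrite -rmorphM imT2 rmorphN1.
- by rewrite -(rmorph_nat (@tofrac T)) tofrac_eq0; apply/eqP => /(char0T (z := 2)).
- by rewrite tofrac_eq0 diam_neq0.
- by move=> j; rewrite /= mmapX mmap1U rmorphXn.
- by move=> j; rewrite -!rmorphXn -rmorphD sine_cosine.
- rewrite card_ord -rmorphXn -rmorphM -prod_chord rmorph_prod; apply: eq_bigr => j _.
  by rewrite -rmorphM -rmorphD cosD.
- rewrite card_ord -rmorphXn -rmorphM -rmorphN -prod_cchord rmorph_prod.
  by apply: eq_bigr => j _; rewrite -rmorphM -rmorphB cosB.
Qed.

Lemma integral_area2 : integralOver psi area2.
Proof.
have Ocs j : integralOver psi (sine C j * cosine C j).
  apply: integral_sqr; rewrite exprMn -psiX.
  have -> : cosine C j ^+ 2 = diam2 - psi 'X_j by rewrite psiX /diam2 -(sine_cosine _ j); ring.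
  apply: integral_mul; first exact: integral_id.
  by apply: integral_sub; [exact: integral_diam2T | exact: integral_id].
have OC : integralOver psi darea.
  by apply: (big_ind (integralOver psi)) => //; [exact: integral0 | exact: integral_add].
by rewrite /area2 expr2; apply: integral_mul.
Qed.

Lemma psi0 c : psi c = 0 -> c = 0.
Proof.
apply: (@psi_inj m T (imT C m) (diam C m) (sine C (m := m)) (cosine C (m := m)) psi
  (imT2 C m) char0T (@sine_cosine C m) psiX (@rotate C m) (@dilate C m)).
- exact: rotate_der.
- exact: dilate_der.
- exact: rotate_sine.
- exact: rotate_cosine.
- exact: dilate_sine.
- exact: dilate_cosine.
- exact: tan_sum_neq0.
- exact: sine_neq0.
- exact: cosine_neq0.
Qed.

Lemma area_minpoly : exists alpha : {poly A}, [/\ alpha \is monic,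
    ev psi area2 alpha = 0 & forall p, ev psi area2 p = 0 -> exists q, p = q * alpha].
Proof. exact: minpoly_exists (@factorial_mpoly _) psi0 _ integral_area2. Qed.

Lemma diam_minpoly : exists S : {poly A}, [/\ S \is monic,
    ev psi diam2 S = 0 & forall p, ev psi diam2 p = 0 -> exists q, p = q * S].
Proof. exact: minpoly_exists (@factorial_mpoly _) psi0 _ integral_diam2T. Qed.

Lemma minpoly_size_gt1 w (al : {poly A}) : al \is monic -> ev psi w al = 0 -> (1 < size al)%N.
Proof.
move=> amon; rewrite ltnNge => alK; apply/negP => /size1_polyC E.
have := monic_neq0 amon; move: alK; rewrite E evC => /psi0 ->.
by rewrite eqxx.
Qed.

(** By minimality of alpha and characteristic 0, alpha'(u) <> 0; hence the denominator 4 u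
    alpha'(u)^2 in [diam_rational] is nonzero and [size_rational] applies. *)
Lemma size_diam_area (alpha S : {poly A}) :
  alpha \is monic -> ev psi area2 alpha = 0 ->
  (forall p, ev psi area2 p = 0 -> exists q, p = q * alpha) ->
  (forall p, ev psi diam2 p = 0 -> exists q, p = q * S) ->
  (size S <= size alpha)%N.
Proof.
move=> amon aK aP SP.
have da : ev psi area2 alpha^`() != 0.
  apply/eqP => /aP dP; have a1 := minpoly_size_gt1 amon aK.
  have d0 : alpha^`() != 0.
    have [k sk] : exists k, size alpha = k.+2.
      by case: (size alpha) a1 => [|[|k]] // _; exists k.
    have : alpha^`()`_k != 0.
      have := monicP amon; rewrite lead_coefE sk /= coef_deriv => ->.
      rewrite -mpolyC1 -mpolyCMn mpolyC_eq0 // pnatr_eq0 //.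
    by apply: contraNneq => ->; rewrite coef0.
  have := leq_ltn_trans (size_kernel d0 dP) (lt_size_deriv (monic_neq0 amon)).
  by rewrite ltnn.
have := @diam_rational m T (imT C m) (diam C m) (sine C (m := m)) (cosine C (m := m)) psi
  (imT2 C m) char0T (@sine_cosine C m) psiX (@rotate C m) (@dilate C m).
move=> /(_ (@rotate_der C m) (@dilate_der C m) (@rotate_sine C m) (@rotate_cosine C m)).
move=> /(_ (@dilate_sine C m) (@dilate_cosine C m) (tan_sum_neq0 C m)).
move=> /(_ (cosine_neq0 C m_gt0) ord_max alpha aK) E.
have g0 : ev psi area2 (4 *: ('X * alpha^`() ^+ 2)) != 0.
  have four : psi 4 != 0 by rewrite rmorph_nat; apply/eqP => /(char0T (z := 4)).
  by rewrite evZ !rmorphM evX !mulf_neq0 //; exact: area_neq0.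
have [S0 S00 [S0K sS0]] := size_rational amon aK g0 E.
exact: leq_trans (size_kernel S00 (SP _ S0K)) sS0.
Qed.

End MinimalPolynomials.

(** * Homogeneity *)

Lemma coef_graded n (T : comNzRingType) (f : {rmorphism {mpoly int[n]} -> T})
    (g : {rmorphism {mpoly int[n]} -> {poly T}}) :
  (forall j, g 'X_j = f 'X_j *: 'X^2) ->
  forall a i, (g a)`_(2 * i) = f (pihomog mdeg i a).
Proof.
move=> gX a i.
have gXk (k : 'X_{1..n}) : g 'X_[k] = f 'X_[k] *: 'X^(2 * mdeg k).
  rewrite mpolyXE_id !rmorph_prod mdegE.
  transitivity (\prod_(j < n) ((f 'X_j ^+ k j) *: 'X^(2 * k j) : {poly T})).
    by apply: eq_bigr => j _; rewrite rmorphXn gX exprZn -exprM.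
  rewrite scaler_prod; congr (_ *: _).
    by apply: eq_bigr => j _; rewrite rmorphXn.
  by rewrite -expr_sum big_distrr.
elim/mpolyind: a => [|c k p _ _ IH].
  by rewrite pihomog0 !rmorph0 coef0.
rewrite pihomogD !rmorphD coefD IH; congr (_ + _).
have -> : pihomog mdeg i (c *: 'X_[k]) = c *: pihomog mdeg i 'X_[k] by rewrite linearZ.
rewrite -!mul_mpolyC !rmorphM -[c]intz !rmorph_int gXk pihomogX.
rewrite mulrzl -mulrzl.
rewrite -(rmorph_int (@polyC T)) coefCM coefZ coefXn; congr (_ * _).
rewrite eqn_pmul2l // eq_sym; case: eqP => _; first by rewrite mulr1.
by rewrite mulr0 rmorph0.
Qed.

(** Keeping in each coefficient of [al] only the component of the expected degree gives another
    monic polynomial killing w, because the relation splits by degree. The difference has smaller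
    size, so it is 0. Here [h] is the degree of w when each variable has degree 1. *)
Lemma homog_minpoly n (T : idomainType) (f : {rmorphism {mpoly int[n]} -> T})
    (g : {rmorphism T -> {poly T}}) (w : T) h (al : {poly {mpoly int[n]}}) :
  (forall j, g (f 'X_j) = f 'X_j *: 'X^2) -> g w = w *: 'X^(2 * h) ->
  al \is monic -> ev f w al = 0 ->
  (forall p, ev f w p = 0 -> exists q, p = q * al) ->
  forall k, (k < size al)%N -> al`_k \is (h * ((size al).-1 - k)).-homog.
Proof.
move=> gX gw amon aK aP; pose d := (size al).-1.
have sa : size al = d.+1 by rewrite prednK // size_poly_gt0 monic_neq0.
pose be := \poly_(k < d.+1) pihomog mdeg (h * (d - k)) al`_k.
have beE k : (k < d.+1)%N -> be`_k = pihomog mdeg (h * (d - k)) al`_k.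
  by move=> kd; rewrite coef_poly kd.
have bK : ev f w be = 0.
  have := congr1 (fun p : T => (g p)`_(2 * (h * d))) aK.
  rewrite /be poly_def !rmorph_sum evE sa rmorph_sum rmorph0 coef0 coef_sum => E.
  rewrite -[RHS]E; apply: eq_bigr => k _; rewrite evZ rmorphXn evX rmorphM rmorphXn gw.
  rewrite exprZn -exprM -scalerAr coefZ coefMXn mulrC; congr (_ * _).
  have kd : (k <= d)%N by rewrite -ltnS.
  rewrite ltnNge -mulnA leq_mul2l leq_mul2l kd !orbT /=.
  by rewrite -!mulnBr; apply/esym/(coef_graded (f := f) (g := g \o f)).
have : al - be = 0.
  apply/eqP; apply: contraT => ab0; have := aP (al - be).
  rewrite rmorphB aK bK subrr => /(_ erefl) /(size_kernel ab0); rewrite leqNgt => /negP[].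
  rewrite sa ltnS; apply/leq_sizeP => k dk; rewrite coefB.
  have [kd|kd] := ltnP k d.+1; last first.
    by rewrite !nth_default ?subr0 ?sa // (leq_trans (size_poly _ _)).
  have -> : k = d by apply/eqP; rewrite eqn_leq -ltnS kd.
  rewrite beE // subnn muln0.
  have -> : al`_d = 1 by rewrite /d -lead_coefE (monicP amon).
  by rewrite pihomog_dE ?subrr // dhomog1.
move/eqP; rewrite subr_eq0 => /eqP E k; rewrite {1}sa {1}E => kd.
by rewrite beE // pihomogP.
Qed.

Section Homogeneity.
Variables (C : numClosedFieldType) (m : nat).
Notation T := {mpoly C[m.+1]}.
Notation A := {mpoly int[m.+1]}.

(* The grading of T for which the sides have degree 1. *)
Definition grade : {rmorphism T -> {poly T}} :=
  mmap (polyC \o @mpolyC m.+1 C)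
    (fun j => if j == ord_max then 'X_j *: 'X else ('X_j)%:P).

Lemma grade_scale : grade (scale C m) = scale C m *: 'X.
Proof. by rewrite /= mmapX mmap1U eqxx. Qed.

Lemma grade_arc k : grade (half_arc C k) = (half_arc C k)%:P.
Proof. by rewrite /= mmapX mmap1U eq_sym (negPf (neq_lift _ _)). Qed.

Lemma grade_prod (P : pred 'I_m) : grade (\prod_(k | P k) half_arc C k) =
  (\prod_(k | P k) half_arc C k)%:P.
Proof. by rewrite !rmorph_prod; apply: eq_bigr => k _; rewrite grade_arc. Qed.

Lemma grade_arc_prod : grade (arc_prod C m) = (arc_prod C m)%:P.
Proof. exact: grade_prod. Qed.

Lemma gradeC c : grade c%:MP = c%:MP%:P.
Proof. by rewrite /= mmapC. Qed.

Lemma grade_diam : grade (diam C m) = diam C m *: 'X.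
Proof. by rewrite rmorphM grade_scale grade_arc_prod -!mul_polyC polyCM; ring. Qed.

Lemma grade_chord j : grade (chord C j) = chord C j *: 'X.
Proof.
have [k ->|->] := unliftP ord_max j.
  by rewrite chord_lift rmorphM grade_diam grade_arc -!mul_polyC (polyCM (diam C m)); ring.
by rewrite chord_max rmorphM grade_scale gradeC -!mul_polyC polyCM; ring.
Qed.

Lemma grade_cchord j : grade (cchord C j) = cchord C j *: 'X.
Proof.
have [k ->|->] := unliftP ord_max j.
  by rewrite cchord_lift rmorphM grade_scale grade_prod -!mul_polyC polyCM; ring.
rewrite cchord_max rmorphN !rmorphM grade_scale gradeC grade_arc_prod -!mul_polyC.
by rewrite polyCN !polyCM; ring.
Qed.

Lemma grade_sine j : grade (sine C j) = sine C j *: 'X.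
Proof.
rewrite /sine rmorphN !rmorphM rmorphB grade_chord grade_cchord !gradeC -!mul_polyC.
by rewrite polyCN !polyCM polyCB; ring.
Qed.

Lemma grade_cosine j : grade (cosine C j) = cosine C j *: 'X.
Proof.
rewrite /cosine rmorphM rmorphD grade_chord grade_cchord !gradeC -!mul_polyC.
by rewrite !polyCM polyCD; ring.
Qed.

Lemma grade_diam2 : grade (diam2 C m) = diam2 C m *: 'X^(2 * 1).
Proof. by rewrite rmorphXn grade_diam exprZn. Qed.

Lemma grade_area2 : grade (area2 C m) = area2 C m *: 'X^(2 * 2).
Proof.
rewrite rmorphXn; have -> : grade (darea C m) = darea C m *: 'X^2.
  rewrite rmorph_sum scaler_suml; apply: eq_bigr => j _.
  by rewrite rmorphM grade_sine grade_cosine -scalerAl -scalerAr scalerA -expr2.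
by rewrite exprZn -exprM.
Qed.

Lemma homog_area (al : {poly A}) : al \is monic -> ev (psi C m) (area2 C m) al = 0 ->
  (forall p, ev (psi C m) (area2 C m) p = 0 -> exists q, p = q * al) ->
  forall k, (k < size al)%N -> al`_k \is (2 * ((size al).-1 - k)).-homog.
Proof.
apply: (homog_minpoly (g := grade)); last exact: grade_area2.
by move=> j; rewrite psiX rmorphXn grade_sine exprZn.
Qed.

Lemma homog_diam (al : {poly A}) : al \is monic -> ev (psi C m) (diam2 C m) al = 0 ->
  (forall p, ev (psi C m) (diam2 C m) p = 0 -> exists q, p = q * al) ->
  forall k, (k < size al)%N -> al`_k \is (1 * ((size al).-1 - k)).-homog.
Proof.
apply: (homog_minpoly (g := grade)); last exact: grade_diam2.
by move=> j; rewrite psiX rmorphXn grade_sine exprZn.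
Qed.

End Homogeneity.

(** * The lower bound *)

Definition aeval n (K : comNzRingType) (x : 'I_n -> K) : {rmorphism {mpoly int[n]} -> K} :=
  mmap intr x.

Lemma aevalX n (K : comNzRingType) (x : 'I_n -> K) j : aeval x 'X_j = x j.
Proof. by rewrite /= mmapX mmap1U. Qed.

Lemma aeval_morph n (K L : comNzRingType) (f : {rmorphism K -> L}) (y : 'I_n -> K) p :
  f (aeval y p) = aeval (fun j => f (y j)) p.
Proof.
apply: (mpoly_int_ext (f := f \o aeval y) (g := aeval (fun j => f (y j)))) => i.
by rewrite -[LHS]/(f (aeval y 'X_i)) !aevalX.
Qed.

Lemma eq_aeval n (K : comNzRingType) (x y : 'I_n -> K) p : x =1 y -> aeval x p = aeval y p.
Proof.
move=> xy; apply: (mpoly_int_ext (f := aeval x) (g := aeval y)) => i.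
by rewrite !aevalX.
Qed.

Lemma aeval_to_poly n (K : comNzRingType) (x : 'I_n -> K) w p :
  ev (aeval x) w (to_poly p) = aeval (fun i => if unlift ord0 i is Some j then x j else w) p.
Proof.
set y := fun i => _.
apply: (mpoly_int_ext (f := ev (aeval x) w \o to_poly) (g := aeval y)) => i.
rewrite -[LHS]/(ev (aeval x) w (to_poly 'X_i)) aevalX /y.
case: (unliftP ord0 i) => [j|] ->; first by rewrite to_polyXS evC aevalX.
by rewrite to_polyX0 evX.
Qed.

Lemma meval_map_int n (K : comNzRingType) (y : 'I_n -> K) p :
  (map_mpoly (intr : int -> K) p).@[y] = aeval y p.
Proof.
apply: (mpoly_int_ext (f := meval y \o map_mpoly intr) (g := aeval y)) => i.
by rewrite aevalX -[LHS]/((map_mpoly intr 'X_i).@[y]) map_mpolyX mevalXU.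
Qed.

Lemma ev_morph n (K L : comNzRingType) (x : 'I_n -> K) (f : {rmorphism K -> L}) w p :
  f (ev (aeval x) w p) = ev (aeval (fun j => f (x j))) (f w) p.
Proof.
rewrite !evE rmorph_sum; apply: eq_bigr => i _.
by rewrite rmorphM rmorphXn aeval_morph.
Qed.

Lemma eq_ev_aeval n (K : comNzRingType) (x y : 'I_n -> K) w p :
  x =1 y -> ev (aeval x) w p = ev (aeval y) w p.
Proof. by move=> xy; rewrite !evE; apply: eq_bigr => i _; rewrite (eq_aeval _ xy). Qed.

Section Points.
Variables (C : numClosedFieldType) (m : nat).
Notation T := {mpoly C[m.+1]}.
Notation A := {mpoly int[m.+1]}.

Lemma meval_ev (v : 'I_m.+1 -> C) w (p : {poly A}) :
  (ev (psi C m) w p).@[v] = ev (aeval (fun j => (sine C j ^+ 2).@[v])) w.@[v] p.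
Proof. exact: (ev_morph (fun j => sine C j ^+ 2) (meval v)). Qed.

Section Point.
Variables (s : C) (z : 'I_m.+1 -> C).
Hypotheses (z0 : forall j, z j != 0) (zprod : \prod_j z j = -1).

(** The last square root is dictated by the product being i; an independent choice could give -i. *)
Definition half_arcs (j : 'I_m.+1) : C :=
  if unlift ord_max j is Some k then sqrtC (z j)
  else 'i / \prod_k sqrtC (z (lift ord_max k)).

Lemma half_arcs_sqr j : half_arcs j ^+ 2 = z j.
Proof.
rewrite /half_arcs; case: unliftP => [k _|->]; first by rewrite sqrtCK.
rewrite expr_div_n sqrCi -prodrXl.
under eq_bigr => k _ do rewrite sqrtCK.
rewrite -zprod (bigD1_ord ord_max) //= mulfK //.
exact/prodf_neq0.
Qed.

Lemma half_arcs_neq0 j : half_arcs j != 0.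
Proof. by apply: contraNneq (z0 j) => h; rewrite -half_arcs_sqr h expr0n. Qed.

Lemma half_arcs_prod : \prod_j half_arcs j = 'i.
Proof.
rewrite (bigD1_ord ord_max) //= {1}/half_arcs unlift_none.
rewrite [X in _ * X](eq_bigr (fun k : 'I_m => sqrtC (z (lift ord_max k)))); last first.
  by move=> k _; rewrite /half_arcs liftK.
by rewrite divfK //; apply/prodf_neq0 => k _; rewrite sqrtC_eq0.
Qed.

Definition zpoint := polygon_point (sqrtC s) half_arcs.

Lemma zpoint_sine j : (sine C j ^+ 2).@[zpoint] = s * (2 - z j - (z j)^-1) / 4.
Proof.
rewrite eval_sine2 ?half_arcs_prod //; last exact: half_arcs_neq0.
by rewrite sqrtCK half_arcs_sqr.
Qed.

Lemma zpoint_diam2 : (diam2 C m).@[zpoint] = s.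
Proof.
rewrite /diam2 expr2 mevalM eval_diam ?half_arcs_prod -?expr2 ?sqrtCK //.
exact: half_arcs_neq0.
Qed.

Lemma ev_diam_zero p : ev (psi C m) (diam2 C m) p = 0 ->
  ev (aeval (fun j => s * (2 - z j - (z j)^-1) / 4)) s p = 0.
Proof.
move/(congr1 (meval zpoint)); rewrite meval_ev meval0 zpoint_diam2 => <-.
by apply: eq_ev_aeval => j; rewrite zpoint_sine.
Qed.

End Point.
End Points.

(** For k > 0 the polynomial X^k - c is coprime to its derivative. For k = 0 the list is empty,
    which suits the sets E of at most half the indices. *)
Lemma distinct_roots (C : numClosedFieldType) k (c : C) : c != 0 ->
  exists r : seq C, [/\ uniq r, size r = k & forall x, x \in r -> x ^+ k = c].
Proof.
move=> c0; case: k => [|k]; first by exists [::].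
have [r rE] := closed_field_poly_normal ('X^(k.+1) - c%:P : {poly C}).
rewrite (monicP (monicXnsubC _ _)) // scale1r in rE.
have rP x : x \in r -> x ^+ k.+1 = c.
  rewrite -root_prod_XsubC -rE rootE !hornerE subr_eq0 => /eqP //.
exists r; split=> //.
  rewrite -separable_prod_XsubC -rE unlock; apply/Bezout_eq1_coprimepP.
  have kc : k.+1%:R * c != 0 by rewrite mulf_neq0 // pnatr_eq0.
  exists (- (c^-1)%:P, ((k.+1%:R * c)^-1)%:P * 'X) => /=.
  rewrite derivB derivXn derivC subr0 /= -['X^k *+ _]mulr_natl exprS.
  have e1 : (c^-1)%:P * c%:P = 1 by rewrite -polyCM mulVf // polyC1.
  have e2 : ((k.+1%:R * c)^-1)%:P * k.+1%:R = (c^-1)%:P :> {poly C}.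
    rewrite -[X in _ * X](rmorph_nat (@polyC C)) -polyCM invfM mulrAC mulVf ?mul1r //.
    by rewrite pnatr_eq0.
  move: e1 e2; move: ((_ * _)^-1)%:P (c^-1)%:P c%:P (k.+1%:R : {poly C}) => b a e K e1 e2.
  transitivity (a * e + (b * K - a) * ('X * 'X^k)); first by ring.
  by rewrite e1 e2 subrr mul0r addr0.
by apply/eqP; rewrite -eqSS -(size_prod_XsubC _ id) -rE size_XnsubC.
Qed.

Lemma uniq_flatten_map (I J : eqType) (r : I -> seq J) (s : seq I) :
  uniq s -> (forall i, uniq (r i)) ->
  (forall i j x, x \in r i -> x \in r j -> i = j) -> uniq (flatten (map r s)).
Proof.
move=> + ur disj; elim: s => //= i s IH /andP[is_ us].
rewrite cat_uniq ur IH // andbT /=; apply/hasPn => x /flattenP[_ /mapP[j js ->] xj].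
by apply: contra is_ => xi; rewrite (disj _ _ _ xi xj).
Qed.

Lemma size_aeval_homog n (K : comNzRingType) (x : 'I_n -> {poly K}) e a :
  (forall j, (size (x j) <= 3)%N) -> a \is e.-homog -> (size (aeval x a) <= (2 * e).+1)%N.
Proof.
move=> x3 /dhomogP ah; rewrite /= /mmap.
apply: (leq_trans (size_sum _ _ _)); apply/bigmax_leqP_seq => k /ah <- _.
rewrite -(rmorph_int (@polyC K)) mul_polyC; apply: leq_trans (size_scale_leq _ _) _.
have sM (p q : {poly K}) i j : (size p <= i.+1)%N -> (size q <= j.+1)%N ->
    (size (p * q)%R <= (i + j).+1)%N.
  move=> pi qj; apply: leq_trans (size_polyMleq _ _) _.
  by rewrite -subn1 leq_subLR -(addnC _.+1) addn1 (leq_trans (leq_add pi qj)) // addnS addSn.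
rewrite /mmap1 /= mdegE big_distrr /=.
apply: (big_ind2 (fun (p : {poly K}) i => (size p <= i.+1)%N)) => [|p i q j|i _].
- by rewrite size_poly1.
- exact: sM.
elim: (k i) => [|l IH]; first by rewrite expr0 size_poly1.
by rewrite exprS mulnS; apply: sM.
Qed.

Lemma aeval0_homog n (K : comNzRingType) (x : 'I_n -> K) e a :
  (forall j, x j = 0) -> (0 < e)%N -> a \is e.-homog -> aeval x a = 0.
Proof.
move=> x0 e0 /dhomogP ah; rewrite /= /mmap big_seq big1 // => k /ah ke.
have [i ki] : exists i, k i != 0%N.
  apply: contrapT => nk; move: e0; rewrite -ke /= mdegE big1 // => i _.
  by apply: contrapT => /eqP ki; apply: nk; exists i.
by rewrite /mmap1 (bigD1 i) //= x0 expr0n (negPf ki) mul0r mulr0.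
Qed.

Section LowerBound.
Variables (C : numClosedFieldType) (m : nat).
Notation T := {mpoly C[m.+1]}.
Notation A := {mpoly int[m.+1]}.
Variables (S : {poly A}) (d : nat).
Hypotheses (Smon : S \is monic) (sS : size S = d.+1).
Hypothesis SK : ev (psi C m) (diam2 C m) S = 0.
Hypothesis Shom : forall k, (k < d.+1)%N -> S`_k \is (d - k).-homog.

(* [trace kap L] is S along x_j = - (y_j - 1)^2 prod_(l <> j) kap_l, which are the
   squared sides of the polygon with arcs y_j := kap_j L and squared diameter
   s = 4 L prod kap. *)
Definition trace_sides (K : comNzRingType) (kap : 'I_m.+1 -> K) (L : K) (j : 'I_m.+1) : K :=
  - ((kap j * L - 1) ^+ 2 * \prod_(l | l != j) kap l).
Definition trace_diam (K : comNzRingType) (kap : 'I_m.+1 -> K) (L : K) : K :=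
  4 * (\prod_l kap l) * L.
Definition trace (K : comNzRingType) (kap : 'I_m.+1 -> K) (L : K) : K :=
  ev (aeval (trace_sides kap L)) (trace_diam kap L) S.

Lemma trace_morph (K K' : comNzRingType) (f : {rmorphism K -> K'}) kap L :
  f (trace kap L) = trace (fun j => f (kap j)) (f L).
Proof.
rewrite /trace ev_morph /trace_diam !rmorphM rmorph_nat rmorph_prod.
apply: eq_ev_aeval => j.
by rewrite /trace_sides rmorphN rmorphM rmorphXn rmorphB rmorphM rmorph1 rmorph_prod.
Qed.

Lemma eq_trace (K : comNzRingType) (kap kap' : 'I_m.+1 -> K) L L' :
  kap =1 kap' -> L = L' -> trace kap L = trace kap' L'.
Proof. by move=> /funext -> ->. Qed.

Lemma trace_horner (kap : 'I_m.+1 -> {poly C}) L t :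
  (trace kap L).[t] = trace (fun j => (kap j).[t]) L.[t].
Proof. exact: (trace_morph (horner_eval t)). Qed.

(** The polygon with z_j = y_j on B and z_j = 1/y_j off B has the same squared sides and diameter as
    the formal one with arcs y_j; the hypothesis says that the product of these z_j is -1. *)
Lemma trace_root (kap : 'I_m.+1 -> C) (L : C) (B : {set 'I_m.+1}) :
  (forall j, kap j != 0) -> L != 0 ->
  \prod_(j in B) (kap j * L) = - \prod_(j in ~: B) (kap j * L) -> trace kap L = 0.
Proof.
move=> kap0 L0 BE; pose y j := kap j * L.
pose z j := if j \in B then y j else (y j)^-1.
have y0 j : y j != 0 by rewrite mulf_neq0.
have z0 j : z j != 0 by rewrite /z; case: ifP; rewrite ?invr_eq0.
have zprod : \prod_j z j = -1.
  rewrite (bigID (mem B)) /=.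
  rewrite (eq_bigr y) => [|j jB]; last by rewrite /z jB.
  rewrite [X in _ * X](eq_bigr (fun j => (y j)^-1)) => [|j jB]; last by rewrite /z (negPf jB).
  have -> : \prod_(j | j \notin B) (y j)^-1 = (\prod_(j in ~: B) y j)^-1.
    by rewrite prodfV; congr (_^-1); apply: eq_bigl => j; rewrite inE.
  rewrite [X in X * _]BE.
  by rewrite mulNr divff //; apply/prodf_neq0 => j _; apply: y0.
have s0 : trace_diam kap L != 0.
  by rewrite !mulf_neq0 ?pnatr_eq0 //; apply/prodf_neq0 => j _; apply: kap0.
rewrite -[RHS](ev_diam_zero (trace_diam kap L) z0 zprod SK); apply: eq_ev_aeval => j.
have -> : 2 - z j - (z j)^-1 = 2 - y j - (y j)^-1.
  by rewrite /z; case: ifP => // _; rewrite invrK; ring.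
have PE : \prod_l kap l = kap j * \prod_(l | l != j) kap l by rewrite (bigD1 j).
rewrite /trace_sides /trace_diam PE /y; move: (\prod_(l | _) _) => Q.
by field; rewrite kap0 L0.
Qed.

(** The coefficient of degree k in S has degree d - k in the squared sides, which are quadratic in
    L, and the diameter is linear: 2 (d - k) + k <= 2 d. *)
Lemma size_trace (kap : 'I_m.+1 -> C) :
  (size (trace (fun j => (kap j)%:P) 'X) <= (2 * d).+1)%N.
Proof.
rewrite /trace evE sS (leq_trans (size_sum _ _ _)) //; apply/bigmax_leqP => k _.
have kd : (k <= d)%N by rewrite -ltnS.
have s3 j : (size (trace_sides (fun j => (kap j)%:P) 'X j : {poly C}) <= 3)%N.
  rewrite /trace_sides -rmorph_prod size_polyN mulrC mul_polyC.
  apply: leq_trans (size_scale_leq _ _) _.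
  rewrite mul_polyC; apply: leq_trans (size_poly_exp_leq _ _) _.
  have h : (size ((kap j *: 'X : {poly C}) - 1)%R <= 2)%N.
    rewrite (leq_trans (size_polyD _ _)) // geq_max size_polyN size_poly1 andbT.
    by rewrite (leq_trans (size_scale_leq _ _)) // size_polyX.
  by move: h; set s0 := size _; lia.
have h1 := size_aeval_homog s3 (Shom (ltn_ord k)).
have h2 : (size ((trace_diam (fun j => (kap j)%:P) 'X : {poly C}) ^+ k) <= k.+1)%N.
  rewrite /trace_diam -rmorph_prod -(rmorph_nat (@polyC C)) -rmorphM mul_polyC exprZn.
  by rewrite (leq_trans (size_scale_leq _ _)) // size_polyXn.
apply: leq_trans (size_polyMleq _ _) _.
rewrite -subn1 leq_subLR (leq_trans (leq_add h1 h2)) //; lia.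
Qed.

(** All squared sides vanish here, so by homogeneity only the leading term of S survives. *)
Lemma trace1 : trace (fun=> 1 : C) 1 = 4 ^+ d.
Proof.
have x0 j : trace_sides (fun=> 1 : C) 1 j = 0.
  by rewrite /trace_sides mulr1 subrr expr0n mul0r oppr0.
rewrite /trace /trace_diam big1 // !mulr1 evE sS big_ord_recr /= big1 ?add0r => [|k _].
  by rewrite -[S`_d]/(S`_(d.+1).-1) -sS -lead_coefE (monicP Smon) rmorph1 mul1r.
by rewrite (aeval0_homog x0 _ (Shom (leqW (ltn_ord k)))) ?mul0r // subn_gt0.
Qed.

(** At L = 1 the trace is a polynomial in t, nonzero at t = 1 by [trace1], hence nonzero at some
    integer t > 1, where powers of t can be compared by their exponents. *)
Lemma trace_neq0 : exists2 t : nat, (1 < t)%N &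
  trace (fun j : 'I_m.+1 => (t%:R ^+ ((2 * m.+1).+1 ^ j)%N : C)%:P) 'X != 0.
Proof.
(* With n = m + 1, the exponents compared in the lower bound have digits at most 2n, so base 2n + 1
   determines them. *)
set B := (2 * m.+1).+1; pose W : {poly C} := trace (fun j : 'I_m.+1 => 'X^(B ^ j)) 1.
have WE t : W.[t] = trace (fun j : 'I_m.+1 => t ^+ (B ^ j)) 1.
  by rewrite trace_horner; apply: eq_trace => [j|]; rewrite ?hornerXn ?hornerC.
have W0 : W != 0.
  apply/eqP => W0; have := trace1; have := WE 1; rewrite W0 horner0.
  rewrite (_ : (fun j : 'I_m.+1 => 1 ^+ _) = fun=> 1 : C); last by apply/funext => j; rewrite expr1n.
  by move=> <- /eqP; rewrite eq_sym expf_eq0 pnatr_eq0 andbF.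
have [k Wk] : exists k : nat, W.[k.+2%:R] != 0.
  apply: contrapT => nk; case/eqP: W0.
  apply: (@poly_zero_on _ (fun x => exists k : nat, x = k.+2%:R)).
    exists (fun k => k.+2%:R) => [i j /eqP|k]; last by exists k.
    by rewrite eqr_nat => /eqP[].
  by move=> _ [k ->]; apply: contrapT => /eqP h; apply: nk; exists k.
exists k.+2 => //; apply: contraNneq Wk => P0; rewrite WE.
have := congr1 (fun p : {poly C} => p.[1]) P0; rewrite trace_horner horner0 hornerX => E.
by apply/eqP; rewrite -[RHS]E; apply: eq_trace => // j; rewrite hornerC.
Qed.

Lemma diam_degree_ge : (m.+1 * 'C(m, m./2) <= 2 * d)%N.
Proof.
have [t t1 P0] := trace_neq0; set B := (2 * m.+1).+1 in P0.
pose kap (j : 'I_m.+1) : C := t%:R ^+ (B ^ j).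
set P := trace _ _ in P0.
have kap0 j : kap j != 0 by rewrite expf_neq0 // pnatr_eq0 -lt0n ltnW.
have tC (E : {set 'I_m.+1}) : \prod_(j in E) kap j = t%:R ^+ (\sum_(j in E) B ^ j).
  by rewrite expr_sum.
pose c (E : {set 'I_m.+1}) : C := - (\prod_(j in ~: E) kap j / \prod_(j in E) kap j).
pose mE (E : {set 'I_m.+1}) := (2 * #|E| - m.+1)%N.
have c0 E : c E != 0 by rewrite oppr_eq0 mulf_neq0 ?invr_eq0 //; apply/prodf_neq0 => j _; apply: kap0.
have [r rP] := choice (fun E => distinct_roots (mE E) (c0 E)).
have r_pos E x : x \in r E -> (0 < mE E)%N.
  by have [_ sr _] := rP E; rewrite -sr; case: (r E).
have rE E x : x \in r E -> x ^+ mE E = c E by have [_ _] := rP E; apply.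
have rx0 E x : x \in r E -> x != 0.
  move=> xr; apply: contraNneq (c0 E) => x0.
  by rewrite -(rE _ _ xr) x0 expr0n gtn_eqF // (r_pos _ _ xr).
have root_r E x : x \in r E -> root P x.
  move=> xr; rewrite rootE /P trace_horner hornerX; apply/eqP; rewrite -[RHS](@trace_root kap x E) //.
  - by apply: eq_trace => // j; rewrite hornerC.
  - exact: rx0 xr.
  - rewrite !big_split /= !prodr_const -[in X in X = _](subnK (_ : #|~: E| <= #|E|)%N).
      have -> : (#|E| - #|~: E| = mE E)%N by rewrite /mE; have := cardsC E; rewrite card_ord; lia.
      by rewrite exprD (rE _ _ xr) /c mulrA mulrN mulrCA mulfV ?mulr1 ?mulNr //; apply/prodf_neq0 => j _; apply: kap0.
    have := r_pos _ _ xr; have := cardsC E; rewrite card_ord /mE; lia.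
(* Absolute values turn the two equations for x into an equality of powers of t, whose exponents are
   compared digit by digit in base B. An index in E but not in F would give the digit 0 on one side
   and [mE E + mE F] > 0 on the other; likewise with E and F exchanged. *)
have disj E F x : x \in r E -> x \in r F -> E = F.
  move=> xE xF; pose b (E' : {set 'I_m.+1}) := (\sum_(j in E') B ^ j)%N.
  have nE E' : x \in r E' -> `|x| ^+ mE E' * t%:R ^+ b E' = t%:R ^+ b (~: E') :> C.
    move=> xr; rewrite -normrX (rE _ _ xr) normrN normf_div !tC !normrX normr_nat.
    by rewrite divfK // expf_neq0 // pnatr_eq0 -lt0n ltnW.
  have x0 : `|x| != 0 by rewrite normr_eq0 (rx0 _ _ xE).
  have eqt : t%:R ^+ (b (~: E) * mE F + b F * mE E) =
      t%:R ^+ (b (~: F) * mE E + b E * mE F) :> C.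
    rewrite !exprD !exprM -!nE // !exprMn -!exprM.
    by rewrite (mulnC (mE F)) -!mulrA; congr (_ * _); rewrite mulrC.
  have /eqP := eqt; rewrite -!natrX eqr_nat eqn_exp2l // => /eqP eqb.
  pose g (E1 E2 : {set 'I_m.+1}) (j : 'I_m.+1) :=
    ((j \in ~: E1) * mE E2 + (j \in E2) * mE E1)%N.
  have mE_le E' : (mE E' <= m.+1)%N.
    by rewrite /mE; have := cardsC E'; rewrite card_ord; lia.
  have gB E1 E2 j : (g E1 E2 j < B)%N.
    by rewrite /g /B; have := mE_le E1; have := mE_le E2; case: (_ \in _); case: (_ \in _); lia.
  have gS E1 E2 : (b (~: E1) * mE E2 + b E2 * mE E1 = \sum_j g E1 E2 j * B ^ j)%N.
    rewrite /b !big_distrl /= !(big_mkcond (fun j => j \in _)) -big_split /=.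
    apply: eq_bigr => j _; rewrite /g; case: (_ \in _); case: (_ \in _); lia.
  rewrite !gS in eqb; have gg := base_expansion_inj (gB E F) (gB F E) eqb.
  have pE := r_pos _ _ xE; have pF := r_pos _ _ xF.
  apply/setP => j; have := gg j; rewrite /g !inE.
  by case: (j \in E); case: (j \in F) => //=; lia.
pose l := flatten [seq r E | E : {set 'I_m.+1}].
have ul : uniq l.
  by apply: uniq_flatten_map => [|E|//]; [exact: enum_uniq | have [] := rP E].
have sl : size l = (m.+1 * 'C(m, m./2))%N.
  rewrite -sum_excess_sets size_flatten /shape -map_comp sumnE big_map big_enum /=.
  by apply: eq_bigr => E _; case: (rP E).
rewrite -sl -ltnS; apply: leq_trans (size_trace kap).
apply: max_poly_roots => //.
by apply/allP => x /flattenP[_ /mapP[E _ ->]]; apply: root_r.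
Qed.

End LowerBound.

(** * The upper bound *)

Definition exponents m w := {t : m.+1.-tuple 'I_w.+1 | (\sum_(i <- t) i == w)%N}.

Lemma card_exponents m w : #|{: exponents m w}| = 'C(m + w, m).
Proof. by rewrite card_sig -card_ord_partitions cardsE. Qed.

(* As the product of the z_j is -1, dividing a Laurent monomial by a power of it
   only changes a sign; a median exponent can thus be made 0 without increasing
   the sum of the absolute values of the exponents. *)
Section LaurentSpan.
Variables (L : fieldType) (m : nat) (s : L) (z : 'I_m.+1 -> L).
Hypotheses (z0 : forall j, z j != 0) (zprod : \prod_j z j = -1).

Definition laurent (h : 'I_m.+1 -> int) : L := \prod_j z j ^ h j.
Definition height (h : 'I_m.+1 -> int) : nat := \sum_j `|h j|%N.

(** The data are the place of the zero exponent, the places of the nonpositive ones, and the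
    absolute values. The tuple entry at the zero place is slack that brings their sum up to exactly
    w. An exponent may have several indices; only their number is used. *)
Definition normal_index w : finType :=
  ('I_m.+1 * {S : {set 'I_m} | #|S| == m./2} * exponents m w)%type.

Definition normal_exp w (t : normal_index w) (j : 'I_m.+1) : int :=
  if unlift t.1.1 j is Some k then
    (if k \in val t.1.2 then - (tnth (val t.2) j)%:Z else (tnth (val t.2) j)%:Z)
  else 0.

Lemma card_normal_index w :
  #|{: normal_index w}| = (m.+1 * 'C(m, m./2) * 'C(m + w, m))%N.
Proof.
rewrite !card_prod card_ord card_exponents card_sig; congr (_ * _ * _)%N.
have := card_draws 'I_m m./2; rewrite card_ord => <-; rewrite cardsE.
by apply: eq_card => S; rewrite !inE.
Qed.

Lemma sign_expz (c : int) : exists b : bool, (-1) ^ c = (-1) ^+ b :> L.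
Proof.
case: c => n; first by exists (odd n); rewrite signr_odd.
by exists (odd n.+1); rewrite signr_odd -[LHS]exprVn invrN1.
Qed.

Lemma laurent_shift h (c : int) :
  exists b : bool, laurent h = (-1) ^+ b * laurent (fun j => h j - c).
Proof.
have [b bE] := sign_expz c; exists b; rewrite -bE -zprod.
have -> : (\prod_j z j) ^ c = \prod_j z j ^ c.
  case: c {bE} => n; first by rewrite -[LHS]prodrXl.
  by rewrite -[LHS]exprVn -prodfV -[LHS]prodrXl; apply: eq_bigr => j _; rewrite exprVn.
rewrite -big_split; apply: eq_bigr => j _ /=.
by rewrite -expfzDr // addrCA subrr addr0.
Qed.

Lemma laurent_normal w h : (height h <= w)%N ->
  exists t : normal_index w, exists b : bool,
    laurent h = (-1) ^+ b * laurent (normal_exp t).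
Proof.
move=> hw; have [i [S cS iS]] := median h.
pose h' j := h j - h i.
pose rest := (\sum_(k < m) `|h' (lift i k)|)%N.
have PoszS (I : finType) (F : I -> nat) : (\sum_i F i)%N%:Z = \sum_i (F i)%:Z.
  exact: (big_morph Posz PoszD (erefl _)).
have restE : rest%:Z = \sum_(k < m) (if k \in S then - h' (lift i k) else h' (lift i k)).
  rewrite PoszS; apply: eq_bigr => k _; rewrite abszE; have := iS k.
  by case: ifP => _ hk; [rewrite ler0_norm // subr_le0 | rewrite ger0_norm // subr_ge0].
have heightE : (height h)%:Z = `|h i| + \sum_(k < m) `|h (lift i k)|.
  by rewrite PoszS (bigD1_ord i) //= abszE; congr (_ + _); apply: eq_bigr => k _; rewrite abszE.
(* The sum of the |h_k - h_i| is a signed sum of the h_k plus h_i (2 |S| - m). As |S| = floor(m/2),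
   at most one copy of h_i is left, and the term |h_i| of the height pays for it. *)
have rest_le : (rest <= w)%N.
  apply: leq_trans hw; rewrite -lez_nat restE heightE addrC.
  rewrite (eq_bigr (fun k => (if k \in S then - h (lift i k) else h (lift i k))
      + h i * ((k \in S)%:R * 2 - 1))); last first.
    by move=> k _; rewrite /h'; case: ifP => _ /=; ring.
  rewrite big_split lerD //.
    by apply: ler_sum => k _; case: ifP => _; rewrite ?ler_norm // -normrN ler_norm.
  rewrite -mulr_sumr sumrB sumr_const card_ord -mulr_suml.
  have -> : \sum_(k < m) (k \in S)%:R = (m./2)%:R :> int.
    by rewrite -natr_sum -cS -sum1_card [in RHS]big_mkcond.
  have -> : (m./2)%:R * 2 - 1 *+ m = - (odd m)%:R :> int.
    rewrite -{2}(odd_double_half m) mulrnDr -mul2n natrM; ring.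
  by case: (odd m); rewrite /= ?mulr0n ?oppr0 ?mulr0 ?normr_ge0 // mulrN1 -normrN ler_norm.
pose v j := if j == i then (w - rest)%N else `|h' j|%N.
have vi : v i = (w - rest)%N by rewrite /v eqxx.
have vl k : v (lift i k) = `|h' (lift i k)|%N.
  by rewrite /v eq_sym (negPf (neq_lift _ _)).
have vw j : (v j < w.+1)%N.
  rewrite ltnS; case: (unliftP i j) => [k ->|->]; last by rewrite vi leq_subr.
  by rewrite vl (leq_trans _ rest_le) // /rest (bigD1 k) //= leq_addr.
pose tv := [tuple inord (v j) | j < m.+1] : m.+1.-tuple 'I_w.+1.
have tvP : (\sum_(i <- tv) i == w)%N.
  rewrite big_tuple (eq_bigr v) => [|j _]; last by rewrite tnth_mktuple inordK.
  rewrite (bigD1_ord i) //= vi (eq_bigr (fun k => `|h' (lift i k)|%N)) => [|k _]; last exact: vl.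
  by rewrite subnK.
have [b bE] := laurent_shift h (h i).
have Sq : #|S| == m./2 by rewrite cS.
exists (i, exist _ S Sq, exist _ tv tvP), b; rewrite bE; congr (_ * _).
apply: eq_bigr => j _; congr (_ ^ _); rewrite /normal_exp /=.
case: unliftP => [k ->|->]; last by rewrite subrr.
have tE : (tnth tv (lift i k))%:Z = `|h' (lift i k)|.
  by rewrite tnth_mktuple inordK // vl abszE.
rewrite tE; have := iS k; case: ifP => _ hk.
  by rewrite ler0_norm ?opprK // subr_le0.
by rewrite ger0_norm // subr_ge0.
Qed.

Definition spanned w (y : L) := exists r : normal_index w -> int,
  y = \sum_t (r t)%:~R * (s ^+ w * laurent (normal_exp t)).

Lemma spanned0 w : spanned w 0.
Proof. by exists (fun=> 0); rewrite big1 // => t _; rewrite mul0r. Qed.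

Lemma spannedD w y1 y2 : spanned w y1 -> spanned w y2 -> spanned w (y1 + y2).
Proof.
move=> [r1 ->] [r2 ->]; exists (fun t => r1 t + r2 t); rewrite -big_split.
by apply: eq_bigr => t _; rewrite intrD mulrDl.
Qed.

Lemma spannedZ w (c : int) y : spanned w y -> spanned w (c%:~R * y).
Proof.
move=> [r ->]; exists (fun t => c * r t); rewrite mulr_sumr.
by apply: eq_bigr => t _; rewrite intrM mulrA.
Qed.

Lemma spanned_laurent w h : (height h <= w)%N -> spanned w (s ^+ w * laurent h).
Proof.
move=> hw; have [t [b ->]] := laurent_normal hw.
exists (fun t' => (-1) ^+ b * (t' == t)%:R).
rewrite (bigD1 t) //= big1 => [|t' /negPf ->]; last by rewrite mulr0 mul0r.
by rewrite eqxx mulr1 addr0 rmorphXn rmorphN1 mulrCA.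
Qed.

Lemma spanned_sum w (I : finType) (F : I -> L) :
  (forall i, spanned w (F i)) -> spanned w (\sum_i F i).
Proof.
by move=> FP; apply: big_ind => [|x y|i _]; [exact: spanned0 | exact: spannedD | exact: FP].
Qed.

(** Both 4 a_j^2 and 4 i times the area expression are such multipliers, so products of w of them
    lie in [spanned w]. *)
Definition multiplier (f : L) := forall w y, spanned w y -> spanned w.+1 (y * f).

Lemma height_normal w (t : normal_index w) : (height (normal_exp t) <= w)%N.
Proof.
case: t => [[i S] [tv tvw]]; have /eqP tvP := tvw.
rewrite [X in (_ <= X)%N](_ : w = \sum_j tnth tv j)%N; last by rewrite -[LHS]tvP big_tuple.
apply: leq_sum => j _; rewrite /normal_exp /=.
by case: unliftP => [k _|_] //; case: ifP => _; rewrite ?abszN.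
Qed.

Lemma multiplier_basic (f : L) :
  (forall w h, (height h <= w)%N -> spanned w.+1 (s ^+ w * laurent h * f)) -> multiplier f.
Proof.
move=> fP w y [r ->]; rewrite mulr_suml; apply: spanned_sum => t.
by rewrite -mulrA; apply/spannedZ/fP/height_normal.
Qed.

Lemma multiplier_s : multiplier s.
Proof.
apply: multiplier_basic => w h hw; rewrite mulrAC -exprSr.
by apply: spanned_laurent; apply: leqW.
Qed.

Lemma laurent_mul_z h j (c : int) :
  laurent h * z j ^ c = laurent (fun l => h l + (if l == j then c else 0)).
Proof.
rewrite /laurent (bigD1 j) //= [in RHS](bigD1 j) //= eqxx expfzDr // mulrAC.
congr (_ * _); apply: eq_bigr => l /negPf ->; by rewrite addr0.
Qed.

Lemma height_add (h : 'I_m.+1 -> int) j (c : int) :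
  (height (fun l => h l + (if l == j then c else 0))%R <= height h + `|c|)%N.
Proof.
rewrite /height (bigD1 j) //= [in X in (_ <= X)%N](bigD1 j) //= eqxx.
rewrite (eq_bigr (fun l => `|h l|%N)) => [|l /negPf ->]; last by rewrite addr0.
by rewrite addnAC leq_add2r; lia.
Qed.

Lemma multiplier_z j (c : int) : `|c|%N = 1%N -> multiplier (s * z j ^ c).
Proof.
move=> c1; apply: multiplier_basic => w h hw.
rewrite mulrACA -exprSr laurent_mul_z; apply: spanned_laurent.
by apply: leq_trans (height_add h j c) _; rewrite c1 addn1 ltnS.
Qed.

Lemma multiplierD f g : multiplier f -> multiplier g -> multiplier (f + g).
Proof. by move=> fP gP w y yP; rewrite mulrDr; apply: spannedD; [apply: fP | apply: gP]. Qed.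

Lemma multiplierZ c f : multiplier f -> multiplier (c%:~R * f).
Proof. by move=> fP w y yP; rewrite mulrCA; apply: spannedZ; apply: fP. Qed.

Lemma multiplier_sum (I : finType) (F : I -> L) :
  (forall i, multiplier (F i)) -> multiplier (\sum_i F i).
Proof. by move=> FP w y yP; rewrite mulr_sumr; apply: spanned_sum => i; apply: FP. Qed.

Lemma spanned1 : spanned 0 1.
Proof.
have -> : 1 = s ^+ 0 * laurent (fun=> 0) by rewrite /laurent big1 ?mulr1.
by apply: spanned_laurent; rewrite /height big1.
Qed.

Lemma spannedX k f w y : multiplier f -> spanned w y -> spanned (w + k) (y * f ^+ k).
Proof.
move=> fP yP; elim: k => [|k IH]; first by rewrite addn0 expr0 mulr1.
by rewrite addnS exprSr mulrA; apply: fP.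
Qed.

Lemma spanned_prod (I : finType) (f : I -> L) (k : I -> nat) w y :
  (forall i, multiplier (f i)) -> spanned w y ->
  spanned (w + \sum_i k i) (y * \prod_i f i ^+ k i).
Proof.
move=> fP; elim: (index_enum I) w y => [|i r IH] w y yP.
  by rewrite !big_nil addn0 mulr1.
by rewrite !big_cons addnA mulrA; apply: IH; apply: spannedX.
Qed.

End LaurentSpan.

Lemma size_sumZXn (A : comNzRingType) (I : finType) (a : I -> A) (k : I -> nat) N :
  (forall i, (k i <= N)%N) -> (size (\sum_i a i *: 'X^(k i) : {poly A})%R <= N.+1)%N.
Proof.
move=> kN; apply: (leq_trans (size_sum _ _ _)); apply/bigmax_leqP => i _.
by rewrite (leq_trans (size_scale_leq _ _)) // size_polyXn ltnS.
Qed.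

Lemma ev_sumZXn (A T : comNzRingType) (f : {rmorphism A -> T}) w (I : finType)
    (a : I -> A) (k : I -> nat) :
  ev f w (\sum_i a i *: 'X^(k i)) = \sum_i f (a i) * w ^+ k i.
Proof. by rewrite rmorph_sum; apply: eq_bigr => i _; rewrite evZ rmorphXn evX. Qed.

Section UpperBound.
Variables (m : nat) (T : idomainType) (im D : T) (p q a b : 'I_m.+1 -> T).
Variable psi : {rmorphism {mpoly int[m.+1]} -> T}.
Hypotheses (imE : im * im = -1) (char0 : forall z : int, z%:~R = 0 :> T -> z = 0).
Hypotheses (D0 : D != 0) (p0 : forall j, p j != 0).
Hypothesis pq : forall j, p j * q j = D ^+ 2.
Hypothesis prod_p : \prod_j p j = im * D ^+ m.+1.
Hypotheses (pE : forall j, b j + im * a j = p j) (qE : forall j, b j - im * a j = q j).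
Hypothesis psiX : forall j, psi 'X_j = a j ^+ 2.
Notation A := {mpoly int[m.+1]}.
Variables (L : fieldType) (fr : {rmorphism T -> L}).
Hypothesis fr_eq0 : forall x, (fr x == 0) = (x == 0).

Let area := im * \sum_j a j * b j.
Let s : L := fr (D ^+ 2).
Let z (j : 'I_m.+1) : L := fr (p j ^+ 2) / s.

Let s0 : s != 0.
Proof. by rewrite fr_eq0 expf_neq0. Qed.

Let p20 j : fr (p j ^+ 2) != 0.
Proof. by rewrite fr_eq0 expf_neq0. Qed.

Let z0 j : z j != 0.
Proof. by apply: mulf_neq0; [exact: p20 | rewrite invr_eq0; exact: s0]. Qed.

Let zV j : (z j)^-1 = fr (q j ^+ 2) / s.
Proof.
apply: (mulfI (z0 j)); rewrite mulfV ?z0 //.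
transitivity (fr ((p j * q j) ^+ 2) / (s * s)).
  rewrite pq rmorphXn -expr2 divff //; apply: expf_neq0; exact: s0.
by rewrite exprMn rmorphM /z mulrACA -invfM.
Qed.

Let zprod : \prod_j z j = -1.
Proof.
rewrite big_split prodr_const card_ord -rmorph_prod prodrXl prod_p /=.
rewrite exprMn expr2 imE -exprM mulnC exprM mulN1r rmorphN rmorphXn.
by rewrite exprVn mulNr mulfV //; apply: expf_neq0; exact: s0.
Qed.

Let szE j : s * z j = fr (p j ^+ 2).
Proof. by rewrite mulrC divfK. Qed.

Let szVE j : s * (z j)^-1 = fr (q j ^+ 2).
Proof. by rewrite zV mulrC divfK. Qed.

Lemma sine2_spanning j : 4 * fr (a j ^+ 2) = 2 * s - s * z j - s * (z j)^-1.
Proof.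
rewrite szE szVE -!(rmorph_nat fr) -!rmorphM -!rmorphB; congr (fr _).
rewrite -(pq j) -pE -qE.
transitivity (- (4 * (im * im) * a j ^+ 2)); last by ring.
by rewrite imE; ring.
Qed.

Lemma darea_spanning : 4 * fr area = \sum_j (s * z j - s * (z j)^-1).
Proof.
rewrite -(rmorph_nat fr) -rmorphM /area !mulr_sumr rmorph_sum.
apply: eq_bigr => j _.
by rewrite szE szVE -rmorphB; congr (fr _); rewrite -pE -qE; ring.
Qed.

Let mult_x j : multiplier s z (4 * fr (a j ^+ 2)).
Proof.
rewrite sine2_spanning; apply: multiplierD; first apply: multiplierD.
- by apply: (multiplierZ 2); apply: multiplier_s.
- by rewrite -mulN1r; apply: (multiplierZ (-1)); apply: (@multiplier_z L m s z z0 zprod j 1).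
- by rewrite -mulN1r; apply: (multiplierZ (-1)); apply: (@multiplier_z L m s z z0 zprod j (-1)).
Qed.

Let mult_C : multiplier s z (4 * fr area).
Proof.
rewrite darea_spanning; apply: multiplier_sum => j; apply: multiplierD.
- exact: (@multiplier_z L m s z z0 zprod j 1).
- by rewrite -mulN1r; apply: (multiplierZ (-1)); apply: (@multiplier_z L m s z z0 zprod j (-1)).
Qed.

Let N := (m.+1 * 'C(m, m./2))%N.

(* The products of N + w factors 4 area and 4 a_j^2, of which at most N are the
   area, outnumber the normal Laurent monomials for large w; the factor a_0^2
   pads those with fewer areas. *)
Lemma darea_kernel : exists p : {poly A},
  [/\ p != 0, (size p <= N.+1)%N & ev (psi) area p = 0].
Proof.
have [w wN] := bin_growth m N.
pose I : finType := ('I_N.+1 * exponents m w)%type.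
pose J := normal_index m (w + N).
pose mu (i : I) : 'X_{1..m.+1} := [multinom (if j == ord0 then (N - i.1)%N else 0%N)
  + tnth (val i.2) j | j < m.+1].
pose x j : L := fr (a j ^+ 2).
pose y : L := fr area.
pose R (i : I) : L := (4 * y) ^+ i.1 * (4 * x ord0) ^+ (N - i.1)
  * \prod_j (4 * x j) ^+ tnth (val i.2) j.
have tw (i : I) : (\sum_j tnth (val i.2) j = w)%N.
  by rewrite -[RHS](eqP (valP i.2)) big_tuple.
have iN (i : I) : (i.1 <= N)%N by rewrite -ltnS.
have RP (i : I) : spanned s z (w + N) (R i).
  have h1 := spannedX i.1 mult_C (spanned1 s z0 zprod).
  have h2 := spannedX (N - i.1) (mult_x ord0) h1.
  have := spanned_prod (fun j => tnth (val i.2) j : nat) mult_x h2.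
  by rewrite add0n subnKC // tw addnC mul1r.
have [r rP] := choice RP.
have [|v [[i0 v0] vP]] := @lin_dep int I J (fun i t => r i t).
  by rewrite card_normal_index card_prod card_ord card_exponents.
have R0 : \sum_i (v i)%:~R * R i = 0.
  rewrite (eq_bigr (fun i => \sum_t (v i * r i t)%:~R * (s ^+ (w + N) * laurent z (normal_exp t)))).
    rewrite exchange_big big1 // => t _; rewrite -mulr_suml -rmorph_sum (vP t).
    by rewrite mul0r.
  by move=> i _; rewrite rP mulr_sumr; apply: eq_bigr => t _; rewrite intrM mulrA.
have RE (i : I) : R i = 4 ^+ (w + N) * fr (psi 'X_[mu i] * area ^+ i.1).
  rewrite /R; have -> : psi 'X_[mu i] = (a ord0 ^+ 2) ^+ (N - i.1)
      * \prod_j (a j ^+ 2) ^+ tnth (val i.2) j.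
    rewrite mpolyXE_id rmorph_prod.
    under eq_bigr => j _ do rewrite mnmE exprD rmorphM !rmorphXn psiX.
    rewrite big_split /= (bigD1 ord0) //= [X in _ * X * _]big1 ?mulr1 // => j /negPf ->.
    by rewrite expr0.
  have -> : \prod_j (4 * x j) ^+ tnth (val i.2) j =
      4 ^+ w * fr (\prod_j (a j ^+ 2) ^+ tnth (val i.2) j).
    have -> : 4 ^+ w = \prod_j 4 ^+ tnth (val i.2) j :> L by rewrite -expr_sum tw.
    rewrite rmorph_prod -big_split; apply: eq_bigr => j _.
    by rewrite exprMn rmorphXn.
  have -> : (w + N = w + (i.1 + (N - i.1)))%N by rewrite subnKC.
  rewrite !exprD [(4 * y) ^+ _]exprMn [(4 * x ord0) ^+ _]exprMn.
  rewrite [fr (_ * area ^+ _)]rmorphM [fr (area ^+ _)]rmorphXn -/y.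
  rewrite [fr (_ * \prod_j _)]rmorphM [fr (_ ^+ (N - _))]rmorphXn -/(x ord0).
  by move: (fr (\prod_j _)) => P; ring.
exists (\sum_i (v i *: 'X_[mu i]) *: 'X^(i.1)); split.
(* An index is recovered from its power of the area and its monomial: the power fixes the padding of
   the first variable, which then cancels. So the coefficient at [i0] is [v i0] itself. *)
- apply: contraNneq v0 => f0.
  have := congr1 (fun f : {poly A} => (f`_i0.1)@_(mu i0)) f0.
  rewrite coef_sumMXn coef0 mcoeff0 raddf_sum (bigD1 i0) //= big1 ?addr0.
    by rewrite mcoeffZ mcoeffX eqxx mulr1 => ->.
  move=> i /andP[/eqP ii ni]; rewrite mcoeffZ mcoeffX; case: eqP => [E|]; last by rewrite mulr0.
  case/eqP: ni; case: i i0 ii E => [k t] [k0 t0] /= /val_inj <- E.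
  congr (_, _); apply/val_inj/eq_from_tnth => j; apply/val_inj.
  have := congr1 (fun mm : 'X_{1..m.+1} => mm j) E; rewrite !mnmE /=.
  by move/addnI.
- by apply: size_sumZXn => i; rewrite -ltnS.
- rewrite ev_sumZXn; apply/eqP; rewrite -fr_eq0 rmorph_sum; apply/eqP.
  have f0 : 4 ^+ (w + N) != 0 :> L.
    rewrite expf_neq0 // -(rmorph_nat fr) fr_eq0.
    by apply/eqP => /(char0 (z := 4)).
  apply: (mulfI f0); rewrite mulr0 -[RHS]R0 mulr_sumr; apply: eq_bigr => i _.
  have -> : psi (v i *: 'X_[mu i]) = (v i)%:~R * psi 'X_[mu i].
    by rewrite -mul_mpolyC rmorphM -[v i in LHS]intz !rmorph_int.
  by rewrite RE -[_ * psi _ * _]mulrA [fr (_%:~R * _)]rmorphM rmorph_int mulrCA.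
Qed.

End UpperBound.

(** * Zariski density of real polygons, and evenness in the area *)

Section Density.
Variables (C : numClosedFieldType) (m : nat).
Notation T := {mpoly C[m.+1]}.

(** The Cayley map x -> (x + i)/(x - i) sends the natural numbers injectively to the unit circle. *)
Lemma infinite_circle : infinitely_many (fun x : C => `|x| = 1).
Proof.
have nz (k : nat) : k%:R - 'i != 0 :> C.
  apply/eqP => /eqP; rewrite subr_eq0 => /eqP E.
  have := sqrCi C; rewrite -E -natrX => /eqP; rewrite -addr_eq0 natr1.
  by rewrite pnatr_eq0.
have conjk (k : nat) : (k%:R + 'i)^* = k%:R - 'i :> C.
  by rewrite rmorphD /= conjCi rmorph_nat.
exists (fun k => (k%:R + 'i) / (k%:R - 'i)) => [j k E|k].
  have : (j%:R + 'i) * (k%:R - 'i) = (k%:R + 'i) * (j%:R - 'i) :> C.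
    by rewrite -[j%:R + 'i](divfK (nz j)) E mulrAC divfK.
  move=> E'; have : 2 * 'i * j%:R = 2 * 'i * k%:R :> C.
    apply/eqP; rewrite -subr_eq0.
    have -> : 2 * 'i * j%:R - 2 * 'i * k%:R =
      (k%:R + 'i) * (j%:R - 'i) - (j%:R + 'i) * (k%:R - 'i) :> C by ring.
    by rewrite E' subrr.
  have i2 : 2 * 'i != 0 :> C by rewrite mulf_neq0 ?neq0Ci ?pnatr_eq0.
  by move/(mulfI i2)/eqP; rewrite eqr_nat => /eqP.
by rewrite normf_div -conjk norm_conjC divff // normr_eq0 -conjC_eq0 conjk nz.
Qed.

(** For fixed half-arcs on the circle, the last coordinate d / Q runs over a ray, on which a
    polynomial has infinitely many zeros only if it is 0. Thus F vanishes for every value of the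
    last coordinate, and the others range over infinite sets. *)
Lemma real_points_dense (F : T) :
  (forall (d : C) q, 0 < d -> (forall j, `|q j| = 1) -> \prod_j q j = 'i ->
     F.@[polygon_point d q] = 0) -> F = 0.
Proof.
move=> F0.
pose Sc (j : 'I_m.+1) (x : C) := (j != ord_max) -> `|x| = 1.
apply: (@mpoly_zero_on _ _ Sc) => [j|v vS].
  by have [f finj fS] := infinite_circle; exists f => // k _; exact: fS.
pose ext t j : C := if j == ord_max then t else v j.
pose P : {poly C} := mmap polyC (fun j => if j == ord_max then 'X else (v j)%:P) F.
have PE t : P.[t] = F.@[ext t].
  apply: (mpoly_ext (f := horner_eval t \o mmap polyC (fun j => if j == ord_max then 'X else (v j)%:P))
    (g := meval (ext t))) => [c|j] /=.
    by rewrite mmapC mevalC /horner_eval hornerC.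
  by rewrite mmapX mmap1U mevalXU /horner_eval /ext; case: eqP; rewrite ?hornerX ?hornerC.
pose Q := \prod_(k < m) v (lift ord_max k).
have v1 k : `|v (lift ord_max k)| = 1 by apply: vS; rewrite eq_sym neq_lift.
have Q1 : `|Q| = 1 by rewrite normr_prod big1.
have Q0 : Q != 0 by rewrite -normr_eq0 Q1 oner_eq0.
have P0 : P = 0.
  apply: (@poly_zero_on _ (fun t => exists2 d : C, 0 < d & t = d / Q)).
    exists (fun k => k.+1%:R / Q) => [i j|k]; last by exists k.+1%:R; rewrite ?ltr0Sn.
    have Qi : Q^-1 != 0 by rewrite invr_eq0.
    by move=> /(mulIf Qi) /eqP; rewrite eqr_nat => /eqP[].
  move=> _ [d d0 ->]; pose q j := if j == ord_max then 'i / Q else v j.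
  have ql k : q (lift ord_max k) = v (lift ord_max k) by rewrite /q eq_sym (negPf (neq_lift _ _)).
  have qm : q ord_max = 'i / Q by rewrite /q eqxx.
  have qQ : \prod_(k < m) q (lift ord_max k) = Q by apply: eq_bigr => k _; rewrite ql.
  rewrite PE -(F0 d q d0) => [|j|].
  - apply: meval_eq => j; rewrite /ext /polygon_point; case: unliftP => [k jE|->].
      by rewrite jE ql eq_sym (negPf (neq_lift _ _)).
    by rewrite eqxx qQ.
  - have [k ->|->] := unliftP ord_max j; first by rewrite ql.
    by rewrite qm normf_div Q1 normCi divr1.
  by rewrite (bigD1_ord ord_max) //= qQ qm divfK.
have -> : F.@[v] = P.[v ord_max].
  by rewrite PE; apply: meval_eq => j; rewrite /ext; case: eqP => [->|].
by rewrite P0 horner0.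
Qed.

End Density.

Section EvenOdd.
Variables (A T : idomainType) (psi : {rmorphism A -> T}).

Lemma ev_comp w (p q : {poly A}) : ev psi w (p \Po q) = ev psi (ev psi w q) p.
Proof. by rewrite /= /horner_eval map_comp_poly horner_comp. Qed.

(** The even and odd parts of f both vanish at w^2, and at least one of them is nonzero. *)
Lemma ev_square w (f : {poly A}) : f != 0 -> 2 * w != 0 ->
  ev psi w f = 0 -> ev psi (- w) f = 0 ->
  exists p : {poly A}, [/\ p != 0, (size p <= uphalf (size f))%N & ev psi (w ^+ 2) p = 0].
Proof.
move=> f0 w0 fw fNw; have E v : ev psi v f =
    ev psi (v ^+ 2) (even_poly f) + ev psi (v ^+ 2) (odd_poly f) * v.
  by rewrite -{1}(poly_even_odd f) rmorphD rmorphM !ev_comp rmorphXn evX.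
have oK : ev psi (w ^+ 2) (odd_poly f) = 0.
  apply: (mulIf w0); rewrite mul0r.
  transitivity (ev psi w f - ev psi (- w) f); last by rewrite fw fNw subr0.
  by rewrite !E sqrrN; ring.
have [o0|o0] := eqVneq (odd_poly f) 0; last first.
  exists (odd_poly f); split=> //; apply: leq_trans (size_odd_poly f) _.
  by rewrite uphalf_half leq_addl.
exists (even_poly f); split; last by move: fw; rewrite E oK mul0r addr0.
- by apply: contraNneq f0 => e0; rewrite -(poly_even_odd f) e0 o0 !comp_poly0 mul0r addr0.
- exact: size_even_poly.
Qed.

End EvenOdd.

Section UpperDegree.
Variables (C : numClosedFieldType) (m : nat).
Hypothesis m_gt0 : (0 < m)%N.
Notation T := {mpoly C[m.+1]}.
Notation A := {mpoly int[m.+1]}.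
Notation psi := (psi C m).
Let N := (m.+1 * 'C(m, m./2))%N.

Lemma darea_kernelT : exists f : {poly A},
  [/\ f != 0, (size f <= N.+1)%N & ev psi (imT C m * darea C m) f = 0].
Proof.
apply: (@darea_kernel m T (imT C m) (diam C m) (chord C (m := m)) (cchord C (m := m))
  (sine C (m := m)) (cosine C (m := m)) psi (imT2 C m) (char0T (C := C) (m := m))
  (diam_neq0 C m) (@chord_neq0 C m) (@chordM C m) (prod_chord C m) (@cosD C m)
  (@cosB C m) (@psiX C m) {fraction T} (@tofrac T) (@tofrac_eq0 T)).
Qed.

(** At a real polygon the a_j^2 are real and i times the area is imaginary, so conjugating an
    integral relation only changes the sign of the latter; density carries this back to T. *)
Lemma darea_kernel_conj f : ev psi (imT C m * darea C m) f = 0 ->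
  ev psi (- (imT C m * darea C m)) f = 0.
Proof.
move=> fK; apply: real_points_dense => d q d0 q1 qprod.
have q0 j : q j != 0 by rewrite -normr_eq0 q1 oner_eq0.
have qV j : (q j ^+ 2)^-1 = (q j ^+ 2)^*.
  by rewrite invC_norm normrX q1 !expr1n invr1 mul1r.
have dR : d^* = d by apply/CrealP/gtr0_real.
have xR j : ((sine C j ^+ 2).@[polygon_point d q])^* = (sine C j ^+ 2).@[polygon_point d q].
  rewrite eval_sine2 //; move: (q j ^+ 2) (qV j) => Z ZV.
  rewrite !rmorphM !rmorphB !fmorphV !rmorph_nat /= dR -ZV invrK.
  by ring.
have wR : ((imT C m * darea C m).@[polygon_point d q])^* = (- (imT C m * darea C m)).@[polygon_point d q].
  rewrite mevalN mevalM mevalC rmorph_sum mulr_sumr rmorph_sum -sumrN.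
  apply: eq_bigr => j _; rewrite /= eval_sine_cosine //.
  have e : 'i * - ('i * d ^+ 2 * (q j ^+ 2 - (q j ^+ 2)^-1) / 4) =
      d ^+ 2 * (q j ^+ 2 - (q j ^+ 2)^-1) / 4 :> C.
    have := sqrCi C; set i := 'i => i2.
    transitivity (- i ^+ 2 * (d ^+ 2 * (q j ^+ 2 - (q j ^+ 2)^-1) / 4)); first by ring.
    by rewrite i2 opprK mul1r.
  rewrite e; move: (q j ^+ 2) (qV j) => Z ZV.
  rewrite !rmorphM rmorphB !fmorphV rmorph_nat /= dR -ZV invrK.
  by ring.
have : ((ev psi (imT C m * darea C m) f).@[polygon_point d q])^* = 0.
  by rewrite fK meval0 rmorph0.
have cm x W : (ev (aeval x) W f)^* = ev (aeval (fun j => (x j)^*)) W^* f.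
  exact: (ev_morph x Num.conj W f).
rewrite !meval_ev cm wR => E; rewrite -[RHS]E.
by apply: eq_ev_aeval => j; rewrite xR.
Qed.

Lemma area_degree_le (alpha : {poly A}) :
  (forall p, ev psi (area2 C m) p = 0 -> exists q, p = q * alpha) ->
  (2 * (size alpha).-1 <= N)%N.
Proof.
move=> aP; have [f [f0 sf fK]] := darea_kernelT.
have fK' := darea_kernel_conj fK.
set w := imT C m * darea C m in fK fK'.
have w2 : w ^+ 2 = - area2 C m by rewrite exprMn expr2 imT2 mulN1r.
have w0 : 2 * w != 0.
  rewrite !mulf_neq0 ?imT_neq0 ?area_neq0 //.
  by apply/eqP => /(char0T (z := 2)).
have [p [p0 sp pK]] := ev_square f0 w0 fK fK'.
have sX : size (- 'X : {poly A}) = 2%N by rewrite size_polyN size_polyX.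
(* The relation is for (4 i K)^2 = - 16 K^2, hence the substitution of -X. *)
have p'K : ev psi (area2 C m) (p \Po (- 'X)) = 0.
  by rewrite ev_comp rmorphN evX -w2.
have := size_kernel _ (aP _ p'K); rewrite comp_poly2_eq0 // size_comp_poly2 // => /(_ p0).
move=> /leq_trans /(_ sp) h.
have : (size alpha <= uphalf N.+1)%N by apply: leq_trans h (uphalf_leq sf).
have := odd_double_half N; rewrite -addnn uphalf_half /=; move: (odd N) (N./2) => o h2.
lia.
Qed.

End UpperDegree.

(** * Areas of polygons *)

From mathcomp Require Import functions classical_sets measure topology.
From mathcomp Require Import normedtype derive lebesgue_measure.
From mathcomp Require Import lebesgue_integral ftc.
Import numFieldNormedType.Exports.

Section Integral.
Variable R : realType.

Lemma integral_affine (a b : R) :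
  \int[lebesgue_measure]_(t in `[0, 1]%classic) (a * t + b) = a / 2 + b.
Proof.
pose F (t : R) := a / 2 * t ^+ 2 + b * t.
have dF (x : R) : is_derive x 1 F (a * x + b).
  have -> : F = (a / 2) \*: ((id : R -> R) ^+ 2) + b \*: (id : R -> R) by apply/funext => t.
  by apply: is_derive_eq; rewrite /GRing.scale /= expr1; lra.
have cF : continuous F.
  by move=> x; apply: differentiable_continuous; apply/derivable1_diffP; case: (dF x).
rewrite /Rintegral (@continuous_FTC2 _ (fun t => a * t + b) F) ?ltr01 //=.
- by rewrite /F; lra.
- apply: continuous_subspaceT => x; apply: cvgD; last exact: cvg_cst.
  by apply: cvgM; [exact: cvg_cst | exact: cvg_id].
- split.
  + by move=> x _; case: (dF x).
  + by apply: cvg_at_right_filter; apply: cF.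
  + by apply: cvg_at_left_filter; apply: cF.
- by move=> x _; rewrite derive1E derive_val.
Qed.

Lemma line_integral_segment (p q : R[i]) : line_integral_xdy (segment p q) =
  (complex.Re p + complex.Re q) / 2 * (complex.Im q - complex.Im p).
Proof.
case: p => p1 p2; case: q => q1 q2 /=.
rewrite /line_integral_xdy.
have ReE t : complex.Re (segment (p1 +i* p2)%C (q1 +i* q2)%C t) = (q1 - p1) * t + p1.
  by rewrite /segment /=; ring.
have ImE t : complex.Im (segment (p1 +i* p2)%C (q1 +i* q2)%C t) = (q2 - p2) * t + p2.
  by rewrite /segment /=; ring.
have dIm t : derive1 (fun s => complex.Im (segment (p1 +i* p2)%C (q1 +i* q2)%C s)) t = q2 - p2.
  rewrite (_ : (fun s => _) = (q2 - p2) \*: (id : R -> R) + cst p2); last first.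
    by apply/funext => s; rewrite ImE.
  by rewrite derive1E derive_val /GRing.scale /= mulr1 addr0.
transitivity (\int[lebesgue_measure]_(t in `[0, 1]%classic)
  (((q1 - p1) * (q2 - p2)) * t + p1 * (q2 - p2))).
  by apply: eq_Rintegral => t _; rewrite ReE dIm; ring.
by rewrite integral_affine; lra.
Qed.

End Integral.

Section Polygons.
Variables (R : realType) (m : nat).
Notation C := R[i].
Local Notation toC := (real_complex R).

Lemma ordS_lift (j : 'I_m.+1) : ordS (lift ord_max j) = lift ord0 j :> 'I_m.+2.
Proof. by apply: val_inj; rewrite /= /bump leqNgt ltn_ord /= add0n add1n modn_small // ltnS ltn_ord. Qed.

Lemma prod_ratio (F : 'I_m.+2 -> C) : (forall i, F i != 0) ->
  \prod_(j < m.+1) (F (lift ord0 j) / F (lift ord_max j)) = F ord_max / F ord0.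
Proof.
move=> F0; rewrite big_split /= prodfV.
have E : F ord0 * \prod_(j < m.+1) F (lift ord0 j) = F ord_max * \prod_(j < m.+1) F (lift ord_max j).
  by rewrite -(bigD1_ord ord0 (P := xpredT)) // -(bigD1_ord ord_max (P := xpredT)).
have P0 : \prod_(j < m.+1) F (lift ord_max j) != 0 by apply/prodf_neq0 => j _; apply: F0.
apply: (mulIf P0); rewrite divfK // mulrAC -E mulrC; apply: (mulfI (F0 ord0)).
by rewrite [RHS]mulrA divff ?mul1r.
Qed.

Lemma sum_cyclic (V : zmodType) k (G : 'I_k -> V) : \sum_i (G (ordS i) - G i) = 0.
Proof.
rewrite sumrB; apply/eqP; rewrite subr_eq0; apply/eqP.
by rewrite [RHS](reindex (@ordS k)) //; apply: onW_bij; exact: ordS_bij.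
Qed.

Definition cross (p q : C) : R := complex.Re p * complex.Im q - complex.Im p * complex.Re q.

(** The shoelace formula about c: x dy and half the cross product form differ by an exact form,
    whose primitive [G] telescopes around the polygon. Its second term accounts for moving the
    origin to c. *)
Lemma signed_area_cross k (v : 'I_k -> C) c :
  signed_area v = (\sum_i cross (v i - c) (v (ordS i) - c)) / 2.
Proof.
pose G i : R := complex.Re (v i) * complex.Im (v i) / 2
  + (complex.Re c * complex.Im (v i) - complex.Im c * complex.Re (v i)) / 2.
transitivity (\sum_i (cross (v i - c) (v (ordS i) - c) / 2 + (G (ordS i) - G i))).
  apply: eq_bigr => i _; rewrite line_integral_segment /G /cross.
  by case: (v i) (v (ordS i)) {G} c => [a1 a2] [b1 b2] [c1 c2] /=; field.
by rewrite big_split /= sum_cyclic addr0 mulr_suml.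
Qed.

Section Semicyclic.
Variables (v : 'I_m.+2 -> C) (c : C) (r : R).
Hypotheses (r0 : 0 < r) (vr : forall i, Normc.normc (v i - c) = r).
Hypothesis vmax : v ord_max - c = - (v ord0 - c).

Let w i := v i - c.
(** The rotation about the centre along side j, that is, z_j = q_j^2. *)
Definition turn (j : 'I_m.+1) : C := w (lift ord0 j) / w (lift ord_max j).

Let w0 i : w i != 0.
Proof.
apply/eqP => wi; have := vr i; rewrite -/(w i) wi Normc.normc0 => E.
by move: r0; rewrite -E ltxx.
Qed.

Let wJ i : (w i)^* = toC r ^+ 2 / w i.
Proof.
apply: (mulfI (w0 i)); rewrite mulrCA divff // mulr1 -normCK.
by congr (_ ^+ 2); rewrite -[LHS]/(toC (Normc.normc (w i))) vr.
Qed.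

Lemma turn_neq0 j : turn j != 0.
Proof. by rewrite mulf_neq0 ?invr_eq0. Qed.

Lemma prod_turn : \prod_j turn j = -1.
Proof. by rewrite prod_ratio // /w vmax mulNr divff //; apply: w0. Qed.

Lemma side_turn j : toC (side_length v (lift ord_max j) ^+ 2) =
  toC (4 * r ^+ 2) * (2 - turn j - (turn j)^-1) / 4.
Proof.
rewrite /side_length ordS_lift rmorphXn.
rewrite [X in X ^+ 2]/(`|v (lift ord0 j) - v (lift ord_max j)| : C) normCK.
have -> : v (lift ord0 j) - v (lift ord_max j) = w (lift ord0 j) - w (lift ord_max j).
  by rewrite /w; ring.
have -> p q : (w p - w q)^* = (w p)^* - (w q)^* by exact: rmorphB.
rewrite !wJ rmorphM rmorphXn rmorph_nat /turn.
by field; rewrite !w0.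
Qed.

Lemma area_turn : toC (4 * signed_area v) =
  - ('i * toC (4 * r ^+ 2) * (\sum_j (turn j - (turn j)^-1)) / 4).
Proof.
have crossE i k : toC (cross (w i) (w k)) =
    - ('i * toC r ^+ 2 * (w k / w i - w i / w k) / 2).
  have -> : toC (cross (w i) (w k)) = - ('i * ((w i)^* * w k - (w k)^* * w i) / 2).
    case: (w i) (w k) => [a1 a2] [b1 b2].
    rewrite /cross; apply/eqP; rewrite eq_complex; apply/andP; split; apply/eqP => /=.
      by field.
    by field.
  by rewrite !wJ; field; rewrite !w0.
rewrite (signed_area_cross v c) (bigD1_ord ord_max) //=.
have -> : ordS ord_max = ord0 :> 'I_m.+2 by apply: val_inj; rewrite /= modnn.
(* The closing side passes through the centre. *)
have -> : cross (v ord_max - c) (v ord0 - c) = 0.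
  by rewrite vmax /cross; case: (v ord0 - c) => a b /=; ring.
rewrite add0r; transitivity (2 * \sum_j toC (cross (w (lift ord_max j)) (w (lift ord0 j)))).
  rewrite -rmorph_sum -[2]/(2%:R) -(rmorph_nat toC 2) -rmorphM; congr (toC _).
  under eq_bigr do rewrite ordS_lift.
  by field.
rewrite (eq_bigr _ (fun j _ => crossE (lift ord_max j) (lift ord0 j))).
rewrite rmorphM rmorphXn rmorph_nat !(mulr_sumr, mulr_suml) -sumrN.
by apply: eq_bigr => j _; rewrite /turn invf_div; field; rewrite !w0.
Qed.

End Semicyclic.
Notation T := {mpoly C[m.+1]}.
Notation A := {mpoly int[m.+1]}.

Lemma ev_area_point (d : C) q (p : {poly A}) : (forall j, q j != 0) -> \prod_j q j = 'i ->
  (ev (psi C m) (area2 C m) p).@[polygon_point d q] =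
  ev (aeval (fun j => d ^+ 2 * (2 - q j ^+ 2 - (q j ^+ 2)^-1) / 4))
     ((- ('i * d ^+ 2 * (\sum_j (q j ^+ 2 - (q j ^+ 2)^-1)) / 4)) ^+ 2) p.
Proof.
move=> q0 qprod; rewrite meval_ev.
have -> : (area2 C m).@[polygon_point d q] =
    (- ('i * d ^+ 2 * (\sum_j (q j ^+ 2 - (q j ^+ 2)^-1)) / 4)) ^+ 2.
  rewrite /area2 rmorphXn; congr (_ ^+ 2); rewrite rmorph_sum mulr_sumr mulr_suml -sumrN.
  by apply: eq_bigr => j _; rewrite /= eval_sine_cosine.
by apply: eq_ev_aeval => j; rewrite eval_sine2.
Qed.

(** Only d^2 and the q_j^2 enter the two sides, so any square roots with prod q_j = i represent the
    polygon. *)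
Lemma semicyclic_eval v c r (p : {mpoly int[m.+2]}) d q : 0 < r ->
  (forall i, Normc.normc (v i - c) = r) -> v ord_max - c = - (v ord0 - c) ->
  d ^+ 2 = toC (4 * r ^+ 2) -> (forall j, q j ^+ 2 = turn v c j) -> \prod_j q j = 'i ->
  toC (map_mpoly (intr : int -> R) p).@[area_args (signed_area v)
        (fun j : 'I_m.+1 => side_length v (lift ord_max j))] =
  (ev (psi C m) (area2 C m) (to_poly p)).@[polygon_point d q].
Proof.
move=> r0 vr vmax d2 q2 qprod.
have q0 j : q j != 0.
  by have := turn_neq0 r0 vr j; rewrite -q2 expf_eq0.
rewrite ev_area_point // aeval_to_poly meval_map_int aeval_morph.
apply: eq_aeval => i; rewrite -[LHS]/(toC (area_args _ _ i)) /area_args.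
case: (unlift ord0 i) => [j|].
  by rewrite (side_turn r0 vr) d2 q2.
under eq_bigr do rewrite q2.
rewrite d2 -(area_turn r0 vr vmax) -rmorphXn; congr (toC _).
by rewrite exprMn -natrX.
Qed.

Lemma vanishes_on_semicyclicP (p : {mpoly int[m.+2]}) :
  vanishes_on_semicyclic R p <-> ev (psi C m) (area2 C m) (to_poly p) = 0.
Proof.
split=> [pv|p0 v [c [r [r0 vr vmax]]]].
  apply: real_points_dense => d q d0 q1 qprod.
  have q0 j : q j != 0 by rewrite -normr_eq0 q1 oner_eq0.
  pose r := complex.Re d / 2.
  have dr : d = toC (2 * r).
    by rewrite mulrC divfK ?pnatr_eq0 // RRe_real // ger0_real // ltW.
  have r0 : 0 < r by move: d0; rewrite dr ltcR pmulr_rgt0.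
  (* The polygon centred at 0 and starting at r, whose successive turns are the q_j^2. *)
  pose v (i : 'I_m.+2) : C := toC r * \prod_(j < m.+1 | (j < i)%N) q j ^+ 2.
  have vr i : Normc.normc (v i - 0) = r.
    apply: (@complexI R); rewrite -[LHS]/(`|v i - 0| : C) subr0 normrM.
    rewrite (normr_prod) big1 => [|j _]; last by rewrite normrX q1 expr1n.
    by rewrite mulr1 ger0_norm // lecR ltW.
  have vmax : v ord_max - 0 = - (v ord0 - 0).
    rewrite !subr0 /v [X in - (_ * X)]big_pred0 // mulr1.
    rewrite (eq_bigl xpredT); last by move=> j; rewrite ltn_ord.
    by rewrite prodrXl qprod sqrCi mulrN1.
  have turnE j : q j ^+ 2 = turn v 0 j.
    have rC : toC r != 0 by rewrite fmorph_eq0 gt_eqF.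
    have v0 i : v i != 0.
      by apply: mulf_neq0 => //; apply/prodf_neq0 => k _; rewrite expf_neq0.
    rewrite /turn !subr0; apply: (canRL (mulfK (v0 _))).
    rewrite mulrCA /v [in RHS](bigD1 j) /= ?lift0 ?ltnS //; congr (_ * (_ * _)).
    apply: eq_bigl => k; rewrite /bump (leqNgt m.+1) ltn_ord /= add0n add1n ltnS (ltn_neqAle k j).
    by rewrite andbC.
  have d2 : d ^+ 2 = toC (4 * r ^+ 2) by rewrite dr -rmorphXn exprMn -natrX.
  rewrite -(semicyclic_eval _ r0 vr vmax d2 turnE qprod) pv ?rmorph0 //.
  by exists 0, r.
have z0 := turn_neq0 r0 vr.
apply: (@complexI R); rewrite (@semicyclic_eval v c r p (sqrtC (toC (4 * r ^+ 2)))
  (half_arcs (turn v c))) ?p0 ?meval0 ?rmorph0 ?sqrtCK //.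
- by move=> j; apply: half_arcs_sqr => //; exact: prod_turn r0 vr vmax.
- exact: half_arcs_prod z0.
Qed.

End Polygons.

(** * Irreducibility, uniqueness and weighted degree *)

Section Kernel.
Variables (A T : idomainType) (f : {rmorphism A -> T}) (w : T).

(** The kernel is prime since T is a domain: one factor of [al] lies in it and is thus a multiple of
    [al], which makes the other factor a unit. *)
Lemma kernel_irreducible (al : {poly A}) : al != 0 -> ev f w al = 0 ->
  (forall p, ev f w p = 0 -> exists q, p = q * al) -> irreducible_elt al.
Proof.
move=> al0 alK alP.
have cofactor q r : al = q * r -> ev f w q = 0 -> r \is a GRing.unit.
  move=> alE /alP[s sE]; apply/unitrP; exists s.
  suff : s * r = 1 by move=> E; split; rewrite // mulrC.
  by apply: (mulIf al0); rewrite mul1r {2}alE sE; rewrite -!mulrA [r * al]mulrC.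
split=> //; last first.
  move=> q r alE; move: (alK); rewrite alE rmorphM => /eqP; rewrite mulf_eq0.
  case/orP=> /eqP E; first by right; apply: cofactor alE E.
  by left; apply: (@cofactor r q) => //; rewrite mulrC.
apply/negP => /divrr E; have /eqP : ev f w 1 = 0.
  by rewrite -E rmorphM alK mul0r.
by rewrite rmorph1 oner_eq0.
Qed.

Lemma kernel_monic_irreducible (al be : {poly A}) : al \is monic -> be \is monic ->
  irreducible_elt al -> irreducible_elt be -> ev f w be = 0 ->
  (forall p, ev f w p = 0 -> exists q, p = q * al) -> be = al.
Proof.
move=> alm bem [_ /negP alU _] [_ _ beI] beK alP.
have [q beE] := alP _ beK; case: (beI _ _ beE) => // qU.
have [c qE] : exists c, q = c%:P.
  by move: qU; rewrite poly_unitE => /andP[/size_poly1P[c _ ->] _]; exists c.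
have := monicP bem; rewrite beE qE lead_coefM lead_coefC (monicP alm) mulr1 => ->.
by rewrite polyC1 mul1r.
Qed.

End Kernel.

Lemma irreducible_iso (A B : idomainType) (f : {rmorphism A -> B}) (g : {rmorphism B -> A}) a :
  cancel f g -> cancel g f -> irreducible_elt a -> irreducible_elt (f a).
Proof.
move=> fK gK [a0 aU aI]; split.
- by apply: contraNneq a0 => fa0; rewrite -[a]fK fa0 rmorph0.
- by apply: contra aU => /(rmorph_unit g); rewrite fK.
move=> q r E; have := aI (g q) (g r); rewrite -rmorphM -E fK => /(_ erefl).
by case=> /(rmorph_unit f); rewrite gK; [left | right].
Qed.

Section WeightedDegree.
Variable n : nat.
Local Notation wdeg := (@wdeg n).

Lemma wdegU i : wdeg U_(i)%MM = if i == ord0 then 2 else 1.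
Proof.
rewrite /Defs.wdeg (bigD1 i) //= mnmE eqxx mul1n big1 ?addn0 // => j ji.
by rewrite mnmE eq_sym (negbTE ji).
Qed.

Lemma dhomog_shift_var d (a : {mpoly int[n]}) : a \is d.-homog ->
  shift_var a \is d.-homog for wdeg.
Proof.
have X1 j : shift_var ('X_j : {mpoly int[n]}) \is 1.-homog for wdeg.
  by rewrite shift_varX dhomogX; apply/eqP; exact: wdegU.
move=> /dhomogP ad; rewrite [a]mpolyE rmorph_sum big_seq rpred_sum // => k /ad kd.
have {kd} <- : mdeg k = d by [].
rewrite -mul_mpolyC rmorphM shift_varC mul_mpolyC; apply: dhomogZ.
rewrite mpolyXE_id rmorph_prod mdegE.
apply: (big_ind2 (fun (p : {mpoly int[n.+1]}) (e : nat) => p \is e.-homog for wdeg)).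
- exact: dhomog1.
- by move=> p e q e' pe qe; apply: dhomogM.
by move=> j _; rewrite rmorphXn; have := dhomogMn (k j) (X1 j); rewrite mul1n.
Qed.

Lemma dhomog_of_poly d (al : {poly {mpoly int[n]}}) : size al = d.+1 ->
  (forall k, (k < size al)%N -> al`_k \is (2 * (d - k)).-homog) ->
  of_poly al \is (2 * d).-homog for wdeg.
Proof.
move=> sz alh; rewrite -[of_poly al]/(ev shift_var 'X_ord0 al) evE.
apply: rpred_sum => k _.
have kd : (k <= d)%N by rewrite -ltnS -sz.
have -> : (2 * d = 2 * (d - k) + 2 * k)%N by rewrite -mulnDr subnK.
apply: dhomogM; first by apply: dhomog_shift_var; exact: alh.
by apply: dhomogMn; rewrite dhomogX; apply/eqP; exact: wdegU.
Qed.

Lemma dhomog_total_wdegree d (p : {mpoly int[n.+1]}) :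
  p != 0 -> p \is d.-homog for wdeg -> total_wdegree p = d.
Proof.
move=> p0 pd; have := dhomog_msize pd; move/dhomogP: pd => pd /dhomogP pd'.
have := p0; rewrite -msupp_eq0; case E : (msupp p) => [//|k s] _.
have kp : k \in msupp p by rewrite E mem_head.
by have := pd' _ kp; rewrite (pd _ kp) => ->.
Qed.

End WeightedDegree.

Theorem theorem3 (R : realType) (n : nat) (hn : (2 <= n)%N) :
  exists alpha : {mpoly int[n.+1]},
    [/\ semicyclic_area_poly R alpha,
        forall beta : {mpoly int[n.+1]},
          semicyclic_area_poly R beta -> beta = alpha
      & (total_wdegree alpha)%:R = 2 * Delta' n].
Proof.
case: n hn => [//|m] m_gt0.
have [al [alm alK alP]] := area_minpoly R[i] m_gt0.
have alI := kernel_irreducible (monic_neq0 alm) alK alP.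
have al2 := minpoly_size_gt1 m_gt0 alm alK.
set d := (size al).-1.
have sz : size al = d.+1 by rewrite /d prednK // ltnW.
have alh := dhomog_of_poly sz (homog_area alm alK alP).
have al0 : of_poly al != 0.
  by apply: contraNneq (monic_neq0 alm) => E; rewrite -[al]of_polyK E rmorph0.
(* Since u has weight 2, the weighted degree is 2 d. It is squeezed between the lower bound for 2
   deg S, where deg S <= d, and the upper bound for alpha. *)
have dE : (2 * d = m.+1 * 'C(m, m./2))%N.
  apply/eqP; rewrite eqn_leq (area_degree_le m_gt0 alP) /=.
  have [S [Sm SK SP]] := diam_minpoly R[i] m_gt0.
  have S2 := minpoly_size_gt1 m_gt0 Sm SK.
  have sS : size S = (size S).-1.+1 by rewrite prednK // ltnW.
  have := size_diam_area m_gt0 alm alK alP SP; rewrite sz sS ltnS => Sal.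
  apply: leq_trans (_ : 2 * (size S).-1 <= _)%N; last by rewrite leq_mul2l.
  apply: (diam_degree_ge Sm sS SK) => k; rewrite -sS => kS.
  by have := homog_diam Sm SK SP kS; rewrite mul1n.
exists (of_poly al); split.
- split.
  + exact: irreducible_iso (@of_polyK _ _) (@to_polyK _ _) alI.
  + by rewrite /monic_in_first poly_in_firstE of_polyK.
  + exact: homogE alh.
  + by apply/vanishes_on_semicyclicP; rewrite of_polyK.
- move=> be [beI bem _ /vanishes_on_semicyclicP beK].
  move: bem; rewrite /monic_in_first poly_in_firstE => bem.
  rewrite -[be]to_polyK; congr (of_poly _).
  apply: kernel_monic_irreducible alm bem alI _ beK alP.
  exact: irreducible_iso (@to_polyK _ _) (@of_polyK _ _) beI.
rewrite (dhomog_total_wdegree al0 alh) dE natrM /Delta' /= mulrA.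
by congr (_ * _); field.
Qed.
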